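(* Let $\Omega, I \subset \mathbb{R}$ be open intervals containing $0$ and let $f : \Omega \times I \to \mathbb{R}$, $$f(x;\mu) = \begin{cases} f_L(x;\mu), & x \le 0, \\ f_R(x;\mu), & x \ge 0, \end{cases}$$ be piecewise-$C^3$ with $f_L(0;\mu) = f_R(0;\mu)$ for all $\mu \in I$ and $f_L(0;0) = f_R(0;0) = 0$. Let $a_L = \frac{\partial f_L}{\partial x}(0;0)$, $a_R = \frac{\partial f_R}{\partial x}(0;0)$ and $\beta = \frac{\partial f_L}{\partial \mu}(0;0) = \frac{\partial f_R}{\partial \mu}(0;0)$. Suppose $\beta > 0$, $a_R < -1$, and $\frac{1}{a_R} < a_L < 0$. Let $\nu(\mu) = f(0;\mu)$, and for $\nu, s_L, s_R, t \in \mathbb{R}$ let $$g(y;\nu,s_L,s_R,t) = \begin{cases} \nu + s_L y + t y^2, & y \le 0, \\ \nu + s_R y, & y \ge 0. \end{cases}$$ Then there exist $\mu_0 > 0$, continuous functions $s_L(\mu) = a_L + O(\mu)$, $s_R(\mu) = a_R + O(\mu)$, and $t(\mu)$, and neighbourhoods $N$ and $M(\mu)$ of $0$, such that for $\tilde{g}(y;\mu) = g(y;\nu(\mu),s_L(\mu),s_R(\mu),t(\mu))$: (i) if $\mu \in (-\mu_0,0]$, then $f$ on $N$ and $\tilde{g}$ on $M(\mu)$ are differentiably conjugate; (ii) if $\mu \in (0,\mu_0)$, then $f$ on $N$ and $\tilde{g}$ on $M(\mu)$ are differentiably conjugate on the basins of repulsion of their fixed points, and on the basins of attraction of their period-two solutions.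 Moreover, for any $\delta > 0$ we can choose $\mu_0 > 0$, $N = (-p,p)$, and $M(\mu) = (q^-(\mu),q^+(\mu))$ so that $$(1-\delta)\, p < \left| q^\pm(\mu) \right| < (1+\delta)\, p$$ for all $\mu \in (-\mu_0,\mu_0)$.
   Context: Piecewise-$C^k$: $f_L$ (defined for $x \le 0$) and $f_R$ (defined for $x \ge 0$) are $C^k$ functions of $(x;\mu)$ that can be smoothly extended to a neighbourhood of $x=0$, so their derivatives at $x=0$ are well-defined. Conjugacy: let $F : \Omega \to \mathbb{R}$ and $G : \Psi \to \mathbb{R}$ be continuous maps on open intervals, $U \subset \Omega$, $V \subset \Psi$. Then $F$ on $U$ and $G$ on $V$ are topologically conjugate if there is a homeomorphism $h : U \to V$ such that $h(F(x)) = G(h(x))$ for all $x \in U$ for which $F(x) \in U$. If $h$ is also a diffeomorphism, then $F$ on $U$ and $G$ on $V$ are differentiably conjugate. (Here, for each fixed $\mu$, $F = f(\cdot\,;\mu)$ and $G = \tilde g(\cdot\,;\mu)$; $N$ does not depend on $\mu$.) Invariant sets: under the hypotheses, for all sufficiently small $\mu > 0$ the map $f(\cdot\,;\mu)$ has a locally (near $0$) unique fixed point $x_R(\mu) > 0$, which is unstable, and a locally unique period-two solution $\{u_L(\mu),u_R(\mu)\}$ with $u_L(\mu) < 0 < u_R(\mu)$, which is stable. Likewise $\tilde g(\cdot\,;\mu)$ has a locally unique fixed point $y_R(\mu) > 0$ and a locally unique period-two solution $\{v_L(\mu),v_R(\mu)\}$ with $v_L(\mu) < 0 < v_R(\mu)$.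 These are the fixed points and period-two solutions referred to in (ii). ''Basin of attraction'' (points whose forward orbits converge to the stable invariant set) and ''basin of repulsion'' (points whose backward orbits converge to the unstable fixed point) have their usual meanings; near $0$ the maps are strictly decreasing and hence locally invertible. *)

(* Defs.v *)
From HB Require Import structures.
From mathcomp Require Import all_boot all_order all_algebra.
From mathcomp Require Import all_classical all_reals all_analysis.
Set Implicit Arguments.
Unset Strict Implicit.
Unset Printing Implicit Defensive.
Import Order.TTheory GRing.Theory Num.Theory.
Import numFieldNormedType.Exports.
Local Open Scope classical_set_scope.
Local Open Scope ring_scope.

(* MathComp-Analysis, over an arbitrary R : realType.  Maps defined on an open
   subset of R are total functions; their domain is a separate set argument. *)

Definition pderiv_x (R : realType) (F : R * R -> R) : R * R -> R :=
  'D_((1, 0) : R * R) F.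

Definition pderiv_mu (R : realType) (F : R * R -> R) : R * R -> R :=
  'D_((0, 1) : R * R) F.

(* Class C^k on U (meaningful for U open): all partial derivatives of order at
   most k exist on U and are jointly continuous there. *)
Fixpoint C_on (R : realType) (k : nat) (U : set (R * R)) (F : R * R -> R)
    : Prop :=
  {in U, continuous F} /\
  match k with
  | 0 => True
  | k'.+1 =>
    [/\ {in U, forall z : R * R, derivable F z ((1, 0) : R * R)},
        {in U, forall z : R * R, derivable F z ((0, 1) : R * R)},
        C_on k' U (pderiv_x F) & C_on k' U (pderiv_mu F)]
  end.

(* fL and fR stand for the extended pieces: each is C^k on an open set of
   (x, mu) containing its closed half of Omega x I, hence a neighbourhood of
   {0} x I. *)
Definition piecewise_C (R : realType) (k : nat) (Omega I : set R)
    (fL fR : R * R -> R) (f : R -> R -> R) : Prop :=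
  [/\ exists U : set (R * R),
        [/\ open U,
            [set z : R * R | [/\ Omega z.1, I z.2 & z.1 <= 0]] `<=` U
          & C_on k U fL],
      exists U : set (R * R),
        [/\ open U,
            [set z : R * R | [/\ Omega z.1, I z.2 & 0 <= z.1]] `<=` U
          & C_on k U fR],
      forall x mu : R, Omega x -> I mu -> x <= 0 -> f x mu = fL (x, mu)
    & forall x mu : R, Omega x -> I mu -> 0 <= x -> f x mu = fR (x, mu)].

Definition normal_form (R : realType) (nu sL sR t y : R) : R :=
  if y <= 0 then nu + sL * y + t * y ^+ 2 else nu + sR * y.

Definition homeomorphism_on (R : realType) (U V : set R) (h k : R -> R)
    : Prop :=
  [/\ {within U, continuous h} /\ {within V, continuous k},
      forall x, U x -> V (h x) /\ k (h x) = x
    & forall y, V y -> U (k y) /\ h (k y) = y].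

(* Two-sided derivatives: only meant for open U. *)
Definition C1_on (R : realType) (U : set R) (h : R -> R) : Prop :=
  {in U, forall x : R, derivable h x 1} /\ {within U, continuous (derive1 h)}.

Definition diffeomorphism_on (R : realType) (U V : set R) (h k : R -> R)
    : Prop :=
  [/\ homeomorphism_on U V h k, C1_on U h & C1_on V k].

Definition differentiably_conjugate (R : realType)
    (F : R -> R) (U : set R) (G : R -> R) (V : set R) : Prop :=
  exists h k : R -> R, diffeomorphism_on U V h k /\
    forall x, U x -> U (F x) -> h (F x) = G (h x).

Definition fixed_points (R : realType) (F : R -> R) (N : set R) : set R :=
  [set x | N x /\ F x = x].

Definition period_two_points (R : realType) (F : R -> R) (N : set R) : set R :=
  [set x | [/\ N x, N (F x), F x <> x & F (F x) = x]].

(* Convergence of the orbit to the set A is dist(F^n(x), A) -> 0.  The orbit has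
   to remain in the domain D of F, but may leave the neighbourhood on which the
   conjugacy is considered. *)
Definition basin_of_attraction (R : realType) (F : R -> R) (D A : set R)
    : set R :=
  [set x | (forall n, D (iter n F x)) /\
    forall eps : R, 0 < eps ->
      \forall n \near \oo, exists2 a, A a & `|iter n F x - a| < eps].

(* The backward orbit is taken in N because inverses are local ones. *)
Definition basin_of_repulsion (R : realType) (F : R -> R) (N : set R) (z : R)
    : set R :=
  [set x | exists w : nat -> R,
    [/\ w 0%N = x, forall n, N (w n), forall n, F (w n.+1) = w n
      & w @ \oo --> z]].

(* Conclusions (i) and (ii).  D and E are the domains of the maps f mu and
   g mu.  Uniqueness of the fixed points and of the period-two solutions in N
   and M mu is what identifies the invariant sets whose basins are used. *)
Definition local_conjugacies (R : realType) (D E : set R)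
    (f g : R -> R -> R) (mu0 : R) (N : set R) (M : R -> set R) : Prop :=
  (forall mu : R, - mu0 < mu <= 0 ->
     differentiably_conjugate (f mu) N (g mu) (M mu)) /\
  (forall mu : R, 0 < mu < mu0 ->
     exists xR uL uR yR vL vR : R,
     [/\ [/\ 0 < xR, fixed_points (f mu) N = [set xR],
             uL < 0 < uR & period_two_points (f mu) N = [set uL; uR]],
         [/\ 0 < yR, fixed_points (g mu) (M mu) = [set yR],
             vL < 0 < vR & period_two_points (g mu) (M mu) = [set vL; vR]],
         differentiably_conjugate
           (f mu) (N `&` basin_of_repulsion (f mu) N xR)
           (g mu) (M mu `&` basin_of_repulsion (g mu) (M mu) yR)
       & differentiably_conjugate
           (f mu) (N `&` basin_of_attraction (f mu) D [set uL; uR])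
           (g mu) (M mu `&` basin_of_attraction (g mu) E [set vL; vR])]).

Definition conjugate_to_normal_form (R : realType) (Omega I : set R)
    (f : R -> R -> R) (sL sR t : R -> R) (mu0 : R) (N : set R) (M : R -> set R)
    : Prop :=
  [/\ 0 < mu0 /\ `]- mu0, mu0[ `<=` I,
      [/\ {in `]- mu0, mu0[, continuous sL}, {in `]- mu0, mu0[, continuous sR}
        & {in `]- mu0, mu0[, continuous t}],
      open_nbhs 0 N /\ N `<=` Omega,
      (forall mu : R, - mu0 < mu < mu0 -> open_nbhs 0 (M mu))
    & local_conjugacies Omega setT (fun mu x => f x mu)
        (fun mu => normal_form (f 0 mu) (sL mu) (sR mu) (t mu)) mu0 N M].

(* Main.v *)
(** Fix mu.  Near 0 both f and the normal form g are decreasing, with slopes bounded by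
    al <= -f' <= al' < 1 on the left and 1 < ga <= -f' <= ga' on the right, al' ga' < 1.
    The Koenigs coordinate phi = lim lam^-n (F^n - u), with F = f^2 (F = f^-2 for the
    basin of repulsion), linearises F at its fixed point u, and psi does so for g.  When
    the multipliers agree, h = psi^-1 (c phi) conjugates F to the corresponding power of
    g; the constant c is fixed by h 0 = 0, and h conjugates f to g because f and g
    act linearly in these coordinates.  Near u the map h is C^1, and the functional
    equation spreads this over the basin; at the preimages of the kink it needs the
    two one-sided slopes at 0 to have the same ratio for f and g.

    Hence s_L, s_R and t have to match the ratio of the slopes at the kink, the multiplier
    of the fixed point and, for mu > 0, the multiplier of the two-cycle.  For mu > 0
    these equations determine all three, and C^3 smoothness yields a limit t0 of t as mu
    decreases to 0; for mu <= 0 the remaining freedom is used to make t tend to t0.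

    For the last claim, h is close to the identity on the scale of mu, because phi and psi
    are, and the bound |h x - x| <= M x^2, with M independent of mu, propagates along
    backward orbits of f^2 because (al' ga')^2 < al ga. *)

(* Two obstacles shape the proof. The conjugacy [h] is known only through functional equations, so
   its regularity is carried by strict (two-point) derivatives: they pass to limits of iterates, can
   be taken one side at a time and glued at the kink, and their existence on an open set already
   gives C^1. And constants must be uniform in mu, although the fixed point and the two-cycle
   collapse onto the kink as mu tends to 0. The branches are therefore replaced by extensions to the
   whole line with fixed slope bounds and a fixed Lipschitz constant [K] of the derivative, and the
   size estimates depend on these numbers alone. Hence the order of the choices: [M] from the
   bounds, then [p] from [M] and delta, then [mu0] from [p].

   For mu > 0 two maps are needed, since [h 0 = 0] uses up the only free constant and the
   coordinates at the two-cycle and at the fixed point generally give different maps. The one built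
   at the two-cycle defines M(mu) by its values at -p and p; the other lives between the two points
   of the cycle, which the first one already places inside M(mu). *)
Require Import Defs.
From HB Require Import structures.
From mathcomp Require Import all_boot all_order all_algebra.
From mathcomp Require Import all_classical all_reals all_analysis.
From mathcomp Require Import ring lra.
Import Order.TTheory GRing.Theory Num.Theory.
Import numFieldNormedType.Exports.
Local Open Scope classical_set_scope.
Local Open Scope ring_scope.
Set Implicit Arguments.
Unset Strict Implicit.
Unset Printing Implicit Defensive.

(** * Strict derivatives *)

Section StrictDerivative.
Variable R : realType.
Implicit Types (f g h k : R -> R) (S T : set R) (x y z d e : R).

(** The two-point (strict) derivative. Taking both points in [S] lets one-sided derivatives at a
    kink obey the same calculus as ordinary ones. *)
Definition sdiff_in S f x d := forall e, 0 < e -> exists2 r : R, 0 < r &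
  forall y z, S y -> S z -> `|y - x| < r -> `|z - x| < r ->
    `|f y - f z - d * (y - z)| <= e * `|y - z|.

(* A function strictly differentiable at every point of an open set is C^1 there. *)
Definition sdiff f x d := sdiff_in setT f x d.

Lemma sdiff_inW S T f x d : S `<=` T -> sdiff_in T f x d -> sdiff_in S f x d.
Proof.
move=> ST fd e e0; have [r r0 H] := fd e e0.
by exists r => // y z Sy Sz; apply: H; exact: ST.
Qed.

Lemma sdiff_in_local S f g x d r : 0 < r ->
  (forall y, S y -> `|y - x| < r -> f y = g y) ->
  sdiff_in S f x d -> sdiff_in S g x d.
Proof.
move=> r0 fg fd e e0; have [s s0 H] := fd e e0.
exists (Num.min r s); first by rewrite lt_min r0.
move=> y z Sy Sz; rewrite !lt_min => /andP[yr ys] /andP[zr zs].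
by rewrite -!fg//; exact: H.
Qed.

Lemma sdiff_in_lip S f x d : sdiff_in S f x d -> exists2 r : R, 0 < r &
  forall y z, S y -> S z -> `|y - x| < r -> `|z - x| < r ->
    `|f y - f z| <= (`|d| + 1) * `|y - z|.
Proof.
move=> fd; have [r r0 H] := fd 1 ltr01; exists r => // y z Sy Sz yr zr.
have := H y z Sy Sz yr zr; rewrite mul1r => H1.
have -> : f y - f z = (f y - f z - d * (y - z)) + d * (y - z) by ring.
by rewrite (le_trans (ler_normD _ _))// normrM mulrDl mul1r addrC lerD2l.
Qed.

Lemma sdiff_in_comp S T f g x d e : S x -> (forall y, S y -> T (f y)) ->
  sdiff_in S f x d -> sdiff_in T g (f x) e ->
  sdiff_in S (g \o f) x (e * d).
Proof.
move=> Sx ST fd ge eps eps0; have [r1 r10 L] := sdiff_in_lip fd.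
have d1 : 0 < `|d| + 1 by rewrite ltr_wpDl.
have e1 : 0 < `|e| + 1 by rewrite ltr_wpDl.
have [r2 r20 H2] := ge (eps / 2 / (`|d| + 1)) (divr_gt0 (divr_gt0 eps0 (ltr0Sn _ _)) d1).
have [r3 r30 H3] := fd (eps / 2 / (`|e| + 1)) (divr_gt0 (divr_gt0 eps0 (ltr0Sn _ _)) e1).
exists (Num.min r1 (Num.min r3 (r2 / (`|d| + 1)))).
  by rewrite !lt_min r10 r30 divr_gt0.
move=> y z Sy Sz; rewrite !lt_min ltr_pdivlMr// ltr_pdivlMr//.
move=> /andP[y1 /andP[y3 y2]] /andP[z1 /andP[z3 z2]].
have x1 : `|x - x| < r1 by rewrite subrr normr0.
have fy : `|f y - f x| < r2.
  by rewrite (le_lt_trans (L y x Sy Sx y1 x1))// mulrC.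
have fz : `|f z - f x| < r2.
  by rewrite (le_lt_trans (L z x Sz Sx z1 x1))// mulrC.
have A := H2 _ _ (ST _ Sy) (ST _ Sz) fy fz.
have B := H3 _ _ Sy Sz y3 z3.
have C := L _ _ Sy Sz y1 z1.
rewrite /comp.
have -> : g (f y) - g (f z) - e * d * (y - z) =
  (g (f y) - g (f z) - e * (f y - f z)) + e * (f y - f z - d * (y - z)) by ring.
rewrite (le_trans (ler_normD _ _))// normrM.
have -> : eps * `|y - z| = eps / 2 * `|y - z| + eps / 2 * `|y - z| by field.
apply: lerD.
  apply: (le_trans A); rewrite -mulrA ler_wpM2l//; first by rewrite divr_ge0// ltW.
  by rewrite mulrC ler_pdivrMr// mulrC.
apply: (@le_trans _ _ ((`|e| + 1) * (eps / 2 / (`|e| + 1) * `|y - z|))).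
  by apply: ler_pM => //; rewrite lerDl.
by rewrite mulrA mulrCA divff ?gt_eqF// mulr1.
Qed.

(** For points on opposite sides of [x], insert [x]: the two increments have the same sign, so their
    lengths add up to that of [y - z] and no constant is lost. *)
Lemma sdiff_glue f x d : sdiff_in [set y | y <= x] f x d ->
  sdiff_in [set y | x <= y] f x d -> sdiff f x d.
Proof.
move=> L U e e0; have [r r0 HL] := L e e0; have [s s0 HU] := U e e0.
exists (Num.min r s); first by rewrite lt_min r0.
have xx t : 0 < t -> `|x - x| < t by rewrite subrr normr0.
suff W y z : y <= z -> `|y - x| < Num.min r s -> `|z - x| < Num.min r s ->
    `|f y - f z - d * (y - z)| <= e * `|y - z|.
  move=> y z _ _ yr zr; have [yz|/ltW zy] := leP y z; first exact: W.
  rewrite -normrN (distrC y z); set a := (X in `|X|).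
  have -> : a = f z - f y - d * (z - y) by rewrite /a; ring.
  exact: W.
rewrite !lt_min => yz /andP[yr ys] /andP[zr zs].
have [zx|xz] := leP z x; first by apply: HL => //=; exact: le_trans zx.
have [xy|yx] := leP x y; first by apply: HU => //=; exact: ltW.
have A := HL y x (ltW yx) (lexx x) yr (xx _ r0).
have B := HU x z (lexx x) (ltW xz) (xx _ s0) zs.
have -> : f y - f z - d * (y - z) =
  (f y - f x - d * (y - x)) + (f x - f z - d * (x - z)) by ring.
rewrite (le_trans (ler_normD _ _))//.
move: A B; rewrite (ltr0_norm (_ : y - x < 0)) ?subr_lt0//.
rewrite (ltr0_norm (_ : x - z < 0)) ?subr_lt0//.
rewrite (ltr0_norm (_ : y - z < 0)) ?subr_lt0 ?(lt_trans yx)//.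
lra.
Qed.

(** Differentiates [h] as a branch of the inverse of [g] applied to [g \o h], without inverting [g].
    This is how regularity of [h] is read off its functional equation. *)
Lemma sdiff_in_div S T g h x c e : S x -> (forall y, S y -> T (h y)) ->
  {for x, continuous h} -> c != 0 ->
  sdiff_in T g (h x) c -> sdiff_in S (g \o h) x e -> sdiff_in S h x (e / c).
Proof.
move=> Sx ST hc c0 gc he eps eps0.
have cp : 0 < `|c| by rewrite normr_gt0.
have d1 : 0 < `|e / c| + 1 by rewrite ltr_wpDl.
have [r1 r10 H1] := gc (`|c| / 2) (divr_gt0 cp (ltr0Sn _ _)).
pose K := 2 / `|c| * (`|e| + 1).
have K0 : 0 < K by rewrite /K mulr_gt0 ?divr_gt0// ltr_wpDl.
have [r2 r20 H2] := gc (eps * `|c| / 2 / K)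
  (divr_gt0 (divr_gt0 (mulr_gt0 eps0 cp) (ltr0Sn _ _)) K0).
have [r3 r30 L3] := sdiff_in_lip he.
have [r4 r40 H4] := he (eps * `|c| / 2) (divr_gt0 (mulr_gt0 eps0 cp) (ltr0Sn _ _)).
have r120 : 0 < Num.min r1 r2 by rewrite lt_min r10.
have := hc _ (nbhsx_ballx (h x) _ r120).
rewrite nbhs_simpl => /nbhs_ballP[s /= s0 Hs].
exists (Num.min s (Num.min r3 r4)); first by rewrite !lt_min s0 r30.
move=> y z Sy Sz; rewrite !lt_min => /andP[ys /andP[y3 y4]] /andP[zs /andP[z3 z4]].
have := Hs y; rewrite /ball/= distrC => /(_ ys); rewrite distrC lt_min => /andP[hy1 hy2].
have := Hs z; rewrite /ball/= distrC => /(_ zs); rewrite distrC lt_min => /andP[hz1 hz2].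
have A1 := H1 _ _ (ST _ Sy) (ST _ Sz) hy1 hz1.
have A2 := H2 _ _ (ST _ Sy) (ST _ Sz) hy2 hz2.
have A3 := L3 _ _ Sy Sz y3 z3.
have A4 := H4 _ _ Sy Sz y4 z4.
(* A Lipschitz bound for [h] comes first: the error term of [g] is at most half of the main term and
   is absorbed on the left. *)
have lh : `|h y - h z| <= K * `|y - z|.
  have B : `|c| * `|h y - h z| <=
      `|g (h y) - g (h z)| + `|c| / 2 * `|h y - h z|.
    rewrite -normrM; have -> : c * (h y - h z) = (g (h y) - g (h z))
      - (g (h y) - g (h z) - c * (h y - h z)) by ring.
    by rewrite (le_trans (ler_normB _ _))// lerD2l.
  have B2 : `|c| / 2 * `|h y - h z| <= (`|e| + 1) * `|y - z|.
    by move: A3; rewrite /comp => A3; lra.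
  have -> : K * `|y - z| = ((`|e| + 1) * `|y - z|) / (`|c| / 2).
    by rewrite /K; field; rewrite normr_eq0.
  by rewrite ler_pdivlMr ?divr_gt0// mulrC.
have E : h y - h z - e / c * (y - z) =
   ((g \o h) y - (g \o h) z - e * (y - z) -
   (g (h y) - g (h z) - c * (h y - h z))) / c by rewrite /comp; field.
rewrite E normrM normfV ler_pdivrMr//.
rewrite (le_trans (ler_normB _ _))//.
have -> : eps * `|y - z| * `|c| = eps * `|c| / 2 * `|y - z| + eps * `|c| / 2 * `|y - z|.
  by field.
apply: lerD => //; apply: (le_trans A2).
apply: (@le_trans _ _ (eps * `|c| / 2 / K * (K * `|y - z|))).
  by rewrite ler_wpM2l// divr_ge0 ?ltW// mulr_gt0// mulr_gt0.
by rewrite mulrA divfK// gt_eqF.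
Qed.

Lemma continuous_epsP f x : {for x, continuous f} <->
  forall e, 0 < e -> exists2 r : R, 0 < r &
    forall y, `|y - x| < r -> `|f y - f x| < e.
Proof.
split=> [fx e e0|H].
  have := fx _ (nbhsx_ballx (f x) _ e0); rewrite nbhs_simpl => /nbhs_ballP[r /= r0 Hr].
  exists r => // y yr; rewrite distrC; apply: (Hr y).
  by rewrite /ball/= distrC.
apply/cvgrPdist_lt => e e0; have [r r0 Hr] := H e e0.
apply/nbhs_ballP; exists r => //= y; rewrite /ball/= => yr.
by rewrite distrC Hr// distrC.
Qed.

Lemma is_derive_epsP f x l : is_derive x 1 f l <->
  forall e, 0 < e -> exists2 r : R, 0 < r &
    forall y, `|y - x| < r -> `|f y - f x - l * (y - x)| <= e * `|y - x|.
Proof.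
have quot (u : R) : u != 0 -> u^-1 *: ((f \o shift x) (u *: 1) - f x) - l =
    u^-1 * (f (u + x) - f x - l * (u + x - x)).
  by move=> h0; rewrite /shift/= /GRing.scale/= mulr1; field.
split=> [|H].
  case=> dfx <- e e0.
  move/cvgrPdist_lt: dfx => /(_ e e0); rewrite near_withinE => /nbhs_ballP[r /= r0 Hr].
  exists r => // y yr.
  have [->|yx] := eqVneq y x; first by rewrite !subrr mulr0 subrr normr0 mulr0.
  have yx0 : y - x != 0 by rewrite subr_eq0.
  have := Hr (y - x); rewrite /ball/= sub0r normrN => /(_ yr yx0) /ltW.
  rewrite distrC /shift /= /GRing.scale /= mulr1 subrK => A.
  have -> : f y - f x - 'D_1 f x * (y - x) =
    ((y - x)^-1 * (f y - f x) - 'D_1 f x) * (y - x).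
    by field.
  by rewrite normrM ler_wpM2r.
suff C : (fun u : R => u^-1 *: ((f \o shift x) (u *: 1) - f x)) @ 0^' --> l.
  split; first by apply/cvg_ex; exists l.
  exact: cvg_lim C.
apply/cvgrPdist_le => e e0; have [r r0 Hr] := H e e0.
rewrite near_withinE; apply/nbhs_ballP; exists r => //= u.
rewrite /ball/= sub0r normrN => hr h0; rewrite distrC quot//.
have := Hr (u + x); rewrite addrK => /(_ hr) A.
by rewrite normrM normfV ler_pdivrMl ?normr_gt0// [leRHS]mulrC.
Qed.

Lemma sdiff_is_derive f x d : sdiff f x d -> is_derive x 1 f d.
Proof.
move=> fd; apply/is_derive_epsP => e e0; have [r r0 H] := fd e e0.
by exists r => // y yr; apply: H => //; rewrite subrr normr0.
Qed.

Lemma sdiff_continuous f x d : sdiff f x d -> {for x, continuous f}.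
Proof.
move=> fd; apply/continuous_epsP => e e0; have [r r0 H] := sdiff_in_lip fd.
have d1 : 0 < `|d| + 1 by rewrite ltr_wpDl.
exists (Num.min r (e / (`|d| + 1))); first by rewrite lt_min r0 divr_gt0.
move=> y; rewrite lt_min ltr_pdivlMr// mulrC => /andP[yr ye].
by rewrite (le_lt_trans _ ye)// H// subrr normr0.
Qed.

Lemma sdiff_uniq f x d d' K r : 0 < r -> sdiff f x d ->
  (forall y z, `|y - x| < r -> `|z - x| < r ->
    `|f y - f z - d' * (y - z)| <= K * `|y - z|) -> `|d - d'| <= K.
Proof.
move=> r0 fd H; apply/ler_addgt0Pr => e e0; have [s s0 Hs] := fd e e0.
pose t := Num.min r s / 2.
have m0 : 0 < Num.min r s by rewrite lt_min r0.
have t0 : 0 < t by rewrite divr_gt0.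
have : `|x + t - x| < Num.min r s.
  by rewrite addrC addKr gtr0_norm// /t ltr_pdivrMr// ltr_pMr// ltr1n.
rewrite lt_min => /andP[t1 t2].
have z0 u : 0 < u -> `|x - x| < u by rewrite subrr normr0.
have A := Hs (x + t) x Logic.I Logic.I t2 (z0 _ s0).
have B := H (x + t) x t1 (z0 _ r0).
have E : x + t - x = t by rewrite addrC addKr.
rewrite E (gtr0_norm t0) in A B.
have C : `|d - d'| * t <= (K + e) * t.
  rewrite -{1}(gtr0_norm t0) -normrM.
  have -> : (d - d') * t = (f (x + t) - f x - d' * t) - (f (x + t) - f x - d * t).
    by ring.
  by rewrite (le_trans (ler_normB _ _))// mulrDl lerD.
by rewrite -(ler_pM2r t0).
Qed.

(** The strict estimate at [x] holds on small balls around every nearby [y], so it also controls the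
    derivative at [y]; continuity of the derivative costs nothing. *)
Lemma sdiff_C1 U f : open U -> (forall x, U x -> exists d, sdiff f x d) -> C1_on U f.
Proof.
move=> oU H; split=> [x|].
  by rewrite inE => /H[d /sdiff_is_derive[]].
apply: continuous_in_subspaceT => x; rewrite inE => Ux.
have [d fd] := H x Ux.
have ed y : U y -> forall d', sdiff f y d' -> derive1 f y = d'.
  by move=> _ d' /sdiff_is_derive[_]; rewrite derive1E.
apply/continuous_epsP => e e0.
have [r r0 Hr] := fd (e / 2) (divr_gt0 e0 (ltr0Sn _ _)).
have := open_nbhs_nbhs (conj oU Ux) => /nbhs_ballP[s /= s0 Hs].
exists (Num.min s (r / 2)); first by rewrite lt_min s0 divr_gt0.
move=> y; rewrite lt_min => /andP[ys yr].
have Uy : U y by apply: Hs; rewrite /ball/= distrC.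
have [d' fd'] := H y Uy.
rewrite (ed y Uy _ fd') (ed x Ux _ fd).
suff : `|d' - d| <= e / 2 by move=> /le_lt_trans; apply; rewrite ltr_pdivrMr// ltr_pMr// ltr1n.
apply: (sdiff_uniq (r := r / 2) _ fd'); first by rewrite divr_gt0.
have tr a : `|a - y| < r / 2 -> `|a - x| < r.
  move=> ay; rewrite (le_lt_trans (ler_distD y _ _))//.
  by rewrite (splitr r) ltrD.
move=> a b ay bz; apply: Hr => //; exact: tr.
Qed.

Lemma sdiff_id x : sdiff id x 1.
Proof.
move=> e e0; exists 1 => // y z _ _ _ _.
by rewrite mul1r subrr normr0 mulr_ge0// ltW.
Qed.

Lemma sdiff_affine (a b : R) f x d : sdiff f x d ->
  sdiff (fun y => a * (f y - b)) x (a * d).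
Proof.
move=> fd e e0; have a1 : 0 < `|a| + 1 by rewrite ltr_wpDl.
have [r r0 H] := fd (e / (`|a| + 1)) (divr_gt0 e0 a1).
exists r => // y z Sy Sz yr zr.
have -> : a * (f y - b) - a * (f z - b) - a * d * (y - z) =
  a * (f y - f z - d * (y - z)) by ring.
rewrite normrM (le_trans (ler_wpM2l (normr_ge0 _) (H y z Sy Sz yr zr)))//.
rewrite mulrA ler_wpM2r// mulrA ler_pdivrMr// mulrC ler_wpM2l ?ltW//.
by rewrite ltrDl.
Qed.

Lemma sdiff_ext f g x d : f =1 g -> sdiff f x d -> sdiff g x d.
Proof. by move=> /funext ->. Qed.

(** Convergence is measured in the Lipschitz seminorm near [x]; it forces the derivatives [d n] to
    be Cauchy, with limit the derivative of [f]. *)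
Lemma sdiff_lim (F : nat -> R -> R) (c : nat -> R) f x (d : nat -> R) r :
  0 < r -> (forall n, sdiff (F n) x (d n)) -> c @ \oo --> (0 : R) ->
  (forall n y z, `|y - x| < r -> `|z - x| < r ->
    `|(f y - f z) - (F n y - F n z)| <= c n * `|y - z|) ->
  exists l, sdiff f x l.
Proof.
move=> r0 Fd c0 H.
have dd n m : `|d n - d m| <= c n + c m.
  apply/ler_addgt0Pr => e e0; have [s s0 Hs] := Fd m e e0.
  have m0 : 0 < Num.min r s by rewrite lt_min r0.
  apply: (sdiff_uniq m0 (Fd n)) => y z.
  rewrite !lt_min => /andP[yr ys] /andP[zr zs].
  have -> : F n y - F n z - d m * (y - z) =
    - (f y - f z - (F n y - F n z)) + (f y - f z - (F m y - F m z))
    + (F m y - F m z - d m * (y - z)) by ring.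
  rewrite (le_trans (ler_normD _ _))// !mulrDl lerD//; last exact: Hs.
  by rewrite (le_trans (ler_normD _ _))// normrN lerD// H.
have cl e : 0 < e -> \forall n \near \oo, `|c n| < e.
  move=> e0; move/cvgrPdist_lt : c0 => /(_ e e0).
  by apply: filterS => n /=; rewrite sub0r normrN.
have : cvg (d @ \oo).
  apply/cauchy_cvgP/cauchy_exP => e e0.
  have [N _ HN] := cl (e / 2) (divr_gt0 e0 (ltr0Sn _ _)).
  exists (d N); exists N => // n /= Nn; rewrite /ball/=.
  rewrite (le_lt_trans (dd _ _))// (splitr e).
  by rewrite ltrD// (le_lt_trans (ler_norm _))// HN//=.
move=> /cvg_ex[/= l dl]; exists l => e e0.
have e3 : 0 < e / 3 by rewrite divr_gt0.
have := cl _ e3; move/cvgrPdist_lt : dl => /(_ _ e3) dl cle.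
have [n [dn cn]] := filter_ex (filterI dl cle).
have [s s0 Hs] := Fd n _ e3.
exists (Num.min r s); first by rewrite lt_min r0.
move=> y z _ _; rewrite !lt_min => /andP[yr ys] /andP[zr zs].
have -> : f y - f z - l * (y - z) = (f y - f z - (F n y - F n z))
  + (F n y - F n z - d n * (y - z)) - (l - d n) * (y - z) by ring.
have -> : e * `|y - z| = e / 3 * `|y - z| + e / 3 * `|y - z| + e / 3 * `|y - z|.
  by field.
rewrite (le_trans (ler_normB _ _))// lerD//; last first.
  by rewrite normrM ler_wpM2r// ltW.
rewrite (le_trans (ler_normD _ _))// lerD//; last exact: Hs.
rewrite (le_trans (H n y z yr zr))// ler_wpM2r//.
by rewrite (le_trans (ler_norm _))// ltW.
Qed.

End StrictDerivative.

(** * Monotone bijections of the line *)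

Section MonotoneBijections.
Variable R : realType.
Implicit Types (f h : R -> R) (x y : R).

Lemma incr_surj_continuous h : {homo h : x y / x < y} ->
  (forall y, exists x, h x = y) -> continuous h.
Proof.
move=> hinc hsurj x; apply/continuous_epsP => e e0.
have [a ha] := hsurj (h x - e); have [b hb] := hsurj (h x + e).
have hle : {mono h : x y / x <= y} by exact: le_mono.
have hlt : {mono h : x y / x < y} by exact: leW_mono.
have ax : a < x by rewrite -hlt ha ltrBlDr ltrDl.
have xb : x < b by rewrite -hlt hb ltrDl.
exists (Num.min (x - a) (b - x)); first by rewrite lt_min !subr_gt0 ax.
move=> y; rewrite lt_min !ltr_norml => /andP[/andP[? ?] /andP[? ?]].
have := hinc a y; have := hinc y b; rewrite ha hb => yb ay.
have {}ay := ay ltac:(lra); have {}yb := yb ltac:(lra).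
by lra.
Qed.

Lemma slope_surj f m : 0 < m -> continuous f ->
  (forall x y, x <= y -> m * (y - x) <= f y - f x) ->
  forall y, exists x, f x = y.
Proof.
(* With slope at least [m], moving from 0 by [b] in either direction carries [f] past [y]. *)
move=> m0 fc fm y; pose b := `|y - f 0| / m.
have b0 : 0 <= b by rewrite divr_ge0// ltW.
have nb : - b <= b by lra.
have mb : m * b = `|y - f 0| by rewrite /b mulrC divfK// gt_eqF.
have H1 := fm 0 b b0; have H2 : m * (0 - - b) <= f 0 - f (- b) by apply: fm; lra.
rewrite subr0 mb in H1; rewrite sub0r opprK mb in H2.
have A : y - f 0 <= `|y - f 0| by exact: ler_norm.
have B : - `|y - f 0| <= y - f 0 by rewrite lerNl -normrN ler_norm.
have [||c _ <-] := @IVT _ f (- b) b y nb; last by exists c.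
  exact: continuous_subspaceT.
by rewrite ge_min le_max; apply/andP; split; apply/orP; [left|right]; lra.
Qed.

Lemma slope_bij f m : 0 < m -> continuous f ->
  (forall x y, x <= y -> m * (y - x) <= f x - f y) ->
  exists k, cancel f k /\ cancel k f.
Proof.
move=> m0 fc fm.
have inj x y : f x = f y -> x = y.
  move=> fxy; have [xy|/ltW yx] := leP x y; apply/eqP; rewrite eq_le.
    by have := fm _ _ xy; rewrite fxy subrr pmulr_rle0// subr_le0 xy => ->.
  by have := fm _ _ yx; rewrite fxy subrr pmulr_rle0// subr_le0 yx => ->.
have [|k fk] := @choice R R (fun y x => f x = y).
  move=> y; have [||x fx] := @slope_surj (fun x => - f x) m m0 _ _ (- y).
  - by move=> x; apply: continuousN; exact: fc.
  - by move=> a b /fm; lra.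
  - by exists x; apply: oppr_inj.
by exists k; split=> x //; apply: inj; rewrite fk.
Qed.

End MonotoneBijections.

(** * Functions with Lipschitz derivative *)

Section C11.
Variable R : realType.
Implicit Types (A B : R -> R) (x y K L : R).

(** The class C^{1,1}, written as a Taylor bound and a Lipschitz bound with one explicit constant,
    so that estimates for a family of maps can be uniform in the parameter. *)
Definition C11 K A A' :=
  (forall x y, `|A y - A x - A' x * (y - x)| <= K * (y - x) ^+ 2) /\
  (forall x y, `|A' x - A' y| <= K * `|x - y|).

Lemma C11_K_ge0 K A A' : C11 K A A' -> 0 <= K.
Proof.
by move=> [_ /(_ 1 0)]; rewrite subr0 normr1 mulr1; apply: le_trans.
Qed.

Lemma C11W K L A A' : K <= L -> C11 K A A' -> C11 L A A'.
Proof.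
move=> KL [H1 H2]; split=> x y.
  by rewrite (le_trans (H1 _ _))// ler_wpM2r// sqr_ge0.
by rewrite (le_trans (H2 _ _))// ler_wpM2r.
Qed.

(** Expand at [z] and move the derivative from [z] to [x]: the two errors are at most [2 * K * r]
    and [K * r] times the distance of the points. That the error is proportional to [r] drives
    Koenigs' iteration. *)
Lemma C11_strict K A A' x y z r : C11 K A A' -> `|y - x| <= r -> `|z - x| <= r ->
  `|A y - A z - A' x * (y - z)| <= 3 * K * r * `|y - z|.
Proof.
move=> HA yr zr; have K0 := C11_K_ge0 HA; have [H1 H2] := HA.
have -> : A y - A z - A' x * (y - z) =
  (A y - A z - A' z * (y - z)) + (A' z - A' x) * (y - z) by ring.
rewrite (le_trans (ler_normD _ _))// normrM.
have := H1 z y; have := H2 z x.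
have yz : `|y - z| <= 2 * r.
  by rewrite (le_trans (ler_distD x _ _))// (distrC x z); lra.
rewrite -(real_normK (num_real (y - z))).
set a := `|y - z| in yz *; set b := `|A' z - A' x|; set c := `|A y - _ - _|.
have a0 : 0 <= a by exact: normr_ge0.
move=> hb hc; have h1 : b <= K * r by rewrite (le_trans hb)// ler_wpM2l.
have h2 : K * a ^+ 2 <= 2 * K * r * a by have := ler_wpM2l (mulr_ge0 K0 a0) yz; lra.
have h3 : b * a <= K * r * a by rewrite ler_wpM2r.
lra.
Qed.

Lemma C11_sdiff K A A' x : C11 K A A' -> sdiff A x (A' x).
Proof.
move=> HA e e0; have K0 := C11_K_ge0 HA.
have k1 : 0 < 3 * K + 1 by lra.
exists (e / (3 * K + 1)); first by rewrite divr_gt0.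
move=> y z _ _ /ltW yr /ltW zr; rewrite (le_trans (C11_strict HA yr zr))//.
rewrite ler_wpM2r// mulrA ler_pdivrMr//; nra.
Qed.

Lemma C11_continuous K A A' : C11 K A A' -> continuous A.
Proof. by move=> HA x; exact: sdiff_continuous (C11_sdiff x HA). Qed.

Lemma C11_slope K A A' lo hi : C11 K A A' -> (forall x, lo <= A' x <= hi) ->
  forall x y, x <= y -> lo * (y - x) <= A y - A x <= hi * (y - x).
Proof.
move=> HA H x y xy.
have [||c _ ->] := @MVT_segment R A A' x y xy.
- by move=> z _; apply: sdiff_is_derive; exact: C11_sdiff HA.
- by apply: continuous_subspaceT; exact: C11_continuous HA.
have /andP[? ?] := H c; rewrite !ler_wpM2r ?subr_ge0//.
Qed.

Lemma C11_lip K A A' L : C11 K A A' -> (forall x, `|A' x| <= L) ->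
  forall x y, `|A y - A x| <= L * `|y - x|.
Proof.
move=> HA H.
have H' x : - L <= A' x <= L by rewrite -ler_norml.
suff W x y : x <= y -> `|A y - A x| <= L * `|y - x|.
  move=> x y; have [/W//|/ltW/W] := leP x y.
  by rewrite distrC [in X in _ <= X -> _]distrC.
move=> xy; rewrite ler_norml (ger0_norm (_ : 0 <= y - x)) ?subr_ge0// -mulNr.
exact: C11_slope HA H' _ _ xy.
Qed.

Lemma C11_comp K1 K2 L1 L2 A A' B B' : C11 K1 A A' -> C11 K2 B B' ->
  (forall x, `|A' x| <= L1) -> (forall x, `|B' x| <= L2) ->
  C11 (K2 * L1 ^+ 2 + L2 * K1) (B \o A) (fun x => B' (A x) * A' x).
Proof.
move=> HA HB LA LB; have lipA := C11_lip HA LA.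
have K10 := C11_K_ge0 HA; have K20 := C11_K_ge0 HB.
have L10 : 0 <= L1 := le_trans (normr_ge0 _) (LA 0).
have L20 : 0 <= L2 := le_trans (normr_ge0 _) (LB 0).
split=> x y /=.
  have -> : B (A y) - B (A x) - B' (A x) * A' x * (y - x) =
    (B (A y) - B (A x) - B' (A x) * (A y - A x)) +
    B' (A x) * (A y - A x - A' x * (y - x)) by ring.
  rewrite (le_trans (ler_normD _ _))// normrM mulrDl lerD//.
    rewrite (le_trans (HB.1 _ _))// -mulrA ler_wpM2l// -exprMn.
    rewrite -[leLHS]real_normK ?num_real// -[leRHS]real_normK ?num_real//.
    rewrite ler_sqr ?nnegrE// normrM (ger0_norm L10); exact: lipA.
  by rewrite -mulrA ler_pM//; exact: HA.1.
have -> : B' (A x) * A' x - B' (A y) * A' y =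
  (B' (A x) - B' (A y)) * A' x + B' (A y) * (A' x - A' y) by ring.
rewrite (le_trans (ler_normD _ _))// !normrM mulrDl lerD//.
  have -> : K2 * L1 ^+ 2 * `|x - y| = (K2 * (L1 * `|x - y|)) * L1 by ring.
  by rewrite ler_pM// (le_trans (HB.2 _ _))// ler_wpM2l.
by rewrite -mulrA ler_pM//; exact: HA.2.
Qed.

(** The constant is the familiar bound of |A''| / |A'|^3 for the second derivative of an inverse
    function. *)
Lemma C11_inv K A A' k m : C11 K A A' -> 0 < m -> (forall x, m <= - A' x) ->
  cancel A k -> cancel k A ->
  C11 (K / m ^+ 3) k (fun y => (A' (k y))^-1).
Proof.
move=> HA m0 H Ak kA; have K0 := C11_K_ge0 HA.
have nA x : m <= `|A' x| by rewrite -normrN (le_trans (H x))// ler_norm.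
have A0 x : A' x != 0 by rewrite -normr_gt0 (lt_le_trans m0).
have lipk x y : `|k y - k x| <= `|y - x| / m.
  rewrite ler_pdivlMr//.
  suff W a b : a <= b -> `|b - a| * m <= `|A b - A a|.
    have [/W|/ltW/W] := leP (k x) (k y); rewrite !kA//.
    by rewrite distrC [in X in _ <= X -> _]distrC.
  move=> ab; have H' z : A' z <= - m by have := H z; lra.
  have lo z : - (`|A' z| ) <= A' z by rewrite lerNl -normrN ler_norm.
  have [||c _ ->] := @MVT_segment R A A' a b ab.
  - by move=> z _; apply: sdiff_is_derive; exact: C11_sdiff HA.
  - by apply: continuous_subspaceT; exact: C11_continuous HA.
  by rewrite normrM mulrC ler_wpM2r.
split=> x y.
  have -> : k y - k x - (A' (k x))^-1 * (y - x) =
     - (A (k y) - A (k x) - A' (k x) * (k y - k x)) / A' (k x).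
    by rewrite !kA; field.
  rewrite normrM normrN normfV ler_pdivrMr; last by rewrite (lt_le_trans m0).
  rewrite (le_trans (HA.1 _ _))//.
  have -> : K * (k y - k x) ^+ 2 = K * `|k y - k x| ^+ 2.
    by rewrite real_normK// num_real.
  apply: (@le_trans _ _ (K * (`|y - x| / m) ^+ 2)).
    by rewrite ler_wpM2l// ler_sqr ?nnegrE ?divr_ge0// ltW.
  apply: (@le_trans _ _ (K / m ^+ 3 * (y - x) ^+ 2 * m)); last first.
    by rewrite ler_wpM2l// mulr_ge0 ?sqr_ge0// divr_ge0// exprn_ge0// ltW.
  rewrite exprMn real_normK ?num_real// le_eqVlt; apply/orP; left; apply/eqP.
  by field; rewrite gt_eqF.
have -> : (A' (k x))^-1 - (A' (k y))^-1 =
    (A' (k y) - A' (k x)) / (A' (k x) * A' (k y)).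
  by field; rewrite !A0.
rewrite normrM normfV normrM ler_pdivrMr; last by rewrite mulr_gt0// (lt_le_trans m0).
rewrite (le_trans (HA.2 _ _))//.
apply: (@le_trans _ _ (K * (`|x - y| / m))); first by rewrite (distrC x) ler_wpM2l ?lipk.
apply: (@le_trans _ _ (K / m ^+ 3 * `|x - y| * (m * m))); last first.
  rewrite ler_wpM2l//; first by rewrite mulr_ge0// divr_ge0// exprn_ge0// ltW.
  by rewrite ler_pM// ltW.
rewrite le_eqVlt; apply/orP; left; apply/eqP.
by field; rewrite gt_eqF.
Qed.

End C11.

(** * Koenigs linearisation *)

Section Limits.
Variable R : realType.

Lemma cvg_norm_le (v : nat -> R) (l a b : R) N : v @ \oo --> l ->
  (forall n, (N <= n)%N -> `|v n - a| <= b) -> `|l - a| <= b.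
Proof.
move=> vl H; apply/ler_addgt0Pr => e e0.
move/cvgrPdist_le : vl => /(_ e e0) vl.
have [n [Hn Nn]] := filter_ex (filterI vl (nbhs_infty_ge N)).
rewrite (le_trans (ler_distD (v n) _ _))// addrC lerD//; exact: H.
Qed.

Lemma geom_small (c th e : R) : 0 <= th < 1 -> 0 < e ->
  exists N, forall n, (N <= n)%N -> c * th ^+ n < e.
Proof.
move=> /andP[t0 t1] e0.
have : (fun n => c * th ^+ n) @ \oo --> c * 0.
  by apply: cvgMr; apply: cvg_expr; rewrite ger0_norm.
rewrite mulr0 => /cvgrPdist_lt/(_ e e0)[N _ HN]; exists N => n Nn.
by have := HN n Nn; rewrite /= sub0r normrN; apply: le_lt_trans; exact: ler_norm.
Qed.

End Limits.

Section Linearisation.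
Variable R : realType.
Implicit Types (F : R -> R) (x y u lam : R).

Definition lin_seq F u lam x n := (iter n F x - u) / lam ^+ n.

(* Koenigs' linearising coordinate at the fixed point u of F, of multiplier
   lam. *)
Definition koenigs F u lam x := lim (lin_seq F u lam x @ \oo).

Lemma lin_seq_shift F u lam x l : lam != 0 ->
  lin_seq F u lam x @ \oo --> l <-> lin_seq F u lam (F x) @ \oo --> lam * l.
Proof.
move=> l0.
have E n : lin_seq F u lam (F x) n = lam * lin_seq F u lam x n.+1.
  rewrite /lin_seq -iterSr exprS; field.
  by rewrite l0 expf_neq0.
split=> H.
  rewrite (_ : lin_seq F u lam (F x) = fun n => lam * lin_seq F u lam x n.+1).
    by apply: cvgMr; move: H; rewrite -[X in X -> _](cvg_shiftS (lin_seq F u lam x)).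
  exact/funext.
rewrite -(cvg_shiftS (lin_seq F u lam x)).
have -> : [sequence lin_seq F u lam x n.+1]_n =
   fun n => lam^-1 * lin_seq F u lam (F x) n.
  by apply/funext => n /=; rewrite E mulKf.
by rewrite -[l](mulKf l0); apply: cvgMr.
Qed.

Lemma lin_seq_shiftn F u lam x l n : lam != 0 ->
  lin_seq F u lam x @ \oo --> l <->
  lin_seq F u lam (iter n F x) @ \oo --> lam ^+ n * l.
Proof.
move=> l0; elim: n l => [|n IH] l; first by rewrite mul1r.
by rewrite iterS exprS -mulrA -lin_seq_shift.
Qed.

(** Along an orbit tending to [u], [f] acts to first order as multiplication by [a]. So the
    coordinate of a map [F] commuting with [f] also linearises [f], sign of the multiplier included:
    this turns a conjugacy of squares into a conjugacy of the maps. *)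
Lemma lin_seq_commute F f u lam x l a : (forall y, f (F y) = F (f y)) ->
  f u = u -> sdiff f u a -> iter n F x @[n --> \oo] --> u ->
  lin_seq F u lam x @ \oo --> l -> lin_seq F u lam (f x) @ \oo --> a * l.
Proof.
move=> fF fu fa xu xl.
have fFn n : iter n F (f x) = f (iter n F x) by elim: n => //= n ->; rewrite fF.
suff D : (fun n => lin_seq F u lam (f x) n - a * lin_seq F u lam x n) @ \oo --> (0:R).
  rewrite (_ : lin_seq F u lam (f x) = fun n => a * lin_seq F u lam x n +
     (lin_seq F u lam (f x) n - a * lin_seq F u lam x n)); last first.
    by apply/funext => n; rewrite addrC subrK.
  by rewrite -[a * l]addr0; apply: cvgD => //; apply: cvgMr.
apply/cvgrPdist_le => e e0; have l1 : 0 < `|l| + 1 by rewrite ltr_wpDl.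
have [r r0 H] := fa (e / (`|l| + 1)) (divr_gt0 e0 l1).
move/cvgrPdist_lt : xu => /(_ r r0); move/cvgrPdist_le : xl => /(_ 1 ltr01).
apply: filterS2 => n Hl Hr; rewrite sub0r normrN.
have -> : lin_seq F u lam (f x) n - a * lin_seq F u lam x n =
  (f (iter n F x) - f u - a * (iter n F x - u)) / lam ^+ n.
  by rewrite /lin_seq fFn fu; ring.
rewrite normrM.
apply: (@le_trans _ _ (e / (`|l| + 1) * `|lin_seq F u lam x n|)).
  rewrite /lin_seq [in leRHS]normrM mulrA ler_wpM2r//; apply: H => //.
    by rewrite distrC.
  by rewrite subrr normr0.
rewrite mulrAC ler_pdivrMr// ler_wpM2l ?(ltW e0)//.
by rewrite -lerBlDl (le_trans (lerB_dist _ _))// distrC.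
Qed.

End Linearisation.

Section LocalLinearisation.
Variables (R : realType) (F F' : R -> R) (K th u lam : R).
Hypotheses (FC : C11 K F F') (Fth : forall x, `|F' x| <= th) (th1 : th < 1)
  (Fu : F u = u) (F'u : F' u = lam) (lam0 : 0 < lam).
Implicit Types (x y r : R).

(** Per unit of radius, step n contributes a relative error [3 * K * th ^+ n / lam]; the increments
    at most double along the way, and the geometric sum gives the factor [1 / (1 - th)]. *)
Definition koenigs_const := 6 * K / (lam * (1 - th)).

Let C1 := koenigs_const.
Let phi n x := lin_seq F u lam x n.

Let th0 : 0 <= th := le_trans (normr_ge0 _) (Fth u).
Let K0 : 0 <= K := C11_K_ge0 FC.
Let C10 : 0 <= C1.
Proof. by rewrite /C1 /koenigs_const divr_ge0 ?mulr_ge0 ?subr_ge0// ltW. Qed.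

Let iter_u n : iter n F u = u.
Proof. by elim: n => //= n ->. Qed.

Let iter_bound n x r : `|x - u| <= r -> `|iter n F x - u| <= th ^+ n * r.
Proof.
move=> xr; elim: n => [|n IH]; first by rewrite mul1r.
rewrite iterS -{1}Fu (le_trans (C11_lip FC Fth _ _))// exprS -mulrA.
exact: ler_wpM2l.
Qed.

(** The n-th iterates lie within [th ^+ n * r] of [u], where the strict derivative has a
    correspondingly small error. The bound is relative to [phi n x - phi n y] and so sums for every
    [th < 1]; an absolute bound by squared distances would call for [th ^+ 2 < lam]. *)
Let phi_inc n x y r : `|x - u| <= r -> `|y - u| <= r ->
  `|phi n.+1 x - phi n.+1 y - (phi n x - phi n y)| <=
  C1 * r * (1 - th) * th ^+ n / 2 * `|phi n x - phi n y|.
Proof.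
move=> xr yr; have ln : 0 < lam ^+ n by rewrite exprn_gt0.
have E : phi n.+1 x - phi n.+1 y - (phi n x - phi n y) =
  (F (iter n F x) - F (iter n F y) - F' u * (iter n F x - iter n F y)) / lam ^+ n.+1.
  rewrite /phi /lin_seq F'u iterS [iter n.+1 F y]iterS exprS; field.
  by rewrite !gt_eqF.
have E2 : phi n x - phi n y = (iter n F x - iter n F y) / lam ^+ n.
  by rewrite /phi /lin_seq; ring.
have := C11_strict FC (iter_bound n xr) (iter_bound n yr).
rewrite E E2 !normrM !normfV !(gtr0_norm (exprn_gt0 _ lam0)).
rewrite exprS ler_pdivrMr; last by rewrite mulr_gt0.
move=> /le_trans; apply; rewrite le_eqVlt; apply/orP; left; apply/eqP.
rewrite /C1 /koenigs_const; field.
by rewrite !gt_eqF// subr_gt0.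
Qed.

(** The factor [1 - th ^+ n] is the partial geometric sum carried by the induction. Since
    [C1 * r <= 1 / 2], the increments stay below twice [x - y], which closes it. *)
Let phi_dist n x y r : C1 * r <= 1 / 2 -> `|x - u| <= r -> `|y - u| <= r ->
  `|phi n x - phi n y - (x - y)| <= C1 * r * (1 - th ^+ n) * `|x - y|.
Proof.
move=> r1 xr yr; have r0 : 0 <= r by exact: le_trans xr.
have Cr0 : 0 <= C1 * r by rewrite mulr_ge0.
elim: n => [|n IH].
  by rewrite /phi /lin_seq !expr0 !divr1 subrr mulr0 mul0r opprB addrA subrK subrr normr0.
have tn0 : 0 <= th ^+ n by rewrite exprn_ge0.
have tn1 : th ^+ n <= 1 by rewrite exprn_ile1// ltW.
have d2 : `|phi n x - phi n y| <= 2 * `|x - y|.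
  have -> : phi n x - phi n y = (phi n x - phi n y - (x - y)) + (x - y) by ring.
  rewrite (le_trans (ler_normD _ _))//.
  suff : C1 * r * (1 - th ^+ n) * `|x - y| <= 1 * `|x - y| by move: IH; lra.
  by rewrite ler_wpM2r//; nra.
have -> : phi n.+1 x - phi n.+1 y - (x - y) =
  (phi n.+1 x - phi n.+1 y - (phi n x - phi n y)) + (phi n x - phi n y - (x - y)).
  by ring.
have c0 : 0 <= C1 * r * (1 - th) * th ^+ n / 2.
  by rewrite divr_ge0// mulr_ge0// mulr_ge0// subr_ge0 ltW.
have I := le_trans (phi_inc n xr yr) (ler_wpM2l c0 d2).
rewrite (le_trans (ler_normD _ _))// (le_trans (lerD I IH))// exprS.
rewrite le_eqVlt; apply/orP; left; apply/eqP; by field.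
Qed.

Let phi_tail n m x y r : C1 * r <= 1 / 2 -> `|x - u| <= r -> `|y - u| <= r ->
  `|phi (n + m) x - phi (n + m) y - (phi n x - phi n y)| <=
  C1 * r * th ^+ n * `|x - y|.
Proof.
move=> r1 xr yr; have r0 : 0 <= r by exact: le_trans xr.
have Cr0 : 0 <= C1 * r by rewrite mulr_ge0.
suff : `|phi (n + m) x - phi (n + m) y - (phi n x - phi n y)| <=
  C1 * r * (th ^+ n - th ^+ (n + m)) * `|x - y|.
  move=> /le_trans; apply; rewrite ler_wpM2r// ler_wpM2l// lerBlDr lerDl.
  exact: exprn_ge0.
elim: m => [|m IH].
  by rewrite addn0 !subrr mulr0 mul0r normr0.
rewrite addnS; set k := (n + m)%N.
have tn0 : 0 <= th ^+ k by rewrite exprn_ge0.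
have tn1 : th ^+ k <= 1 by rewrite exprn_ile1// ltW.
have d2 : `|phi k x - phi k y| <= 2 * `|x - y|.
  have -> : phi k x - phi k y = (phi k x - phi k y - (x - y)) + (x - y) by ring.
  rewrite (le_trans (ler_normD _ _))//; have := phi_dist k r1 xr yr.
  suff : C1 * r * (1 - th ^+ k) * `|x - y| <= 1 * `|x - y| by lra.
  by rewrite ler_wpM2r//; nra.
have -> : phi k.+1 x - phi k.+1 y - (phi n x - phi n y) =
  (phi k.+1 x - phi k.+1 y - (phi k x - phi k y)) +
  (phi k x - phi k y - (phi n x - phi n y)) by ring.
have c0 : 0 <= C1 * r * (1 - th) * th ^+ k / 2.
  by rewrite divr_ge0// mulr_ge0// mulr_ge0// subr_ge0 ltW.
have I := le_trans (phi_inc k xr yr) (ler_wpM2l c0 d2).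
rewrite (le_trans (ler_normD _ _))// (le_trans (lerD I IH))// exprS.
rewrite le_eqVlt; apply/orP; left; apply/eqP; by field.
Qed.

Let phi_u n : phi n u = 0.
Proof. by rewrite /phi /lin_seq iter_u subrr mul0r. Qed.

Let rpos r x : `|x - u| <= r -> 0 <= r.
Proof. exact: le_trans. Qed.

Lemma koenigs_cvg x r : C1 * r <= 1 / 2 -> `|x - u| <= r ->
  lin_seq F u lam x @ \oo --> koenigs F u lam x.
Proof.
move=> r1 xr; have uu : `|u - u| <= r by rewrite subrr normr0 (rpos xr).
suff /cvg_ex[l Hl] : cvg (phi ^~ x @ \oo).
  by rewrite /koenigs; have -> := cvg_lim (@Rhausdorff _) Hl.
apply/cauchy_cvgP/cauchy_exP => e e0.
have th01 : 0 <= th < 1 by rewrite th0.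
have [N HN] := geom_small (C1 * r * `|x - u|) th01 e0.
exists (phi N x); exists N => // n /= Nn; rewrite /ball/=.
have := phi_tail N (n - N) r1 xr uu; rewrite subnKC// !phi_u !subr0 distrC.
by move=> /le_lt_trans; apply; rewrite mulrAC HN.
Qed.

Let koenigs_tail n x y r : C1 * r <= 1 / 2 -> `|x - u| <= r -> `|y - u| <= r ->
  `|(koenigs F u lam x - koenigs F u lam y) - (phi n x - phi n y)| <=
  C1 * r * th ^+ n * `|x - y|.
Proof.
move=> r1 xr yr.
have H : (fun n => phi n x - phi n y) @ \oo --> koenigs F u lam x - koenigs F u lam y.
  by apply: cvgB; [exact: koenigs_cvg xr|exact: koenigs_cvg yr].
apply: (cvg_norm_le (N := n) H) => m nm.
by have := phi_tail n (m - n) r1 xr yr; rewrite subnKC.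
Qed.

(** The tail estimate started at n = 0. Its error, proportional to the radius, is what keeps [h]
    close to the identity at small scales. *)
Lemma koenigs_near_id x y r : C1 * r <= 1 / 2 -> `|x - u| <= r -> `|y - u| <= r ->
  `|koenigs F u lam x - koenigs F u lam y - (x - y)| <= C1 * r * `|x - y|.
Proof.
move=> r1 xr yr; have := koenigs_tail 0 r1 xr yr; rewrite expr0 mulr1.
suff -> : phi 0 x - phi 0 y = x - y by [].
by rewrite /phi /lin_seq /= expr0; field.
Qed.

Lemma koenigs_fix : koenigs F u lam u = 0.
Proof.
rewrite /koenigs (_ : lin_seq F u lam u = cst 0) ?lim_cst//.
by apply/funext => n; exact: phi_u.
Qed.

Lemma koenigs_sdiff_fix : sdiff (koenigs F u lam) u 1.
Proof.
move=> e e0; have C2 : 0 < C1 + 1 by rewrite ltr_wpDl.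
have m0 : 0 < Num.min e (1 / 2) by rewrite lt_min e0 divr_gt0.
exists (Num.min e (1 / 2) / (C1 + 1)); first by rewrite divr_gt0.
move=> y z _ _ /ltW yr /ltW zr; rewrite mul1r.
have H : C1 * (Num.min e (1 / 2) / (C1 + 1)) <= Num.min e (1 / 2).
  rewrite mulrA ler_pdivrMr// mulrC ler_wpM2l ?ltW// ltrDl//.
rewrite (le_trans (koenigs_near_id _ yr zr))//.
  by rewrite (le_trans H)// ge_min lexx orbT.
by rewrite ler_wpM2r// (le_trans H)// ge_min lexx.
Qed.

(** The normalised iterates are strictly differentiable and converge in the Lipschitz seminorm. The
    derivative is positive because it lies within 1/2 of 1. *)
Lemma koenigs_sdiff x r : C1 * r <= 1 / 2 -> `|x - u| < r ->
  exists2 d, 0 < d & sdiff (koenigs F u lam) x d.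
Proof.
move=> r1 xr; have s0 : 0 < r - `|x - u| by rewrite subr_gt0.
have tr y : `|y - x| < r - `|x - u| -> `|y - u| <= r.
  move=> yx; rewrite (le_trans (ler_distD x _ _))//; lra.
suff [d Hd] : exists d, sdiff (koenigs F u lam) x d.
  exists d => //; have : `|d - 1| <= C1 * r.
    apply: (sdiff_uniq s0 Hd) => y z yr zr; rewrite mul1r.
    exact: koenigs_near_id (tr _ yr) (tr _ zr).
  rewrite ler_norml; lra.
have dn n : {d | sdiff (phi n) x d}.
  apply: cid; elim: n => [|n [d Hd]].
    exists (1 * 1); apply: sdiff_ext (sdiff_affine 1 u (sdiff_id x)) => y.
    by rewrite /phi /lin_seq /= expr0; field.
  have Hn : sdiff (iter n F) x (lam ^+ n * d).
    have := sdiff_affine (lam ^+ n) (- u / lam ^+ n) Hd; apply: sdiff_ext => y.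
    by rewrite /phi /lin_seq; field; rewrite expf_neq0// gt_eqF.
  have := C11_sdiff (iter n F x) FC => FS.
  have FFn := sdiff_in_comp (S := setT) (T := setT) Logic.I (fun _ _ => Logic.I) Hn FS.
  exists ((lam ^+ n.+1)^-1 * (F' (iter n F x) * (lam ^+ n * d))).
  by apply: sdiff_ext (sdiff_affine _ u FFn) => y; rewrite mulrC.
have c0 : (fun n => C1 * r * th ^+ n) @ \oo --> (0 : R).
  by rewrite -(mulr0 (C1 * r)); apply: cvgMr; apply: cvg_expr; rewrite ger0_norm.
apply: (sdiff_lim s0 (fun n => projT2 (dn n)) c0) => n y z yr zr.
exact: koenigs_tail (tr _ yr) (tr _ zr).
Qed.

End LocalLinearisation.

Section GlobalLinearisation.
Variable R : realType.
Implicit Types (F : R -> R) (x y u lam : R) (W : set R).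

(** Differentiability is recorded only near [u]: farther out the orbit may cross the kink, where
    [phi] need not be differentiable. The regularity of [h] there comes from its functional equation
    instead. *)
Record linearises W F u lam (phi : R -> R) : Prop := {
  lin_fix_in : W u;
  lin_fix : phi u = 0;
  lin_cvg : forall x, W x -> lin_seq F u lam x @ \oo --> phi x;
  lin_eq : forall x, W x -> phi (F x) = lam * phi x;
  lin_incr : forall x y, W x -> W y -> x < y -> phi x < phi y;
  lin_surj : forall y, exists2 x, W x & phi x = y;
  lin_sdiff : exists2 r, 0 < r & forall x, `|x - u| < r ->
    W x /\ exists2 d, 0 < d & sdiff phi x d }.

Lemma near_id_surj f u r Y : 0 < r -> f u = 0 ->
  (forall x, `|x - u| < r -> {for x, continuous f}) ->
  (forall x, `|x - u| <= r -> `|f x - f u - (x - u)| <= 1 / 2 * `|x - u|) ->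
  `|Y| < r / 4 -> exists2 z, `|z - u| <= r & f z = Y.
Proof.
move=> r0 fu fc fn Yr; have r2 : 0 < r / 2 by rewrite divr_gt0.
have rr : r / 2 < r by rewrite ltr_pdivrMr// ltr_pMr// ltr1n.
have Ea : u - r / 2 - u = - (r / 2) by rewrite addrAC subrr sub0r.
have Eb : u + r / 2 - u = r / 2 by rewrite addrAC subrr add0r.
have A := fn (u - r / 2); have B := fn (u + r / 2).
rewrite Ea normrN (gtr0_norm r2) fu subr0 in A; rewrite Eb (gtr0_norm r2) fu subr0 in B.
have {A}/andP[A1 A2] : - (1 / 2 * (r / 2)) <= f (u - r / 2) - - (r / 2) <= 1 / 2 * (r / 2).
  by rewrite -ler_norml A// ltW.
have {B}/andP[B1 B2] : - (1 / 2 * (r / 2)) <= f (u + r / 2) - r / 2 <= 1 / 2 * (r / 2).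
  by rewrite -ler_norml B// ltW.
move: Yr; rewrite ltr_norml => /andP[Y1 Y2].
have [|||z] := @IVT _ f (u - r / 2) (u + r / 2) Y.
- by lra.
- apply: continuous_in_subspaceT => z; rewrite inE/= in_itv/= => /andP[z1 z2].
  by apply: fc; rewrite ltr_norml; lra.
- by rewrite ge_min le_max; apply/andP; split; apply/orP; [left|right]; lra.
by rewrite in_itv/= => /andP[z1 z2] <-; exists z => //; rewrite ler_norml; lra.
Qed.

(** [G] is a globally smooth model equal to [F] near [u]. Every orbit in [W] enters that ball, so
    the properties of the local coordinate spread to [W] through [phi (F^n x) = lam^n * phi x]. *)
Lemma koenigs_linearises W F Fi G G' K th u lam r0 :
  open W -> W u -> (forall x, W x -> W (F x)) ->
  (forall x, W x -> W (Fi x) /\ F (Fi x) = x) ->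
  (forall x y, W x -> W y -> x < y -> F x < F y) ->
  (forall x, W x -> iter n F x @[n --> \oo] --> u) ->
  0 < r0 -> (forall x, `|x - u| <= r0 -> F x = G x) ->
  C11 K G G' -> (forall x, `|G' x| <= th) -> th < 1 -> G u = u -> G' u = lam ->
  0 < lam -> linearises W F u lam (koenigs F u lam).
Proof.
move=> oW Wu WF WFi Finc Fu r00 FG GC Gth th1 Gu G'u lam0.
have th0 : 0 <= th := le_trans (normr_ge0 _) (Gth u).
have lamn0 : lam != 0 by rewrite gt_eqF.
pose C1 := koenigs_const K th lam.
have C10 : 0 <= C1.
  by rewrite /C1 /koenigs_const divr_ge0 ?mulr_ge0 ?subr_ge0 ?(C11_K_ge0 GC)// ltW.
have := open_nbhs_nbhs (conj oW Wu) => /nbhs_ballP[s /= s0 Hs].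
have C2 : 0 < C1 + 1 by lra.
pose r := Num.min r0 (Num.min (s / 2) (1 / 2 / (C1 + 1))).
have r_gt0 : 0 < r by rewrite !lt_min r00 !divr_gt0.
have rr0 : r <= r0 by rewrite ge_min lexx.
have rs : r < s.
  have : r <= s / 2 by rewrite /r !ge_min lexx orbT.
  by move=> /le_lt_trans; apply; rewrite ltr_pdivrMr// ltr_pMr// ltr1n.
have r1 : C1 * r <= 1 / 2.
  have : r <= 1 / 2 / (C1 + 1) by rewrite /r !ge_min lexx !orbT.
  rewrite ler_pdivlMr// => H; have := r_gt0; lra.
have Wr x : `|x - u| <= r -> W x.
  by move=> xr; apply: Hs; rewrite /ball/= distrC (le_lt_trans xr).
have iterE x n : `|x - u| <= r -> iter n F x = iter n G x /\ `|iter n G x - u| <= r.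
  move=> xr; elim: n => [//|n [E IH]]; rewrite !iterS E FG; last first.
    exact: le_trans rr0.
  split=> //; rewrite -{1}Gu (le_trans (C11_lip GC Gth _ _))//.
  rewrite (le_trans _ IH)// -[leRHS]mul1r ler_wpM2r// ltW//.
have seqE x : `|x - u| <= r -> lin_seq F u lam x = lin_seq G u lam x.
  by move=> xr; apply/funext => n; rewrite /lin_seq (iterE x n xr).1.
have kE x : `|x - u| <= r -> koenigs F u lam x = koenigs G u lam x.
  by move=> xr; rewrite /koenigs seqE.
have Wn n x : W x -> W (iter n F x) by move=> Wx; elim: n => //= n; exact: WF.
have enter x : W x -> exists N, forall n, (N <= n)%N -> `|iter n F x - u| <= r.
  move=> /Fu /cvgrPdist_le/(_ r r_gt0)[N _ HN]; exists N => n Nn.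
  by rewrite distrC HN.
have cv0 x : `|x - u| <= r -> lin_seq F u lam x @ \oo --> koenigs F u lam x.
  by move=> xr; rewrite kE// seqE//; exact: (koenigs_cvg GC Gth th1 Gu G'u lam0 r1).
have cv x : W x -> lin_seq F u lam x @ \oo --> koenigs F u lam x.
  move=> Wx; suff /cvg_ex[l Hl] : cvg (lin_seq F u lam x @ \oo).
    by rewrite /koenigs; have -> := cvg_lim (@Rhausdorff _) Hl.
  have [N HN] := enter x Wx; apply/cvg_ex.
  exists (koenigs F u lam (iter N F x) / lam ^+ N).
  apply: (iffRL (@lin_seq_shiftn _ F u lam x _ N lamn0)).
  by rewrite mulrC divfK ?expf_neq0//; exact/cv0/HN.
have eqn x n : W x -> koenigs F u lam (iter n F x) = lam ^+ n * koenigs F u lam x.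
  move=> Wx; apply: (cvg_unique (@Rhausdorff R)) (cv _ (Wn n _ Wx)) _.
  exact: (iffLR (@lin_seq_shiftn _ F u lam x _ n lamn0) (cv _ Wx)).
have near_id x y : `|x - u| <= r -> `|y - u| <= r ->
    `|koenigs F u lam x - koenigs F u lam y - (x - y)| <= 1 / 2 * `|x - y|.
  move=> xr yr; rewrite !kE//.
  rewrite (le_trans (koenigs_near_id GC Gth th1 Gu G'u lam0 r1 xr yr))//.
  exact: ler_wpM2r.
have inc0 x y : `|x - u| <= r -> `|y - u| <= r -> x < y ->
    koenigs F u lam x < koenigs F u lam y.
  move=> xr yr xy; have := near_id y x yr xr.
  by rewrite (gtr0_norm (_ : 0 < y - x)) ?subr_gt0// ler_norml; lra.
have Finc_n n x y : W x -> W y -> x < y -> iter n F x < iter n F y.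
  by move=> Wx Wy xy; elim: n => //= n IH; apply: Finc => //; exact: Wn.
have uu : `|u - u| <= r by rewrite subrr normr0 ltW.
have ku : koenigs F u lam u = 0 by rewrite kE// koenigs_fix.
have sd x : `|x - u| < r -> exists2 d, 0 < d & sdiff (koenigs F u lam) x d.
  move=> xr; have [d d0 Hd] := koenigs_sdiff GC Gth th1 Gu G'u lam0 r1 xr.
  exists d => //; have r2 : 0 < r - `|x - u| by rewrite subr_gt0.
  apply: (sdiff_in_local r2 _ Hd) => y _ yx; rewrite kE//.
  by rewrite (le_trans (ler_distD x _ _))//; lra.
split=> //.
- by move=> x Wx; rewrite -[F x]/(iter 1 F x) eqn.
- move=> x y Wx Wy xy; have [N HN] := enter x Wx; have [M HM] := enter y Wy.
  pose n := maxn N M.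
  have := inc0 _ _ (HN n (leq_maxl _ _)) (HM n (leq_maxr _ _)) (Finc_n n _ _ Wx Wy xy).
  by rewrite !eqn// ltr_pM2l// exprn_gt0.
(* Surjectivity: multiply [Y] by a power of [lam] to bring it into the range of the local
   coordinate, then apply the inverse [Fi] as many times. *)
- move=> Y; have lam1 : 0 <= lam < 1.
    by rewrite ltW//= (le_lt_trans _ th1)// -G'u (le_trans _ (Gth u))// ler_norm.
  have r4 : 0 < r / 4 by rewrite divr_gt0.
  have [N /(_ N (leqnn N)) HN] := geom_small `|Y| lam1 r4.
  have YN : `|lam ^+ N * Y| < r / 4.
    by rewrite normrM ger0_norm ?exprn_ge0 ?(ltW lam0)// mulrC.
  have [||z zr Ez] := near_id_surj r_gt0 ku _ _ YN.
  + by move=> x xr; have [d _ Hd] := sd x xr; exact: sdiff_continuous Hd.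
  + by move=> x xr; exact: near_id.
  have Wz := Wr _ zr.
  have Wi n : W (iter n Fi z) by elim: n => //= n IH; exact: (WFi _ IH).1.
  have Ei n : iter n F (iter n Fi z) = z.
    by elim: n => // n IH; rewrite iterSr iterS (WFi _ (Wi n)).2.
  exists (iter N Fi z) => //.
  have := eqn _ N (Wi N); rewrite Ei Ez => /esym/mulfI; apply.
  by rewrite expf_neq0.
- exists r => // x xr; split; first exact/Wr/ltW.
  exact: sd.
Qed.

End GlobalLinearisation.

(** * Propagation of regularity along orbits, and conjugacies from coordinates *)

Section Propagation.
Variable R : realType.
Implicit Types (f g h : R -> R) (x y : R).

Definition sided f x a b :=
  sdiff_in [set y | y <= x] f x a /\ sdiff_in [set y | x <= y] f x b.

Lemma sdiff_sided f x a : sdiff f x a -> sided f x a a.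
Proof. by move=> H; split; apply: sdiff_inW H. Qed.

(* At a kink of f, the conjugate h x is a kink of g and the one-sided slopes have
   the same ratio, so that both one-sided derivatives of h at x agree. *)
Lemma sdiff_pullback f g h x a1 a2 c1 c2 r : 0 < r ->
  (forall y, `|y - x| < r -> h (f y) = g (h y)) ->
  {homo h : x y / x <= y} -> {for x, continuous h} ->
  sided f x a1 a2 -> sided g (h x) c1 c2 -> 0 < a1 / c1 -> 0 < a2 / c2 ->
  a1 * c2 = a2 * c1 -> (exists2 d : R, 0 < d & sdiff h (f x) d) ->
  exists2 d : R, 0 < d & sdiff h x d.
Proof.
move=> r0 E hi hc [f1 f2] [g1 g2] p1 p2 q [d d0 hd].
have c10 : c1 != 0 by apply: contraTneq p1 => ->; rewrite invr0 mulr0 ltxx.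
have c20 : c2 != 0 by apply: contraTneq p2 => ->; rewrite invr0 mulr0 ltxx.
exists (d * a1 / c1); first by rewrite -mulrA mulr_gt0.
have hf S a : S x -> sdiff_in S f x a -> sdiff_in S (g \o h) x (d * a).
  move=> Sx Sf; apply: (@sdiff_in_local _ S (h \o f) _ x _ r r0).
    by move=> y _ /E.
  by apply: (sdiff_in_comp Sx (T := setT)).
apply: sdiff_glue.
  apply: (sdiff_in_div (g := g) (T := [set y | y <= h x])) => //=.
  - by move=> y; exact: hi.
  - by apply: hf => /=.
have -> : d * a1 / c1 = d * a2 / c2.
  by apply/eqP; rewrite eqr_div// -!mulrA q.
apply: (sdiff_in_div (g := g) (T := [set y | h x <= y])) => //=.
- by move=> y; exact: hi.
- by apply: hf => /=.
Qed.

Lemma sided_inv f k x a b : {homo f : x y /~ x < y} -> cancel f k -> cancel k f ->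
  {for f x, continuous k} -> a != 0 -> b != 0 ->
  sided f x a b -> sided k (f x) b^-1 a^-1.
Proof.
move=> fd fk kf kc a0 b0 [f1 f2].
have kd y z : y <= z -> k z <= k y.
  by move=> yz; have [//|/fd] := leP (k z) (k y); rewrite !kf ltNge yz.
have idE S : sdiff_in S (f \o k) (f x) 1.
  apply: (sdiff_in_local ltr01 (f := id)) => [y _ _|]; first by rewrite /= kf.
  by apply: sdiff_inW (sdiff_id (f x)).
rewrite -(div1r a) -(div1r b); split.
  apply: (sdiff_in_div (g := f) (T := [set y | x <= y])) => //=.
  - by move=> y /kd; rewrite fk.
  - by rewrite fk.
apply: (sdiff_in_div (g := f) (T := [set y | y <= x])) => //=.
- by move=> y /kd; rewrite fk.
- by rewrite fk.
Qed.

Lemma iter_contract (T : R -> R) (S : set R) (th u x : R) : 0 <= th < 1 ->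
  (forall y, S y -> S (T y) /\ `|T y - u| <= th * `|y - u|) -> S x ->
  iter n T x @[n --> \oo] --> u.
Proof.
move=> th01 H Sx; have /andP[th0 _] := th01.
have I n : S (iter n T x) /\ `|iter n T x - u| <= `|x - u| * th ^+ n.
  elim: n => [|n [Sn IH]]; first by rewrite mulr1.
  have [? L] := H _ Sn; split=> //; rewrite (le_trans L)// exprS mulrCA.
  exact: ler_wpM2l.
apply/cvgrPdist_lt => e e0; have [N HN] := geom_small `|x - u| th01 e0.
by exists N => // n /= /HN; apply: le_lt_trans; rewrite distrC; exact: (I n).2.
Qed.

(** Repeated expansion away from [w] is incompatible with staying in a bounded set. *)
Lemma iter_escape (T : R -> R) (S : set R) m b w x : 1 < m -> x != w ->
  (forall y, S y -> `|y - w| <= b) ->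
  (forall y, S y -> S (T y) -> m * `|y - w| <= `|T y - w|) ->
  exists n, ~ S (iter n T x).
Proof.
move=> m1 xw Sb H; apply: contrapT => /forallNP E.
have Sn n : S (iter n T x) by apply: contrapT; exact: E.
have m0 : 0 < m by rewrite (lt_trans _ m1).
have I n : `|x - w| <= `|iter n T x - w| * m^-1 ^+ n.
  elim: n => [|n IH]; first by rewrite mulr1.
  rewrite (le_trans IH)// exprS mulrA ler_wpM2r ?exprn_ge0 ?invr_ge0 ?(ltW m0)//.
  by rewrite ler_pdivlMr// mulrC; apply: H => //; exact: (Sn n.+1).
have m01 : 0 <= m^-1 < 1 by rewrite invr_ge0 ltW//= invf_lt1.
have xw0 : 0 < `|x - w| by rewrite normr_gt0 subr_eq0.
have [N /(_ N (leqnn N))] := geom_small b m01 xw0.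
rewrite ltNge (le_trans (I N))// ler_wpM2r ?exprn_ge0 ?invr_ge0 ?(ltW m0)//.
exact/Sb/Sn.
Qed.

Lemma iter_cvg_shift (T : R -> R) N (u x : R) :
  iter n T (iter N T x) @[n --> \oo] --> u -> iter n T x @[n --> \oo] --> u.
Proof.
move=> H; rewrite -(cvg_shiftn N).
by under eq_fun do rewrite iterD.
Qed.

Lemma iter_comp2 f n (x : R) : iter n (f \o f) x = iter n.*2 f x.
Proof. by elim: n => //= n ->. Qed.

Lemma lin_conj (W W' : set R) F G u v lam phi psi (c : R) : 0 < c ->
  (forall x, W x -> W (F x)) -> (forall x, W' x -> W' (G x)) ->
  linearises W F u lam phi -> linearises W' G v lam psi ->
  exists h, [/\ forall x, W x -> W' (h x) /\ psi (h x) = c * phi x,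
    forall x y, W x -> W y -> x < y -> h x < h y,
    forall y, W' y -> exists2 x, W x & h x = y
    & forall x, W x -> h (F x) = G (h x)].
Proof.
move=> c0 WF WG Lf Lg.
have inj x y : W' x -> W' y -> psi x = psi y -> x = y.
  move=> Wx Wy E; have [xy|xy|//] := ltgtP x y.
    by have := lin_incr Lg Wx Wy xy; rewrite E ltxx.
  by have := lin_incr Lg Wy Wx xy; rewrite E ltxx.
have injf x y : W x -> W y -> phi x = phi y -> x = y.
  move=> Wx Wy E; have [xy|xy|//] := ltgtP x y.
    by have := lin_incr Lf Wx Wy xy; rewrite E ltxx.
  by have := lin_incr Lf Wy Wx xy; rewrite E ltxx.
have [|h Hh] := @choice R R (fun x y => W' y /\ psi y = c * phi x).
  by move=> x; have [y Wy yE] := lin_surj Lg (c * phi x); exists y.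
exists h; split.
- by move=> x _; exact: Hh.
- move=> x y Wx Wy xy; have [W1 E1] := Hh x; have [W2 E2] := Hh y.
  have H : psi (h x) < psi (h y) by rewrite E1 E2 ltr_pM2l// (lin_incr Lf).
  rewrite ltNge le_eqVlt; apply/negP => /orP[/eqP e|/(lin_incr Lg W2 W1)].
    by rewrite e ltxx in H.
  by rewrite ltNge ltW.
- move=> y Wy; have [x Wx xE] := lin_surj Lf (c^-1 * psi y).
  exists x => //; have [W1 E1] := Hh x; apply: inj => //.
  by rewrite E1 xE mulrA divff ?gt_eqF// mul1r.
- move=> x Wx; have [W1 E1] := Hh x; have [W2 E2] := Hh (F x).
  apply: inj => //; first exact: WG.
  by rewrite (lin_eq Lg)// E1 E2 (lin_eq Lf)// mulrCA.
Qed.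

Lemma lin_conj_sdiff (W W' : set R) F G u v lam phi psi (c : R) h :
  0 < c -> linearises W F u lam phi -> linearises W' G v lam psi ->
  (forall x, W x -> W' (h x) /\ psi (h x) = c * phi x) ->
  (forall x, W x -> {for x, continuous h}) ->
  h u = v /\ exists2 r : R, 0 < r & forall x, `|x - u| < r ->
    W x /\ exists2 d : R, 0 < d & sdiff h x d.
Proof.
move=> c0 Lf Lg H hc.
have [Wu' hu] := H _ (lin_fix_in Lf).
have huv : h u = v.
  have Wv := lin_fix_in Lg; move: hu; rewrite (lin_fix Lf) mulr0 -(lin_fix Lg) => E.
  have [xy|xy|//] := ltgtP (h u) v.
    by have := lin_incr Lg Wu' Wv xy; rewrite E ltxx.
  by have := lin_incr Lg Wv Wu' xy; rewrite E ltxx.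
split=> //; have [r r0 Hr] := lin_sdiff Lf; have [s s0 Hs] := lin_sdiff Lg.
have := hc u (lin_fix_in Lf); rewrite continuous_epsP huv => /(_ s s0)[t t0 Ht].
exists (Num.min r t); first by rewrite lt_min r0.
move=> x; rewrite lt_min => /andP[xr xt]; have [Wx [d d0 dE]] := Hr x xr.
split=> //; have [Whx [e e0 eE]] := Hs (h x) (Ht x xt).
exists (c * d / e); first by rewrite divr_gt0// mulr_gt0.
apply: (sdiff_in_div (g := psi) (T := setT)) => //.
- exact: hc.
- by rewrite gt_eqF.
- have rx : 0 < r - `|x - u| by rewrite subr_gt0.
  apply: (sdiff_in_local rx _ (sdiff_affine c 0 dE)) => y _ yx /=.
  have [|Wy _] := Hr y; first by rewrite (le_lt_trans (ler_distD x _ _))// -ltrBrDr.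
  by rewrite subr0 (H y Wy).2.
Qed.

End Propagation.

(** * Border-collision maps *)

Section BorderCollisionMaps.
Variable R : realType.
Implicit Types (x y : R) (A B : R -> R).

Definition pw A B x := if x <= 0 then A x else B x.

(* theta_sqr_lt serves to propagate the bound |h x - x| <= M x^2 along orbits of f^2. *)
Record slope_bounds (al al' ga ga' : R) : Prop := {
  al_gt0 : 0 < al;
  ga_gt1 : 1 < ga;
  theta_lt1 : al' * ga' < 1;
  theta_sqr_lt : (al' * ga') ^+ 2 < al * ga }.

(** Both branches are defined on the whole line with global bounds, so orbits need not be kept
    inside a domain. None of the bounds involves [nu], hence one set of constants serves all small
    mu. *)
Record bcmap (al al' ga ga' K nu : R) A A' B B' : Prop := {
  bc_bounds : slope_bounds al al' ga ga';
  bcA : C11 K A A';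
  bcB : C11 K B B';
  bcA' : forall x, al <= - A' x <= al';
  bcB' : forall x, ga <= - B' x <= ga';
  bcA0 : A 0 = nu;
  bcB0 : B 0 = nu }.

Section OneMap.
Variables (al al' ga ga' K nu : R) (A A' B B' : R -> R).
Hypothesis bc : bcmap al al' ga ga' K nu A A' B B'.
Let f := pw A B.
Let th := al' * ga'.

Lemma bc_consts : [/\ 0 < al, al <= al' & al' < 1] /\ [/\ 1 < ga, ga <= ga', 0 < th & th < 1].
Proof.
have [a0 g1 t1 _] := bc_bounds bc.
have /andP[h1 h2] := bcA' bc 0; have /andP[h3 h4] := bcB' bc 0.
have aa : al <= al' by exact: le_trans h2.
have gg : ga <= ga' by exact: le_trans h4.
have ga0 : 0 < ga' by lra.
have al0 : 0 < al' by lra.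
split; split=> //; last by rewrite /th mulr_gt0.
by apply: le_lt_trans t1; rewrite ler_peMr; lra.
Qed.

Lemma A_slope x y : x <= y -> al * (y - x) <= A x - A y <= al' * (y - x).
Proof.
move=> xy; have := C11_slope (bcA bc) (lo := - al') (hi := - al) _ xy.
have H z : - al' <= A' z <= - al by have := bcA' bc z; lra.
by move=> /(_ H); lra.
Qed.

Lemma B_slope x y : x <= y -> ga * (y - x) <= B x - B y <= ga' * (y - x).
Proof.
move=> xy; have := C11_slope (bcB bc) (lo := - ga') (hi := - ga) _ xy.
have H z : - ga' <= B' z <= - ga by have := bcB' bc z; lra.
by move=> /(_ H); lra.
Qed.

Lemma normA' x : `|A' x| <= al'.
Proof. by have [[? ? ?] [? ? ? ?]] := bc_consts; have := bcA' bc x; rewrite ler_norml; lra. Qed.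

Lemma normB' x : `|B' x| <= ga'.
Proof. by have [[? ? ?] [? ? ? ?]] := bc_consts; have := bcB' bc x; rewrite ler_norml; lra. Qed.

Lemma A_lip x y : `|A x - A y| <= al' * `|x - y|.
Proof. exact: C11_lip (bcA bc) normA' _ _. Qed.

Lemma B_lip x y : `|B x - B y| <= ga' * `|x - y|.
Proof. exact: C11_lip (bcB bc) normB' _ _. Qed.

Lemma pw_le0 x : x <= 0 -> f x = A x.
Proof. by rewrite /f /pw => ->. Qed.

Lemma pw_ge0 x : 0 <= x -> f x = B x.
Proof.
rewrite /f /pw => x0; case: ifPn => // x0'.
have -> : x = 0 by apply/eqP; rewrite eq_le x0 x0'.
by rewrite (bcA0 bc) (bcB0 bc).
Qed.

Lemma pw0 : f 0 = nu.
Proof. by rewrite pw_le0// (bcA0 bc). Qed.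

Lemma pw_slope x y : x <= y -> al * (y - x) <= f x - f y <= ga' * (y - x).
Proof.
have [[? ? ?] [? ? ? ?]] := bc_consts => xy.
have [y0|/ltW y0] := leP y 0.
  by rewrite !pw_le0 ?(le_trans xy)//; have := A_slope xy; nra.
have [x0|/ltW x0] := leP x 0; last first.
  by rewrite !pw_ge0//; have := B_slope xy; nra.
rewrite pw_le0// pw_ge0//; have := A_slope x0; have := B_slope y0.
rewrite (bcA0 bc) (bcB0 bc); nra.
Qed.

Lemma pw_decr : {homo f : x y /~ x < y}.
Proof.
have [[? ? ?] [? ? ? ?]] := bc_consts.
by move=> x y xy; have := pw_slope (ltW xy); nra.
Qed.

Lemma pw_lip x y : `|f x - f y| <= ga' * `|x - y|.
Proof.
have [[? ? ?] [? ? ? ?]] := bc_consts.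
suff W a b : a <= b -> `|f a - f b| <= ga' * `|a - b|.
  have [/W//|/ltW/W] := leP x y.
  by rewrite distrC [in X in _ <= X -> _]distrC.
move=> ab; rewrite [`|a - b|]distrC (ger0_norm (_ : 0 <= b - a)) ?subr_ge0//.
have /andP[h1 h2] := pw_slope ab; rewrite ger0_norm//; apply: le_trans h1.
by rewrite mulr_ge0 ?subr_ge0// ltW.
Qed.

Lemma pw_continuous : continuous f.
Proof.
have [[? ? ?] [? ? ? ?]] := bc_consts.
have g0 : 0 < ga' by lra.
move=> x; apply/continuous_epsP => e e0; exists (e / ga'); first by rewrite divr_gt0.
move=> y; rewrite ltr_pdivlMr// mulrC; exact: le_lt_trans (pw_lip _ _).
Qed.

Lemma pw_inv : exists k, [/\ cancel f k, cancel k f,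
  {homo k : x y /~ x < y} & continuous k].
Proof.
have [[? ? ?] [? ? ? ?]] := bc_consts.
have [||x y /pw_slope/andP[]//|k [fk kf]] := @slope_bij R f al.
- by [].
- exact: pw_continuous.
exists k.
have kd : {homo k : x y /~ x < y}.
  move=> x y xy; rewrite ltNge; apply/negP; rewrite le_eqVlt => /orP[/eqP e|/pw_decr].
    by move: xy; rewrite -(kf x) -(kf y) e ltxx.
  by rewrite !kf ltNge ltW.
split=> // x; rewrite -[k]opprK; apply: continuousN.
apply: incr_surj_continuous => [a b /kd|y]; first by rewrite ltrN2.
by exists (f (- y)); rewrite /= /GRing.opp/= fk opprK.
Qed.

Lemma pw_sided x : sided f x (if x <= 0 then A' x else B' x)
  (if x < 0 then A' x else B' x).
Proof.
have [x0|x0|->] := ltgtP x 0.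
- apply: sdiff_sided; have nx : 0 < - x by rewrite oppr_gt0.
  apply: (sdiff_in_local nx _ (C11_sdiff x (bcA bc))) => y _.
  by rewrite ltr_norml => yx; rewrite pw_le0//; lra.
- apply: sdiff_sided.
  apply: (sdiff_in_local x0 _ (C11_sdiff x (bcB bc))) => y _.
  by rewrite ltr_norml => yx; rewrite pw_ge0//; lra.
- split.
    apply: (sdiff_in_local ltr01 _ (sdiff_inW _ (C11_sdiff 0 (bcA bc)))) => //.
    by move=> y /= y0 _; rewrite pw_le0.
  apply: (sdiff_in_local ltr01 _ (sdiff_inW _ (C11_sdiff 0 (bcB bc)))) => //.
  by move=> y /= y0 _; rewrite pw_ge0.
Qed.

Lemma BA_C11 : C11 (K * al' ^+ 2 + ga' * K) (B \o A) (fun x => B' (A x) * A' x).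
Proof. exact: C11_comp (bcA bc) (bcB bc) normA' normB'. Qed.

Lemma BA_deriv x : al * ga <= B' (A x) * A' x <= th.
Proof.
have [[? ? ?] [? ? ? ?]] := bc_consts.
have /andP[h1 h2] := bcA' bc x; have /andP[h3 h4] := bcB' bc (A x).
have l1 : al * ga <= (- A' x) * (- B' (A x)) by apply: ler_pM => //; lra.
have l2 : (- A' x) * (- B' (A x)) <= th by apply: ler_pM => //; lra.
by lra.
Qed.

Lemma normBA x : `|B' (A x) * A' x| <= th.
Proof.
have [[? ? ?] [? ? ? ?]] := bc_consts.
have := BA_deriv x; have : 0 < al * ga by rewrite mulr_gt0//; lra.
by move=> ? ?; rewrite ler_norml; lra.
Qed.

Lemma BA_lip x y : `|B (A x) - B (A y)| <= th * `|x - y|.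
Proof. exact: C11_lip BA_C11 normBA _ _. Qed.

Lemma AA_C11 : C11 (K * al' ^+ 2 + al' * K) (A \o A) (fun x => A' (A x) * A' x).
Proof. exact: C11_comp (bcA bc) (bcA bc) normA' normA'. Qed.

Lemma normAA x : `|A' (A x) * A' x| <= th.
Proof.
have [[? ? ?] [? ? ? ?]] := bc_consts.
rewrite normrM; apply: (@le_trans _ _ (al' * al')).
  by apply: ler_pM => //; exact: normA'.
by rewrite /th ler_wpM2l//; lra.
Qed.

Lemma pw_fix_uniq x y : f x = x -> f y = y -> x = y.
Proof.
move=> fx fy; have [xy|xy|//] := ltgtP x y.
  by have := pw_decr xy; rewrite fx fy ltNge (ltW xy).
by have := pw_decr xy; rewrite fx fy ltNge (ltW xy).
Qed.

Lemma fixed_point_exists (T : R -> R) : continuous T ->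
  (forall x y, x <= y -> T y <= T x) -> exists x, T x = x.
Proof.
move=> Tc Td; have [|||x Hx] := @slope_surj R (fun x => x - T x) 1 _ _ _ 0.
- exact: ltr01.
- by move=> x; apply: continuousB; [exact: cvg_id|exact: Tc].
- by move=> x y xy; have := Td _ _ xy; lra.
- by exists x; lra.
Qed.

Lemma A_fix : exists xL, A xL = xL.
Proof.
have [[? ? ?] [? ? ? ?]] := bc_consts.
apply: fixed_point_exists; first exact: C11_continuous (bcA bc).
move=> x y xy; have /andP[h _] := A_slope xy.
have : 0 <= al * (y - x) by rewrite mulr_ge0 ?subr_ge0// ltW.
by lra.
Qed.

Lemma B_fix : exists xR, B xR = xR.
Proof.
have [[? ? ?] [? ? ? ?]] := bc_consts.
apply: fixed_point_exists; first exact: C11_continuous (bcB bc).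
move=> x y xy; have /andP[h _] := B_slope xy.
have : 0 <= ga * (y - x) by rewrite mulr_ge0 ?subr_ge0//; lra.
by lra.
Qed.

Lemma BA_fix : exists uL, B (A uL) = uL.
Proof.
have [[? ? ?] [? ? ? ?]] := bc_consts.
have [|||x Hx] := @slope_surj R (fun x => x - B (A x)) (1 - th) _ _ _ 0.
- lra.
- by move=> x; apply: continuousB; [exact: cvg_id|exact: C11_continuous BA_C11 x].
- move=> x y xy; have := BA_lip y x; rewrite (ger0_norm (_ : 0 <= y - x)) ?subr_ge0//.
  by move=> /(le_trans (ler_norm _)); lra.
- by exists x; lra.
Qed.

Lemma A_fix_norm xL : A xL = xL -> `|xL| <= `|nu| <= 2 * `|xL|.
Proof.
have [[? ? ?] [? ? ? ?]] := bc_consts => E.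
have h := A_lip xL 0; rewrite E (bcA0 bc) subr0 in h.
have [x0|x0] := leP xL 0.
  have := A_slope x0; rewrite E (bcA0 bc) => ?.
  have n0 : nu <= 0 by nra.
  by rewrite !ler0_norm//; nra.
have := A_slope (ltW x0); rewrite E (bcA0 bc) => ?.
have n0 : 0 <= nu by nra.
by rewrite !ger0_norm//; [nra|lra].
Qed.

Lemma A_fix_le0 xL : nu <= 0 -> A xL = xL -> xL <= 0.
Proof.
have [[? ? ?] [? ? ? ?]] := bc_consts => n0 E.
by have [//|x0] := leP xL 0; have := A_slope (ltW x0); rewrite E (bcA0 bc); nra.
Qed.

Lemma B_fix_gt0 xR : 0 < nu -> B xR = xR -> 0 < xR < nu.
Proof.
have [[? ? ?] [? ? ? ?]] := bc_consts => n0 E.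
have x0 : 0 < xR.
  by rewrite ltNge; apply/negP => x0; have := B_slope x0; rewrite E (bcB0 bc); nra.
by have := B_slope (ltW x0); rewrite E (bcB0 bc); nra.
Qed.

(** Since [B \o A] contracts and sends 0 to [B nu < 0], its fixed point cannot be nonnegative. *)
Lemma BA_fix_lt0 uL : 0 < nu -> B (A uL) = uL -> uL < 0 /\ nu < A uL.
Proof.
have [[? ? ?] [? ? ? ?]] := bc_consts => n0 E.
have u0 : uL < 0.
  rewrite ltNge; apply/negP => u0.
  have := BA_lip uL 0; rewrite E (bcA0 bc) subr0 (ger0_norm u0).
  have := B_slope (ltW n0); rewrite (bcB0 bc) subr0 => hB.
  have Bn : B nu < 0 by nra.
  by rewrite ger0_norm; [nra|lra].
by split=> //; have := A_slope (ltW u0); rewrite (bcA0 bc); nra.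
Qed.

Lemma B_nu_lt0 : 0 < nu -> B nu < 0.
Proof.
have [[? ? ?] [? ? ? ?]] := bc_consts => n0.
by have := B_slope (ltW n0); rewrite (bcB0 bc) subr0; nra.
Qed.

Lemma BA_le0 x : 0 < nu -> x <= 0 -> B (A x) < 0.
Proof.
have [[? ? ?] [? ? ? ?]] := bc_consts => n0 x0.
have Ax : nu <= A x by have := A_slope x0; rewrite (bcA0 bc); nra.
by have := B_slope Ax; have := B_nu_lt0 n0; nra.
Qed.

Lemma pw2_le0 x : 0 <= nu -> x <= 0 -> f (f x) = B (A x).
Proof.
have [[? ? ?] [? ? ? ?]] := bc_consts => n0 x0; rewrite (pw_le0 x0) pw_ge0//.
by have := A_slope x0; rewrite (bcA0 bc); nra.
Qed.

(** A point of the cycle in x <= 0 is a fixed point of the contraction [B \o A]. A cycle inside x >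
    0 would contradict the expansion of [B]. *)
Lemma period_two_uniq uL x : 0 < nu -> B (A uL) = uL -> f (f x) = x -> f x <> x ->
  x = uL \/ x = A uL.
Proof.
have [[? ? ?] [? ? ? ?]] := bc_consts => n0 E.
have neg y : y <= 0 -> f (f y) = y -> y = uL.
  move=> y0; rewrite pw2_le0// ?ltW// => Ey; apply/eqP; rewrite -subr_eq0 -normr_eq0.
  have := BA_lip y uL; rewrite E Ey; have := normr_ge0 (y - uL).
  by move=> ? ?; rewrite eq_le; apply/andP; split; nra.
move=> ffx fx; have [x0|x0] := leP x 0; first by left; exact: neg.
have [fx0|fx0] := leP (f x) 0.
  right; have fE : f x = uL by apply: neg => //; rewrite ffx.
  by rewrite -ffx fE pw_le0// ltW// (BA_fix_lt0 n0 E).1.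
exfalso; apply: fx; rewrite (pw_ge0 (ltW fx0)) (pw_ge0 (ltW x0)) in ffx.
rewrite (pw_ge0 (ltW x0)).
have [h|h|//] := ltgtP (B x) x.
  by have := B_slope (ltW h); rewrite ffx; nra.
by have := B_slope (ltW h); rewrite ffx; nra.
Qed.

(** When [nu <= 0], a positive point is mapped to x <= 0. Hence of any two consecutive steps at
    least one uses the left branch, and the factor is at most al' ga'. *)
Lemma pw2_contract_nonpos xL x : nu <= 0 -> A xL = xL ->
  `|f (f x) - xL| <= th * `|x - xL|.
Proof.
have [[? ? ?] [? ? ? ?]] := bc_consts => n0 E; have xL0 := A_fix_le0 n0 E.
have fE : f xL = xL by rewrite pw_le0.
have [x0|x0] := leP x 0.
  rewrite -{1}fE (le_trans (pw_lip _ _))// /th (mulrC al') -mulrA ler_wpM2l//; first lra.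
  by rewrite (pw_le0 x0) -{1}E; exact: A_lip.
have fx0 : f x <= 0 by rewrite pw_ge0 ?ltW//; have := B_slope (ltW x0); rewrite (bcB0 bc); nra.
rewrite (pw_le0 fx0) -{1}E (le_trans (A_lip _ _))// /th -mulrA ler_wpM2l//; first lra.
by rewrite -{1}fE; exact: pw_lip.
Qed.

Lemma iter_pw2_nonpos xL x : nu <= 0 -> A xL = xL ->
  iter n (f \o f) x @[n --> \oo] --> xL.
Proof.
have [[? ? ?] [? ? ? ?]] := bc_consts => n0 E.
apply: (@iter_contract _ _ setT th) => //; first by rewrite ltW.
by move=> y _; split=> //; exact: pw2_contract_nonpos.
Qed.

(** On (0, xR) the map f^2 is [B \o B] and expands away from [xR], so the orbit must leave to x <=
    0, where f^2 is [B \o A] and contracts to [uL]. *)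
Lemma iter_pw2_attr uL xR x : 0 < nu -> B (A uL) = uL -> B xR = xR -> x < xR ->
  iter n (f \o f) x @[n --> \oo] --> uL.
Proof.
have [[? ? ?] [? ? ? ?]] := bc_consts => n0 Eu Ex xxR.
have /andP[xR0 xRn] := B_fix_gt0 n0 Ex.
have fE : f xR = xR by rewrite pw_ge0// ltW.
have W n : iter n (f \o f) x < xR.
  by elim: n => //= n IH; rewrite -fE; apply/pw_decr; rewrite -fE; exact: pw_decr.
have exit n : iter n (f \o f) x <= 0 -> iter k (f \o f) x @[k --> \oo] --> uL.
  move=> H; apply: (iter_cvg_shift (N := n)).
  apply: (@iter_contract _ _ [set y | y <= 0] th) => //; first by rewrite ltW.
  move=> y /= y0; rewrite pw2_le0 ?(ltW n0)//; split; first exact/ltW/BA_le0.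
  by rewrite -{1}Eu; exact: BA_lip.
have [||||n /= Hn] := @iter_escape _ (f \o f) [set y | 0 < y < xR] ga xR xR x.
- lra.
- by rewrite lt_eqF.
- by move=> y /= /andP[? ?]; rewrite ler_norml; lra.
- move=> y /= /andP[y0 yx] _; rewrite (pw_ge0 (ltW y0)).
  have By : xR <= B y by have := B_slope (ltW yx); rewrite Ex; nra.
  rewrite pw_ge0; last lra.
  have h1 := B_slope (ltW yx); have h2 := B_slope By; rewrite Ex in h1 h2.
  rewrite ltr0_norm ?subr_lt0// ler0_norm; nra.
- apply: (exit n); rewrite leNgt; apply/negP => h; apply: Hn.
  by rewrite h W.
Qed.

(** Backwards the roles are reversed: on (uL, 0] the inverse of f^2 expands away from [uL] at rate
    at least 1 / th, until the orbit enters (0, nu), which the inverse of [B] contracts to [xR]. *)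
Lemma iter_inv_rep k uL xR x : cancel f k -> cancel k f -> {homo k : x y /~ x < y} ->
  0 < nu -> B (A uL) = uL -> B xR = xR ->
  uL < x < A uL -> iter n (k \o k) x @[n --> \oo] --> xR.
Proof.
have [[? ? ?] [? ? ? ?]] := bc_consts => fk kf kd n0 Eu Ex.
have /andP[xR0 xRn] := B_fix_gt0 n0 Ex.
have [uL0 nuR] := BA_fix_lt0 n0 Eu.
have fE : f xR = xR by rewrite pw_ge0// ltW.
have kE : k xR = xR by rewrite -{1}fE fk.
have kL : k (A uL) = uL by rewrite -(pw_le0 (ltW uL0)) fk.
have kR : k uL = A uL by rewrite -{1}Eu -pw_ge0 ?fk//; lra.
have W y : uL < y < A uL -> uL < k y < A uL.
  by move=> /andP[h1 h2]; rewrite -{1}kL -{2}kR !kd.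
have kcE : {for xR, continuous f} by exact: pw_continuous.
have near0 y : 0 < y < nu -> iter n (k \o k) y @[n --> \oo] --> xR.
  have kn : k nu = 0 by rewrite -pw0 fk.
  have k0 : k 0 < nu.
    rewrite -[X in _ < X](fk nu); apply: kd; rewrite pw_ge0 ?(ltW n0)//; exact: B_nu_lt0.
  apply: (@iter_contract _ _ [set y | 0 < y < nu] ga^-1).
    by rewrite invr_ge0 invf_lt1; [apply/andP; split|]; lra.
  have S1 z : 0 < z < nu -> 0 < k z < nu.
    by move=> /andP[h1 h2]; rewrite -{1}kn kd//= (lt_trans (kd _ _ h1)).
  have S2 z : 0 < z < nu -> `|k z - xR| <= ga^-1 * `|z - xR|.
    move=> zn; have /andP[kz0 _] := S1 z zn.
    have Bk : B (k z) = z by rewrite -pw_ge0 ?kf// ltW.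
    rewrite ler_pdivlMl; last lra.
    rewrite -{2}Bk -{2}Ex; have [h|h] := leP (k z) xR.
      have := B_slope h => ?; rewrite ler0_norm ?subr_le0// ger0_norm; nra.
    by have := B_slope (ltW h) => ?; rewrite gtr0_norm ?subr_gt0// ler0_norm; nra.
  move=> z zn; split; first exact/S1/S1.
  rewrite (le_trans (S2 _ (S1 _ zn)))//.
  apply: ler_wpM2l; first by rewrite invr_ge0; lra.
  by rewrite (le_trans (S2 _ zn))// ler_piMl// invf_le1; lra.
have left y : uL < y < xR -> iter n (k \o k) y @[n --> \oo] --> xR.
  move=> /andP[uy yx].
  have I n : uL < iter n (k \o k) y < xR.
    elim: n => [|n /andP[h1 h2]]; first by rewrite uy.
    have z1 : xR < k (iter n (k \o k) y) by rewrite -{1}kE; exact: kd.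
    have z2 : k (iter n (k \o k) y) < A uL by rewrite -kR; exact: kd.
    apply/andP; split=> /=; first by rewrite -{1}kL; exact: kd.
    by rewrite -[X in _ < X]kE; exact: kd.
  have m1 : 1 < th^-1 by rewrite invf_gt1.
  have uy' : y != uL by rewrite gt_eqF.
  have [||n /= Hn] := @iter_escape _ (k \o k) [set y | uL < y <= 0] th^-1 `|uL| uL y m1 uy'.
  - by move=> z /= /andP[? ?]; rewrite (ltr0_norm uL0) ger0_norm; lra.
  - move=> z /= /andP[? ?] /andP[? h]; rewrite ler_pdivrMl//.
    have {1}-> : z = B (A (k (k z))) by rewrite -pw2_le0// ?kf// ltW.
    by rewrite -{1}Eu; exact: BA_lip.
  - apply: (iter_cvg_shift (N := n)); apply: near0.
    have /andP[h1 h2] := I n; apply/andP; split; last by rewrite (lt_trans h2).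
    by rewrite ltNge; apply/negP => h3; apply: Hn; rewrite h1.
move=> /andP[ux xu]; have [h|h|->] := ltgtP x xR.
- by apply: left; rewrite ux.
(* A point to the right of [xR] is moved to its left by [k]; applying the continuous [f] to the
   limit brings the statement back. *)
- have : iter n (k \o k) (k x) @[n --> \oo] --> xR.
    apply: left; apply/andP; split; first by rewrite -{1}kL; exact: kd.
    by rewrite -[X in _ < X]kE; exact: kd.
  move=> /(continuous_cvg _ kcE); rewrite fE.
  apply: cvg_trans; apply: near_eq_cvg; apply: nearW.
  elim=> [|n IH] /=; first by rewrite kf.
  by rewrite kf -IH fk.
- rewrite (_ : (fun n => _) = cst xR); first exact: cvg_cst.
  by apply/funext => n; elim: n => //= n ->; rewrite !kE.
Unshelve. all: by end_near. Qed.

End OneMap.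
End BorderCollisionMaps.

Section Conjugacies.
Variable R : realType.
Implicit Types (x y : R) (f g h : R -> R).

Definition incr_bij h := {homo h : x y / x < y} /\ forall y, exists x, h x = y.

Lemma incr_bij_continuous h : incr_bij h -> continuous h.
Proof. by case; exact: incr_surj_continuous. Qed.

Lemma incr_bij_mono h : incr_bij h -> {mono h : x y / x < y}.
Proof. by move=> [hi _]; apply/leW_mono/le_mono. Qed.

Definition incr_diff_at h x := exists2 d : R, 0 < d & sdiff h x d.

Lemma koenigs_ext (F G : R -> R) (u lam x : R) :
  (forall n, iter n F x = iter n G x) -> koenigs F u lam x = koenigs G u lam x.
Proof.
move=> E; rewrite /koenigs (_ : lin_seq F u lam x = lin_seq G u lam x)//.
by apply/funext => n; rewrite /lin_seq E.
Qed.

(** For [nu >= 0] the half line x <= 0 is invariant under f^2, which equals [B \o A] there. The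
    coordinate of the kinked map thus obeys the estimates for a smooth map. *)
Lemma koenigs_pw2_le0 al al' ga ga' K nu (A A' B B' : R -> R) u lam x :
  bcmap al al' ga ga' K nu A A' B B' -> 0 <= nu -> x <= 0 ->
  koenigs (pw A B \o pw A B) u lam x = koenigs (B \o A) u lam x.
Proof.
move=> bc n0 x0; apply: koenigs_ext => n.
have [_ [_ _ _ th1]] := bc_consts bc.
have [[a0 a1 a2] [? ? ? ?]] := bc_consts bc.
suff [-> //] : iter n (pw A B \o pw A B) x = iter n (B \o A) x /\ iter n (B \o A) x <= 0.
elim: n => [//|n [E IH]]; rewrite !iterS E /= (pw2_le0 bc)//; split=> //.
have h1 := A_slope bc IH; rewrite (bcA0 bc) in h1.
have h2 : 0 <= A (iter n (B \o A) x) by nra.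
have := B_slope bc h2; rewrite (bcB0 bc) => h3.
have h4 : nu <= A (iter n (B \o A) x) by nra.
nra.
Qed.

(** A decreasing map exchanges the two sides of its fixed point, so a conjugacy of the squares on
    the left determines the only possible value on the right, [kg (hl (f x))]. *)
Lemma extend_right f g kf kg (hl : R -> R) c c' :
  {homo f : x y /~ x < y} -> cancel f kf -> cancel kf f -> {homo kf : x y /~ x < y} ->
  cancel g kg -> cancel kg g -> {homo g : x y /~ x < y} -> {homo kg : x y /~ x < y} ->
  f c = c -> g c' = c' -> hl c = c' ->
  (forall x y, y <= c -> x < y -> hl x < hl y) ->
  (forall y, y <= c' -> exists2 x, x <= c & hl x = y) ->
  (forall x, x <= c -> hl (f (f x)) = g (g (hl x))) ->
  let h x := if x <= c then hl x else kg (hl (f x)) in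
  incr_bij h /\ forall x, h (f x) = g (h x).
Proof.
move=> fd fk kf_ kfd gk kg_ gd kgd fc gc hc hi hs hE h.
have kfc : kf c = c by rewrite -{1}fc fk.
have kgc : kg c' = c' by rewrite -{1}gc gk.
have hle x : x <= c -> h x = hl x by rewrite /h => ->.
have hgt x : c < x -> h x = kg (hl (f x)) by rewrite /h leNgt => ->.
have fgt x : c < x -> f x < c by move=> /fd; rewrite fc.
have flt x : x < c -> c < f x by move=> /fd; rewrite fc.
have hl_le x : x <= c -> hl x <= c'.
  by rewrite le_eqVlt => /orP[/eqP->|/(hi _ _ (lexx c))]; rewrite hc// => /ltW.
split; [split|].
- move=> x y xy; have [yc|yc] := leP y c.
    by rewrite !hle ?hi// (le_trans (ltW xy)).
  rewrite (hgt y)//; have [xc|xc] := leP x c.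
    rewrite hle// (le_lt_trans (hl_le _ xc))// -{1}kgc; apply: kgd.
    by rewrite -hc hi// fgt.
  by rewrite hgt//; apply: kgd; apply: hi; [exact/ltW/fgt|exact: fd].
- move=> y; have [yc|yc] := leP y c'.
    by have [x xc <-] := hs y yc; exists x; rewrite hle.
  have gy : g y < c' by rewrite -gc; exact: gd.
  have [x xc Ex] := hs _ (ltW gy); exists (kf x); rewrite hgt ?kf_ ?Ex ?gk//.
  rewrite -{1}kfc; apply: kfd; rewrite lt_neqAle xc andbT.
  by apply: contraTneq gy => xE; rewrite -Ex xE hc ltxx.
- move=> x; have [xc|xc|->] := ltgtP x c.
  + by rewrite hgt ?flt// (hle x) ?(ltW xc)// hE ?ltW// gk.
  + by rewrite (hgt x)// kg_ hle// ltW// fgt.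
  + by rewrite fc hle// hc gc.
Qed.

Section TwoMaps.
Variables (al al' ga ga' K nu : R) (A A' B B' C C' D D' : R -> R).
Hypothesis bcf : bcmap al al' ga ga' K nu A A' B B'.
Hypothesis bcg : bcmap al al' ga ga' K nu C C' D D'.
Hypothesis ratio : A' 0 * D' 0 = B' 0 * C' 0.
Let f := pw A B.
Let g := pw C D.
Let th := al' * ga'.

Let negA x : A' x < 0.
Proof. by have [[? _ _] _] := bc_consts bcf; have := bcA' bcf x; lra. Qed.
Let negB x : B' x < 0.
Proof. by have [_ [? _ _ _]] := bc_consts bcf; have := bcB' bcf x; lra. Qed.
Let negC x : C' x < 0.
Proof. by have [[? _ _] _] := bc_consts bcf; have := bcA' bcg x; lra. Qed.
Let negD x : D' x < 0.
Proof. by have [_ [? _ _ _]] := bc_consts bcf; have := bcB' bcg x; lra. Qed.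

Let divneg (a b : R) : a < 0 -> b < 0 -> 0 < a / b.
Proof. by move=> a0 b0; rewrite nmulr_rgt0// invr_lt0. Qed.

(** As [h] is increasing and fixes 0, [x] and [h x] lie on the same side of the kink. The hypothesis
    [ratio] is used only at [x = 0]. *)
Lemma conj_sdiff_step h x r : incr_bij h -> h 0 = 0 -> 0 < r ->
  (forall y, `|y - x| < r -> h (f y) = g (h y)) ->
  incr_diff_at h (f x) -> incr_diff_at h x.
Proof.
move=> hb h0 r0 E; have hm := incr_bij_mono hb.
have hn y : (h y < 0) = (y < 0) by rewrite -{1}h0 hm.
have hz y : (h y <= 0) = (y <= 0) by rewrite !leNgt -{1}h0 hm.
have := pw_sided bcg (h x); rewrite hn hz => Sg.
apply: (sdiff_pullback r0 E _ _ (pw_sided bcf x) Sg).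
- by move=> y z; rewrite leNgt -hm -leNgt.
- exact: incr_bij_continuous.
- by case: ifP => _; exact: divneg.
- by case: ifP => _; exact: divneg.
- by case: ltgtP => // ->; rewrite h0 ratio.
Qed.

Lemma conj_sdiff_step_inv kf kg h y r : incr_bij h -> h 0 = 0 -> 0 < r ->
  cancel f kf -> cancel kf f -> continuous kf ->
  cancel g kg -> cancel kg g -> continuous kg ->
  (forall z, `|z - y| < r -> h (kf z) = kg (h z)) ->
  incr_diff_at h (kf y) -> incr_diff_at h y.
Proof.
move=> hb h0 r0 fk kf_ kfc gk kg_ kgc E; have hm := incr_bij_mono hb.
pose x := kf y; have hn z : (h z < 0) = (z < 0) by rewrite -{1}h0 hm.
have hz z : (h z <= 0) = (z <= 0) by rewrite !leNgt -{1}h0 hm.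
have fx : f x = y by rewrite /x kf_.
have gx : g (h x) = h y by rewrite /x E ?subrr ?normr0// kg_.
have Sf : sided kf y (if x < 0 then A' x else B' x)^-1 (if x <= 0 then A' x else B' x)^-1.
  rewrite -fx; apply: sided_inv (pw_sided bcf x) => //.
  - exact: pw_decr bcf.
  - exact: kfc.
  - by case: ifP => _; rewrite lt_eqF.
  - by case: ifP => _; rewrite lt_eqF.
have Sg : sided kg (h y) (if x < 0 then C' (h x) else D' (h x))^-1
   (if x <= 0 then C' (h x) else D' (h x))^-1.
  rewrite -gx -hn -hz; apply: sided_inv (pw_sided bcg (h x)) => //.
  - exact: pw_decr bcg.
  - exact: kgc.
  - by case: ifP => _; rewrite lt_eqF.
  - by case: ifP => _; rewrite lt_eqF.
apply: (sdiff_pullback r0 E _ _ Sf Sg).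
- by move=> z w; rewrite leNgt -hm -leNgt.
- exact: incr_bij_continuous.
- by case: ifP => _; rewrite invrK mulrC; exact: divneg.
- by case: ifP => _; rewrite invrK mulrC; exact: divneg.
- rewrite -!invfM; congr (_^-1).
  by case: ltgtP => // ->; rewrite h0 ratio.
Qed.

Lemma conj_sdiff_iter h (S : set R) x n : incr_bij h -> h 0 = 0 ->
  open S -> (forall y, S y -> S (f y)) -> (forall y, S y -> h (f y) = g (h y)) ->
  S x -> incr_diff_at h (iter n f x) -> incr_diff_at h x.
Proof.
move=> hb h0 oS SfS E; elim: n x => [//|n IH] x Sx; rewrite iterSr => H.
have [r /= r0 Hr] : nbhs_ball x S by apply/nbhs_ballP; exact: open_nbhs_nbhs.
apply: (conj_sdiff_step hb h0 r0); last by apply: IH => //; exact: SfS.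
by move=> y yr; apply: E; apply: Hr; rewrite /ball/= distrC.
Qed.

Lemma conj_sdiff_iter_inv kf kg h (S : set R) x n : incr_bij h -> h 0 = 0 ->
  cancel f kf -> cancel kf f -> continuous kf ->
  cancel g kg -> cancel kg g -> continuous kg ->
  open S -> (forall y, S y -> S (kf y)) -> (forall y, S y -> h (kf y) = kg (h y)) ->
  S x -> incr_diff_at h (iter n kf x) -> incr_diff_at h x.
Proof.
move=> hb h0 fk kf_ kfc gk kg_ kgc oS SfS E; elim: n x => [//|n IH] x Sx; rewrite iterSr => H.
have [r /= r0 Hr] : nbhs_ball x S by apply/nbhs_ballP; exact: open_nbhs_nbhs.
apply: (conj_sdiff_step_inv hb h0 r0 fk kf_ kfc gk kg_ kgc); last by apply: IH => //; exact: SfS.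
by move=> y yr; apply: E; apply: Hr; rewrite /ball/= distrC.
Qed.

End TwoMaps.
End Conjugacies.

Section LinearisedMaps.
Variable R : realType.
Variables (al al' ga ga' K nu : R) (A A' B B' : R -> R).
Hypothesis bc : bcmap al al' ga ga' K nu A A' B B'.
Implicit Types x y : R.
Local Notation f := (pw A B).
Let th := al' * ga'.

Let negA x : A' x < 0.
Proof. by have [[? _ _] _] := bc_consts bc; have := bcA' bc x; lra. Qed.
Let negB x : B' x < 0.
Proof. by have [_ [? _ _ _]] := bc_consts bc; have := bcB' bc x; lra. Qed.

Lemma A_fix_lt0 xL : nu < 0 -> A xL = xL -> xL < 0.
Proof.
move=> n0 E; rewrite lt_neqAle (A_fix_le0 bc (ltW n0) E) andbT.
apply: contraTneq n0 => x0; have := A_fix_norm bc E.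
by rewrite x0 normr0 mulr0 => /andP[_]; rewrite normr_le0 => /eqP ->; rewrite ltxx.
Qed.

(** Within distance [- xL] of [xL] both a point and its image under [A] are nonpositive, so the
    smooth model of f^2 there is [A \o A]. *)
Lemma linearises_neg xL : nu < 0 -> A xL = xL ->
  linearises setT (f \o f) xL (A' xL * A' xL) (koenigs (f \o f) xL (A' xL * A' xL)).
Proof.
move=> n0 E; have x0 := A_fix_lt0 n0 E.
have [[? ? ?] [? ? ? th1]] := bc_consts bc.
have [k [fk kf kd kc]] := pw_inv bc.
apply: (koenigs_linearises (Fi := k \o k) (r0 := - xL) (G := A \o A)
  (G' := fun x => A' (A x) * A' x) (th := th) _ _ _ _ _ _ _ _ (AA_C11 bc)) => //.
- exact: openT.
- by move=> x _; rewrite /= !kf.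
- by move=> x y _ _ /(pw_decr bc)/(pw_decr bc).
- by move=> x _; exact: iter_pw2_nonpos bc _ _ (ltW n0) E.
- by rewrite oppr_gt0.
- move=> x xr; have xl : x <= 0 by move: xr; rewrite ler_norml; lra.
  have Ax : A x <= 0.
    have := A_lip bc x xL; rewrite E => h.
    have : `|A x - xL| <= - xL.
      rewrite (le_trans h)// (le_trans _ xr)// ler_piMl//; lra.
    by rewrite ler_norml; lra.
  by rewrite /= (pw_le0 _ _ xl) pw_le0.
- exact: normAA bc.
- by rewrite /= !E.
- by rewrite E.
- by rewrite nmulr_rgt0.
Qed.

Lemma linearises_attr uL xR : 0 < nu -> B (A uL) = uL -> B xR = xR ->
  linearises [set x | x < xR] (f \o f) uL (B' (A uL) * A' uL)
    (koenigs (f \o f) uL (B' (A uL) * A' uL)).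
Proof.
move=> n0 Eu Ex; have [[? ? ?] [? ? ? th1]] := bc_consts bc.
have /andP[xR0 xRn] := B_fix_gt0 bc n0 Ex.
have [uL0 nuR] := BA_fix_lt0 bc n0 Eu.
have fE : f xR = xR by rewrite (pw_ge0 bc)// ltW.
have [k [fk kf kd kc]] := pw_inv bc.
have kE : k xR = xR by rewrite -{1}fE fk.
apply: (koenigs_linearises (Fi := k \o k) (r0 := - uL) (G := B \o A)
  (G' := fun x => B' (A x) * A' x) (th := th) _ _ _ _ _ _ _ _ (BA_C11 bc)) => //.
- by rewrite /=; lra.
- by move=> x /= /(pw_decr bc)/(pw_decr bc); rewrite !fE.
- by move=> x /= /kd/kd; rewrite !kE !kf.
- by move=> x y _ _ /(pw_decr bc)/(pw_decr bc).
- by move=> x /=; exact: iter_pw2_attr bc _ _ _ n0 Eu Ex.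
- by rewrite oppr_gt0.
- move=> x xr; have xl : x <= 0 by move: xr; rewrite ler_norml; lra.
  by rewrite /= (pw2_le0 bc)// ltW.
- exact: normBA bc.
- by rewrite nmulr_rgt0.
Qed.

Lemma linearises_BA uL : B (A uL) = uL ->
  linearises setT (B \o A) uL (B' (A uL) * A' uL)
    (koenigs (B \o A) uL (B' (A uL) * A' uL)).
Proof.
move=> Eu; have [[al0 ? ?] [ga1 ? ? th1]] := bc_consts bc.
have ga0 : 0 < ga by lra.
have [|||kA [AkA kAA]] := @slope_bij R A al; first by [].
- exact: C11_continuous (bcA bc).
- by move=> x y /(A_slope bc)/andP[].
have [|||kB [BkB kBB]] := @slope_bij R B ga; first by [].
- exact: C11_continuous (bcB bc).
- by move=> x y /(B_slope bc)/andP[].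
apply: (koenigs_linearises (Fi := kA \o kB) (r0 := 1) (G := B \o A)
  (G' := fun x => B' (A x) * A' x) (th := th) _ _ _ _ _ _ _ _ (BA_C11 bc)) => //.
- exact: openT.
- by move=> x _; rewrite /= kAA kBB.
- move=> x y _ _ xy; have h1 := A_slope bc (ltW xy).
  have h2 : A y < A x by nra.
  by have h3 := B_slope bc (ltW h2); rewrite /=; nra.
- move=> x _; apply: (@iter_contract _ _ setT th) => //; first by rewrite ltW.
  by move=> y _; split=> //=; rewrite -{1}Eu; exact: BA_lip bc _ _.
- exact: normBA bc.
- by rewrite nmulr_rgt0.
Qed.

(** Inverting turns the repelling [xR] into an attracting fixed point. The smooth model is the
    inverse of [B], which agrees with [k] on y <= nu; the radius keeps the ball within [0, nu]. *)
Lemma linearises_rep k uL xR : cancel f k -> cancel k f -> {homo k : x y /~ x < y} ->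
  0 < nu -> B (A uL) = uL -> B xR = xR ->
  linearises [set x | uL < x < A uL] (k \o k) xR ((B' xR)^-1 * (B' xR)^-1)
    (koenigs (k \o k) xR ((B' xR)^-1 * (B' xR)^-1)) /\ sdiff k xR (B' xR)^-1.
Proof.
move=> fk kf kd n0 Eu Ex; have [[? ? ?] [ga1 ? ? th1]] := bc_consts bc.
have /andP[xR0 xRn] := B_fix_gt0 bc n0 Ex.
have [uL0 nuR] := BA_fix_lt0 bc n0 Eu.
have ga0 : 0 < ga by lra.
have fE : f xR = xR by rewrite (pw_ge0 bc)// ltW.
have kE : k xR = xR by rewrite -{1}fE fk.
have kL : k (A uL) = uL by rewrite -(pw_le0 A B (ltW uL0)) fk.
have kR : k uL = A uL by rewrite -{1}Eu -(pw_ge0 bc) ?fk//; lra.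
have [|||kB [BkB kBB]] := @slope_bij R B ga; first by [].
- exact: C11_continuous (bcB bc).
- by move=> x y /(B_slope bc)/andP[].
have kBE y : y <= nu -> k y = kB y.
  move=> yn; rewrite -{1}(kBB y) -(pw_ge0 bc) ?fk//.
  rewrite leNgt; apply/negP => h; have := B_slope bc (ltW h).
  by rewrite kBB (bcB0 bc); nra.
have CkB : C11 (K / ga ^+ 3) kB (fun y => (B' (kB y))^-1).
  apply: (C11_inv (bcB bc)) => // x; by have := bcB' bc x => /andP[].
have nkB y : `|(B' (kB y))^-1| <= ga^-1.
  rewrite normfV lef_pV2 ?posrE ?normr_gt0 ?lt_eqF//.
  by rewrite ltr0_norm//; have /andP[] := bcB' bc (kB y).
have kBx : kB xR = xR by rewrite -kBE// ltW.
have kn0 : k 0 < nu.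
  rewrite -[X in _ < X](fk nu); apply: kd; rewrite (pw_ge0 bc) ?(ltW n0)//.
  exact: B_nu_lt0 bc n0.
split; last first.
  have r0 : 0 < nu - xR by rewrite subr_gt0.
  rewrite -{2}kBx; apply: (sdiff_in_local r0 _ (C11_sdiff xR CkB)) => y _ yr.
  by rewrite kBE//; move: yr; rewrite ltr_norml; lra.
apply: (koenigs_linearises (Fi := f \o f) (r0 := Num.min xR (nu - xR))
  (G := kB \o kB) (G' := fun x => (B' (kB (kB x)))^-1 * (B' (kB x))^-1)
  (th := ga^-1 * ga^-1) _ _ _ _ _ _ _ _ (C11_comp CkB CkB nkB nkB)) => //.
- have -> : [set x | uL < x < A uL] = [set x | uL < x] `&` [set x | x < A uL].
    by apply/seteqP; split=> x /= => [/andP[]|[-> ->]].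
  by apply: openI; [exact: open_gt|exact: open_lt].
- by rewrite /=; apply/andP; split; lra.
- move=> x /= /andP[h1 h2]; apply/andP; split.
    by rewrite -{1}kL; apply/kd; rewrite -kR; exact/kd.
  by rewrite -[X in _ < X]kR; apply/kd; rewrite -{1}kL; exact/kd.
- have fL : f uL = A uL by rewrite pw_le0// ltW.
  have fR : f (A uL) = uL by rewrite (pw_ge0 bc)//; lra.
  move=> x /= /andP[h1 h2]; rewrite !fk; split=> //; apply/andP; split.
    by rewrite -{1}fR; apply/(pw_decr bc); rewrite -fL; exact/(pw_decr bc).
  by rewrite -[X in _ < X]fL; apply/(pw_decr bc); rewrite -[X in X < _]fR; exact/(pw_decr bc).
- by move=> x y _ _ /kd/kd.
- by move=> x /=; exact: iter_inv_rep bc _ _ _ _ fk kf kd n0 Eu Ex.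
- by rewrite lt_min xR0 subr_gt0.
- move=> x; rewrite le_min !ler_norml => /andP[h1 h2].
  have x0 : 0 <= x by lra.
  have xn : x <= nu by lra.
  rewrite /= (kBE x)// kBE// -kBE// ltW// (le_lt_trans _ kn0)//.
  by move: x0; rewrite le_eqVlt => /orP[/eqP<-//|/kd/ltW].
- move=> x; rewrite normrM; apply: ler_pM => //; exact: nkB.
- by rewrite -invfM invf_lt1 ?mulr_gt0//; nra.
- by rewrite /= !kBx.
- by rewrite !kBx.
- by rewrite nmulr_rgt0 invr_lt0.
Qed.

End LinearisedMaps.

Section ConjugacyTheorems.
Variable R : realType.
Implicit Types (x y : R) (h : R -> R).

(** [h] is a bijection of the whole line even when it conjugates only on [S], so that monotonicity
    and continuity carry no domain conditions. *)
Record diff_conj (f g : R -> R) (S : set R) h : Prop := {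
  dc_bij : incr_bij h;
  dc0 : h 0 = 0;
  dc_eq : forall x, S x -> h (f x) = g (h x);
  dc_diff : forall x, S x -> incr_diff_at h x }.

Variables (al al' ga ga' K nu : R) (A A' B B' C C' D D' : R -> R).
Hypothesis bcf : bcmap al al' ga ga' K nu A A' B B'.
Hypothesis bcg : bcmap al al' ga ga' K nu C C' D D'.
Hypothesis ratio : A' 0 * D' 0 = B' 0 * C' 0.
Local Notation f := (pw A B).
Local Notation g := (pw C D).

Lemma lin_inj (W : set R) F (u lam : R) phi x y : linearises W F u lam phi ->
  W x -> W y -> phi x = phi y -> x = y.
Proof.
move=> L Wx Wy E; have [xy|xy|//] := ltgtP x y.
  by have := lin_incr L Wx Wy xy; rewrite E ltxx.
by have := lin_incr L Wy Wx xy; rewrite E ltxx.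
Qed.

(** As [xL < 0], the coordinate of 0 is nonzero and [c] can be chosen so that [h 0 = 0]. The
    coordinates linearise f and g themselves with the common multiplier [A' xL], so injectivity of
    [psi] makes [h] a conjugacy of f and g. *)
Lemma conj_neg xL yL : nu < 0 -> A xL = xL -> C yL = yL -> A' xL = C' yL ->
  exists h c, [/\ 0 < c, diff_conj f g setT h & forall x,
    koenigs (g \o g) yL (A' xL * A' xL) (h x) =
    c * koenigs (f \o f) xL (A' xL * A' xL) x].
Proof.
move=> n0 Ex Ey E.
have x0 := A_fix_lt0 bcf n0 Ex; have y0 := A_fix_lt0 bcg n0 Ey.
have Lf := linearises_neg bcf n0 Ex.
have Lg := linearises_neg bcg n0 Ey; rewrite -E in Lg.
set phi := koenigs (f \o f) _ _ in Lf *; set psi := koenigs (g \o g) _ _ in Lg *.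
have phi0 : 0 < phi 0 by have := lin_incr Lf Logic.I Logic.I x0; rewrite (lin_fix Lf).
have psi0 : 0 < psi 0 by have := lin_incr Lg Logic.I Logic.I y0; rewrite (lin_fix Lg).
pose c := psi 0 / phi 0; have c0 : 0 < c by rewrite divr_gt0.
have [h [hE hi hs _]] := lin_conj c0 (fun _ _ => Logic.I) (fun _ _ => Logic.I) Lf Lg.
have hb : incr_bij h.
  by split=> [x y /hi|y]; [exact|have [x _ <-] := hs y Logic.I; exists x].
have hc := incr_bij_continuous hb.
have h0 : h 0 = 0.
  apply: (lin_inj Lg) => //; rewrite (hE 0 Logic.I).2 /c divfK// gt_eqF//.
have sdf : sdiff f xL (A' xL) by have := (pw_sided bcf xL); rewrite x0 (ltW x0);
  case=> s1 s2; exact: sdiff_glue.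
have sdg : sdiff g yL (A' xL) by rewrite E; have := (pw_sided bcg yL); rewrite y0 (ltW y0);
  case=> s1 s2; exact: sdiff_glue.
have phif x : phi (f x) = A' xL * phi x.
  apply: (cvg_unique (@Rhausdorff R)) (lin_cvg Lf (x := f x) Logic.I) _.
  apply: (lin_seq_commute _ _ sdf) => //; first by rewrite (pw_le0 _ _ (ltW x0)).
    exact: (iter_pw2_nonpos bcf x (ltW n0) Ex).
  exact: (lin_cvg Lf).
have psig x : psi (g x) = A' xL * psi x.
  apply: (cvg_unique (@Rhausdorff R)) (lin_cvg Lg (x := g x) Logic.I) _.
  apply: (lin_seq_commute _ _ sdg) => //; first by rewrite (pw_le0 _ _ (ltW y0)).
    exact: (iter_pw2_nonpos bcg x (ltW n0) Ey).
  exact: (lin_cvg Lg).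
have hf x : h (f x) = g (h x).
  apply: (lin_inj Lg) => //; rewrite psig !(hE _ Logic.I).2 phif.
  by rewrite mulrCA.
exists h, c; split=> //; last by move=> x; exact: (hE x Logic.I).2.
split=> // x _.
have [_ [r r0 Hr]] := lin_conj_sdiff c0 Lf Lg hE (fun x _ => hc x).
have /cvgrPdist_lt/(_ r r0)[N _ HN] := iter_pw2_nonpos bcf x (ltW n0) Ex.
apply: (conj_sdiff_iter bcf bcg ratio (S := setT) (n := N.*2) hb h0) => //.
  exact: openT.
rewrite -iter_comp2; apply: (Hr _ _).2; rewrite distrC; exact: HN (leqnn _).
Qed.

(** For [nu = 0] the fixed point is the kink itself: f^2 has no smooth model on both sides of it.
    The coordinate of [B \o A] is used on x <= 0 only, the right side follows by reflection through
    f, and [c = 1] makes [h] tangent to the identity at 0. *)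
Lemma conj_zero : nu = 0 -> A' 0 = C' 0 -> exists h, diff_conj f g setT h /\
  forall x, x <= 0 -> koenigs (D \o C) 0 (B' 0 * A' 0) (h x) =
    koenigs (B \o A) 0 (B' 0 * A' 0) x.
Proof.
move=> n0 E.
have A0 := bcA0 bcf; have B0 := bcB0 bcf; have C0 := bcA0 bcg; have D0 := bcB0 bcg.
rewrite n0 in A0 B0 C0 D0.
have [[? ? ?] [? ? ? ?]] := bc_consts bcf.
have negA : A' 0 < 0 by have := bcA' bcf 0; lra.
have negD : D' 0 < 0 by have := bcB' bcg 0; lra.
have E2 : B' 0 = D' 0.
  by move: ratio; rewrite E mulrC => /(mulIf _) ->//; rewrite -E lt_eqF.
have Lf : linearises setT (B \o A) 0 (B' 0 * A' 0) (koenigs (B \o A) 0 (B' 0 * A' 0)).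
  by have := linearises_BA bcf (uL := 0); rewrite A0; apply.
have Lg : linearises setT (D \o C) 0 (B' 0 * A' 0) (koenigs (D \o C) 0 (B' 0 * A' 0)).
  by rewrite E E2; have := linearises_BA bcg (uL := 0); rewrite C0; apply.
set phi := koenigs (B \o A) _ _ in Lf *; set psi := koenigs (D \o C) _ _ in Lg *.
have [hl [hE hi hs hF]] := lin_conj ltr01 (fun _ _ => Logic.I) (fun _ _ => Logic.I) Lf Lg.
have hlb : incr_bij hl.
  by split=> [x y /hi|y]; [exact|have [x _ <-] := hs y Logic.I; exists x].
have hlc := incr_bij_continuous hlb.
have hl0 : hl 0 = 0.
  by apply: (lin_inj Lg) => //; rewrite (hE 0 Logic.I).2 (lin_fix Lf) (lin_fix Lg) mulr0.
have [kf [fk kf_ kfd kfc]] := pw_inv bcf; have [kg [gk kg_ kgd kgc]] := pw_inv bcg.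
have fd := pw_decr bcf; have gd := pw_decr bcg.
have nu0 : 0 <= nu by rewrite n0.
have f0 : f 0 = 0 by rewrite (pw0 bcf) n0.
have g0 : g 0 = 0 by rewrite (pw0 bcg) n0.
have hlm := incr_bij_mono hlb.
have hl_le x : x <= 0 -> hl x <= 0 by rewrite !leNgt -{2}hl0 hlm.
pose h x := if x <= 0 then hl x else kg (hl (f x)).
have [hb hf] : incr_bij h /\ forall x, h (f x) = g (h x).
  apply: (extend_right fd fk kf_ kfd gk kg_ gd kgd f0 g0 hl0).
  - by move=> x y _; exact: hi.
  - move=> y y0; have [x _ xE] := hs y Logic.I; exists x => //.
    by rewrite leNgt -hlm hl0 xE -leNgt.
  - move=> x x0; rewrite (pw2_le0 bcf)// (pw2_le0 bcg) ?hl_le//.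
    exact: (hF x Logic.I).
have hle x : x <= 0 -> h x = hl x by rewrite /h => ->.
have h0 : h 0 = 0 by rewrite hle.
have hc := incr_bij_continuous hb; have hm := incr_bij_mono hb.
exists h; split; last by move=> x x0; rewrite hle// (hE x Logic.I).2 mul1r.
have [_ [r r0 Hr]] := lin_conj_sdiff ltr01 Lf Lg hE (fun x _ => hlc x).
split=> // x _.
have neg y : y < 0 -> `|y| < r -> incr_diff_at h y.
  move=> y0 yr; have [|_ [d d0 Hd]] := Hr y; first by rewrite subr0.
  exists d => //; have ny : 0 < - y by rewrite oppr_gt0.
  apply: (sdiff_in_local ny _ Hd) => z _; rewrite ltr_norml => zy; rewrite hle//; lra.
have zero : incr_diff_at h 0.
  have L1 : sdiff phi 0 1 by apply: (koenigs_sdiff_fix (BA_C11 bcf) (normBA bcf)) => //=;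
    rewrite ?A0// nmulr_rgt0//; have := bcB' bcf 0; lra.
  have L2 : sdiff psi 0 1 by rewrite /psi E E2; apply: (koenigs_sdiff_fix (BA_C11 bcg) (normBA bcg)) => //=;
    rewrite ?C0// nmulr_rgt0 -?E//; have := bcB' bcg 0; lra.
  have L3 : sdiff hl 0 1.
    rewrite -[1]divr1; apply: (sdiff_in_div (g := psi) (T := setT)) => //; last first.
    - apply: sdiff_ext L1 => y; by rewrite /= (hE y Logic.I).2 mul1r.
    - by rewrite hl0.
    - exact: hlc.
  (* On the left [h] is [hl]. On the right it solves [D \o h = hl \o B], and its slope is again 1
     since [B' 0 = D' 0]. *)
  exists 1 => //; apply: sdiff_glue.
    apply: (sdiff_in_local ltr01 _ (sdiff_inW _ L3)) => // y /= y0 _; by rewrite hle.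
  have -> : 1 = B' 0 / D' 0 by rewrite E2 divff// lt_eqF.
  apply: (sdiff_in_div (g := D) (T := setT)) => //=.
  - exact: hc.
  - by rewrite lt_eqF.
  - by rewrite h0; exact: C11_sdiff (bcB bcg).
  apply: (sdiff_in_local ltr01 (f := hl \o B)).
    move=> y /= y0 _; have By : B y <= 0.
      by have := B_slope bcf y0; rewrite B0; nra.
    rewrite -(hle _ By) -(pw_ge0 bcf y0) hf (pw_ge0 bcg)//.
    by rewrite leNgt -{1}h0 hm -leNgt.
  rewrite -[B' 0]mul1r; apply: (sdiff_in_comp (T := setT)) => //=.
    exact: sdiff_inW (C11_sdiff 0 (bcB bcf)).
  by rewrite B0.
have nu_le0 : nu <= 0 by rewrite n0.
have g1 : 1 <= ga' by lra.
(* The orbit may approach 0 from the right, where only one more application of f leads to the known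
   region. The margin [ga'] keeps that image within [r]. *)
have r1 : 0 < r / ga' by rewrite divr_gt0//; lra.
have /cvgrPdist_lt/(_ _ r1)[N _ HN] := iter_pw2_nonpos bcf x nu_le0 A0.
have xN : `|iter N.*2 f x| * ga' < r.
  rewrite -ltr_pdivlMr; last lra.
  by have := HN N (leqnn _); rewrite /= sub0r normrN iter_comp2.
have step := conj_sdiff_iter bcf bcg ratio (S := setT) hb h0 (@openT _) (fun _ _ => Logic.I) (fun y _ => hf y).
apply: (step x N.*2 Logic.I).
set z := iter _ f x in xN *; have [z0|z0|->//] := ltgtP z 0.
  by apply: neg => //; apply: le_lt_trans xN; rewrite ler_peMr.
apply: (step z 1%N Logic.I) => /=; apply: neg; first by rewrite -f0; exact: fd.
by have := pw_lip bcf z 0; rewrite f0 !subr0 mulrC => /le_lt_trans; exact.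
Qed.

(** The linearised half x < xR contains the kink, so [h 0 = 0] can be imposed there before
    reflecting through the fixed point. Differentiability is claimed off [xR], whose points all have
    orbits reaching a neighbourhood of [uL] under f^2, if necessary after one step of f. *)
Lemma conj_attr uL vL xR yR : 0 < nu -> B (A uL) = uL -> D (C vL) = vL ->
  B xR = xR -> D yR = yR -> B' (A uL) * A' uL = D' (C vL) * C' vL ->
  exists h c, [/\ 0 < c, diff_conj f g [set x | x != xR] h, h xR = yR, h uL = vL &
    forall x, x <= 0 -> koenigs (D \o C) vL (B' (A uL) * A' uL) (h x) =
      c * koenigs (B \o A) uL (B' (A uL) * A' uL) x].
Proof.
move=> n0 Eu Ev Ex Ey E.
have [[? ? ?] [? ? ? ?]] := bc_consts bcf.
have /andP[x0 _] := B_fix_gt0 bcf n0 Ex; have /andP[y0 _] := B_fix_gt0 bcg n0 Ey.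
have [u0 nuR] := BA_fix_lt0 bcf n0 Eu; have [v0 nvR] := BA_fix_lt0 bcg n0 Ev.
have Lf := linearises_attr bcf n0 Eu Ex.
have Lg := linearises_attr bcg n0 Ev Ey; rewrite -E in Lg.
set lam := B' _ * _ in Lf Lg *.
set phi := koenigs (f \o f) _ _ in Lf; set psi := koenigs (g \o g) _ _ in Lg.
have ux : uL < xR by lra.
have vy : vL < yR by lra.
have phi0 : 0 < phi 0.
  by have := lin_incr Lf (x := uL) (y := 0) ux x0 u0; rewrite (lin_fix Lf).
have psi0 : 0 < psi 0.
  by have := lin_incr Lg (x := vL) (y := 0) vy y0 v0; rewrite (lin_fix Lg).
pose c := psi 0 / phi 0; have c0 : 0 < c by rewrite divr_gt0.
have [kf [fk kf_ kfd kfc]] := pw_inv bcf; have [kg [gk kg_ kgd kgc]] := pw_inv bcg.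
have fd := pw_decr bcf; have gd := pw_decr bcg.
have fE : f xR = xR by rewrite (pw_ge0 bcf)// ltW.
have gE : g yR = yR by rewrite (pw_ge0 bcg)// ltW.
have WF x : x < xR -> f (f x) < xR by move=> /fd/fd; rewrite !fE.
have WG y : y < yR -> g (g y) < yR by move=> /gd/gd; rewrite !gE.
have [hl [hE hi hs hF]] := lin_conj c0 WF WG Lf Lg.
pose hl' x := if x < xR then hl x else yR.
have hlE x : x < xR -> hl' x = hl x by rewrite /hl' => ->.
have hlR : hl' xR = yR by rewrite /hl' ltxx.
pose h x := if x <= xR then hl' x else kg (hl' (f x)).
have [hb hf] : incr_bij h /\ forall x, h (f x) = g (h x).
  apply: (extend_right fd fk kf_ kfd gk kg_ gd kgd fE gE hlR).
  - move=> x y; rewrite le_eqVlt => /orP[/eqP-> xy|yx xy].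
      by rewrite hlR hlE//; exact: (hE x xy).1.
    by rewrite !hlE ?(lt_trans xy)//; apply: hi => //=; exact: lt_trans yx.
  - move=> y; rewrite le_eqVlt => /orP[/eqP->|yy]; first by exists xR.
    by have [x xx <-] := hs y yy; exists x; rewrite ?hlE// ltW.
  - move=> x; rewrite le_eqVlt => /orP[/eqP->|xx]; first by rewrite !fE hlR !gE.
    by rewrite !hlE ?WF//; exact: (hF x xx).
have hle x : x < xR -> h x = hl x by move=> xx; rewrite /h ltW// hlE.
have hxR : h xR = yR by rewrite /h lexx hlR.
have h0 : h 0 = 0.
  rewrite hle//; apply: (lin_inj Lg) => //; first exact: (hE 0 x0).1.
  by rewrite (hE 0 x0).2 /c divfK// gt_eqF.
have hc := incr_bij_continuous hb; have hm := incr_bij_mono hb.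
have hE' x : x < xR -> h x < yR /\ psi (h x) = c * phi x.
  by move=> xx; rewrite hle//; exact: hE.
have [hu [r r0 Hr]] := lin_conj_sdiff c0 Lf Lg hE' (fun x _ => hc x).
have kR : kf xR = xR by rewrite -{1}fE fk.
exists h, c; split=> //; last first.
  move=> x xl; have hx0 : h x <= 0 by rewrite leNgt -{1}h0 hm -leNgt.
  rewrite -(koenigs_pw2_le0 _ _ bcg (ltW n0) hx0) -(koenigs_pw2_le0 _ _ bcf (ltW n0) xl).
  by apply: (hE' _ _).2; exact: le_lt_trans x0.
split=> // x /= xx.
have oS : open [set x | x != xR].
  have -> : [set x | x != xR] = [set x | x < xR] `|` [set x | xR < x].
    by apply/seteqP; split=> z /=; rewrite neq_lt => /orP.
  by apply: openU; [exact: open_lt|exact: open_gt].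
have Sf y : y != xR -> f y != xR.
  by apply: contra_neq => fy; rewrite -(fk y) fy kR.
have step := conj_sdiff_iter bcf bcg ratio hb h0 oS Sf (fun y _ => hf y).
have left z : z < xR -> incr_diff_at h z.
  move=> zx; have /cvgrPdist_lt/(_ _ r0)[N _ HN] := iter_pw2_attr bcf n0 Eu Ex zx.
  apply: (step z N.*2); first by rewrite /= lt_eqF.
  by apply: (Hr _ _).2; rewrite -iter_comp2 distrC; exact: HN (leqnn _).
move: xx; rewrite neq_lt => /orP[/left//|xx].
apply: (step x 1%N); first by rewrite /= gt_eqF.
by apply: left => /=; rewrite -fE; exact: fd.
Qed.

(** The translations outside (a, b) carry no dynamics; they make [h] a bijection of the line, as the
    regularity lemmas expect. *)
Lemma translation_glue (a b a' b' : R) (hl : R -> R) : a < b ->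
  (forall x, a < x < b -> a' < hl x < b') ->
  (forall x y, a < x < b -> a < y < b -> x < y -> hl x < hl y) ->
  (forall y, a' < y < b' -> exists2 x, a < x < b & hl x = y) ->
  incr_bij (fun x => if x <= a then x - a + a' else if x < b then hl x else x - b + b').
Proof.
move=> ab hlW hi hs.
have a'b' : a' < b'.
  have /hlW/andP[h1 h2] : a < (a + b) / 2 < b by lra.
  exact: lt_trans h2.
set h := fun x => _.
have hW x : a < x < b -> h x = hl x by move=> /andP[h1 h2]; rewrite /h leNgt h1 h2.
have hL x : x <= a -> h x = x - a + a' by rewrite /h => ->.
have hR x : b <= x -> h x = x - b + b'.
  by move=> bx; rewrite /h ltNge bx/= leNgt (lt_le_trans ab bx).
clearbody h; split=> [x y xy|y].
  have [ya|ya] := leP y a; first by rewrite !hL//; lra.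
  have [xb|xb] := leP b x; first by rewrite !hR//; lra.
  have [xa|xa] := leP x a; have [yb|yb] := ltP y b.
  - have yW : a < y < b by rewrite ya.
    by rewrite hL// hW//; have /andP[? ?] := hlW _ yW; lra.
  - by rewrite hL// hR//; lra.
  - by rewrite !hW ?xa ?ya//; apply: hi => //; rewrite ?xa ?ya.
  - have xW : a < x < b by rewrite xa.
    by rewrite hW// hR//; have /andP[? ?] := hlW _ xW; lra.
have [ya|ya] := leP y a'; first by exists (y - a' + a); rewrite hL; lra.
have [yb|yb] := leP b' y; first by exists (y - b' + b); rewrite hR; lra.
have [|x xW <-] := hs y; first by rewrite ya.
by exists x; rewrite hW.
Qed.

(** Here the linearised maps are the squares of the inverses at [xR]. The kink lies to the left of
    the fixed points, so both coordinates of 0 are negative and their quotient [c] is positive. *)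
Lemma conj_rep uL vL xR yR : 0 < nu -> B (A uL) = uL -> D (C vL) = vL ->
  B xR = xR -> D yR = yR -> B' xR = D' yR ->
  exists h, [/\ diff_conj f g [set x | uL < x < A uL] h,
    h uL = vL & h (A uL) = C vL].
Proof.
move=> n0 Eu Ev Ex Ey E.
have [[? ? ?] [? ? ? ?]] := bc_consts bcf.
have /andP[x0 xn] := B_fix_gt0 bcf n0 Ex; have /andP[y0 yn] := B_fix_gt0 bcg n0 Ey.
have [u0 nuR] := BA_fix_lt0 bcf n0 Eu; have [v0 nvR] := BA_fix_lt0 bcg n0 Ev.
have [kf [fk kf_ kfd kfc]] := pw_inv bcf; have [kg [gk kg_ kgd kgc]] := pw_inv bcg.
have fd := pw_decr bcf; have gd := pw_decr bcg.
have [Lf sf] := linearises_rep bcf fk kf_ kfd n0 Eu Ex.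
have [Lg sg] := linearises_rep bcg gk kg_ kgd n0 Ev Ey; rewrite -E in Lg sg.
set lam := (B' xR)^-1 * _ in Lf Lg.
set phi := koenigs (kf \o kf) _ _ in Lf; set psi := koenigs (kg \o kg) _ _ in Lg.
have W0 : uL < 0 < A uL by apply/andP; split; lra.
have W0' : vL < 0 < C vL by apply/andP; split; lra.
have phi0 : phi 0 < 0.
  by have := lin_incr Lf W0 (lin_fix_in Lf) x0; rewrite (lin_fix Lf).
have psi0 : psi 0 < 0.
  by have := lin_incr Lg W0' (lin_fix_in Lg) y0; rewrite (lin_fix Lg).
pose c := psi 0 / phi 0; have c0 : 0 < c by rewrite nmulr_rgt0 ?invr_lt0.
have fE : f xR = xR by rewrite (pw_ge0 bcf)// ltW.
have gE : g yR = yR by rewrite (pw_ge0 bcg)// ltW.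
have fL : f uL = A uL by rewrite (pw_le0 _ _ (ltW u0)).
have gL : g vL = C vL by rewrite (pw_le0 _ _ (ltW v0)).
have fR : f (A uL) = uL by rewrite (pw_ge0 bcf)//; lra.
have gR : g (C vL) = vL by rewrite (pw_ge0 bcg)//; lra.
have kxR : kf xR = xR by rewrite -{1}fE fk.
have kyR : kg yR = yR by rewrite -{1}gE gk.
have kfL : kf uL = A uL by rewrite -{1}fR fk.
have kgL : kg vL = C vL by rewrite -{1}gR gk.
have kfR : kf (A uL) = uL by rewrite -fL fk.
have kgR : kg (C vL) = vL by rewrite -gL gk.
have Wk x : uL < x < A uL -> uL < kf x < A uL.
  by move=> /andP[h1 h2]; rewrite -{1}kfR -{2}kfL !kfd.
have Wk' x : vL < x < C vL -> vL < kg x < C vL.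
  by move=> /andP[h1 h2]; rewrite -{1}kgR -{2}kgL !kgd.
have Wf x : uL < x < A uL -> uL < f x < A uL.
  by move=> /andP[h1 h2]; rewrite -{1}fR -{2}fL !fd.
have [hl [hE hi hs _]] := lin_conj c0 (fun x H => Wk _ (Wk x H)) (fun x H => Wk' _ (Wk' x H)) Lf Lg.
pose h x := if x <= uL then x - uL + vL else if x < A uL then hl x
  else x - A uL + C vL.
have hW x : uL < x < A uL -> h x = hl x.
  by move=> /andP[h1 h2]; rewrite /h leNgt h1 h2.
have hL x : x <= uL -> h x = x - uL + vL by rewrite /h => ->.
have hR x : A uL <= x -> h x = x - A uL + C vL.
  move=> xu; rewrite /h ltNge xu/= leNgt; have -> // : uL < x by lra.
have hE' x : uL < x < A uL -> vL < h x < C vL /\ psi (h x) = c * phi x.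
  by move=> xx; rewrite hW//; exact: hE.
have hb : incr_bij h.
  by apply: translation_glue => //; [lra|move=> x /hE[]].
have hc := incr_bij_continuous hb; have hm := incr_bij_mono hb.
have h0 : h 0 = 0.
  apply: (lin_inj Lg) => //; first exact: (hE' 0 W0).1.
  by rewrite (hE' 0 W0).2 /c divfK// lt_eqF.
have phik x : uL < x < A uL -> phi (kf x) = (B' xR)^-1 * phi x.
  move=> xW; apply: (cvg_unique (@Rhausdorff R)) (lin_cvg Lf (x := kf x) (Wk _ xW)) _.
  apply: (lin_seq_commute _ _ sf) => //.
    exact: (iter_inv_rep bcf fk kf_ kfd n0 Eu Ex xW).
  exact: (lin_cvg Lf).
have psik x : vL < x < C vL -> psi (kg x) = (B' xR)^-1 * psi x.
  move=> xW; apply: (cvg_unique (@Rhausdorff R)) (lin_cvg Lg (x := kg x) (Wk' _ xW)) _.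
  apply: (lin_seq_commute _ _ sg) => //.
    exact: (iter_inv_rep bcg gk kg_ kgd n0 Ev Ey xW).
  exact: (lin_cvg Lg).
have hk x : uL < x < A uL -> h (kf x) = kg (h x).
  move=> xW; have [W1 E1] := hE' _ xW; have [W2 E2] := hE' _ (Wk _ xW).
  apply: (lin_inj Lg) => //; first exact: Wk'.
  by rewrite E2 psik// E1 phik// mulrCA.
exists h; split; last 2 first.
- by rewrite hL//; lra.
- by rewrite hR//; lra.
split=> // x xW.
  by rewrite -{2}(fk x) hk ?kg_//; exact: Wf.
have [_ [r r0 Hr]] := lin_conj_sdiff c0 Lf Lg hE' (fun x _ => hc x).
have oS : open [set x | uL < x < A uL].
  have -> : [set x | uL < x < A uL] = [set x | uL < x] `&` [set x | x < A uL].
    by apply/seteqP; split=> z /= => [/andP[]|[-> ->]].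
  by apply: openI; [exact: open_gt|exact: open_lt].
have /cvgrPdist_lt/(_ _ r0)[N _ HN] := iter_inv_rep bcf fk kf_ kfd n0 Eu Ex xW.
apply: (conj_sdiff_iter_inv bcf bcg ratio (n := N.*2) hb h0 fk kf_ kfc gk kg_ kgc oS Wk hk xW).
by apply: (Hr _ _).2; rewrite -iter_comp2 distrC; exact: HN (leqnn _).
Qed.

End ConjugacyTheorems.

(** * Distance of the conjugacy from the identity *)

Section SizeEstimates.
Variable R : realType.
Implicit Types (x y : R) (h : R -> R).

(** Near-identity coordinates take values close to -u and -v at 0, and u is close to v, so their
    quotient is close to 1. At [u = 0] the quotient is indeterminate, hence the separate
    hypothesis. *)
Lemma lin_scale_near1 (phi0 psi0 u v k c : R) : 0 <= k <= 8^-1 ->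
  `|phi0 + u| <= k * `|u| -> `|psi0 + v| <= k * `|v| -> `|u - v| <= k * `|u| ->
  psi0 = c * phi0 -> (u = 0 -> c = 1) -> `|c - 1| <= 4 * k.
Proof.
move=> /andP[k0 k1] h1 h2 h3 E c1.
have [u0|u0] := eqVneq u 0; first by rewrite c1// subrr normr0 mulr_ge0.
have un : 0 < `|u| by rewrite normr_gt0.
have vu : `|v| <= `|u| + k * `|u|.
  by rewrite -[v](subrK u) addrC (le_trans (ler_normD _ _))// lerD2l distrC.
have p0 : (1 - k) * `|u| <= `|phi0|.
  have : `|u| <= `|phi0 + u| + `|phi0|.
    by rewrite -{1}[u](addKr phi0) addrC (le_trans (ler_normB _ _)).
  lra.
(* Here 25/8 = 1 + 9/8 + 1, from the two coordinates and [u - v]; dividing by 1 - k >= 7/8 then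
   leaves less than 4 k. *)
have d0 : `|psi0 - phi0| <= 25 / 8 * k * `|u|.
  have -> : psi0 - phi0 = (psi0 + v) - (phi0 + u) + (u - v) by ring.
  rewrite (le_trans (ler_normD _ _))// (le_trans (lerD (ler_normB _ _) h3))//.
  have : k * `|v| <= k * (9 / 8 * `|u|) by rewrite ler_wpM2l//; nra.
  nra.
have Ec : (c - 1) * phi0 = psi0 - phi0 by rewrite E; ring.
rewrite -Ec normrM in d0.
have : `|c - 1| * ((1 - k) * `|u|) <= 25 / 8 * k * `|u|.
  by rewrite (le_trans _ d0)// ler_wpM2l.
rewrite mulrA ler_pM2r// => H.
have := normr_ge0 (c - 1); nra.
Qed.

(** [d] and [e] stand for the increments of the two coordinates from 0 to x and from 0 to z. The
    part of the error that involves [|z - x|] is absorbed on the left, thanks to k <= 1/8. *)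
Lemma lin_conj_near_id (d e x z k c : R) : 0 <= k <= 8^-1 ->
  `|d - x| <= k * `|x| -> `|e - z| <= k * `|z| -> e = c * d ->
  `|c - 1| <= 4 * k -> `|z - x| <= 8 * k * `|x|.
Proof.
move=> /andP[k0 k1] h1 h2 E c1.
have x0 := normr_ge0 x; have zx0 := normr_ge0 (z - x).
have zn : `|z| <= `|z - x| + `|x| by rewrite -{1}[z](subrK x) ler_normD.
have dn : `|d| <= 9 / 8 * `|x|.
  have : `|d| <= `|d - x| + `|x| by rewrite -{1}[d](subrK x) ler_normD.
  nra.
have kz : k * `|z| <= k * `|x| + 8^-1 * `|z - x| by nra.
have cd : `|c - 1| * `|d| <= 4 * k * (9 / 8 * `|x|) by apply: ler_pM.
have -> : z - x = (c - 1) * d + (d - x) - (e - z) by rewrite E; ring.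
have H : `|z - x| <= `|c - 1| * `|d| + `|d - x| + `|e - z|.
  have -> : z - x = (c - 1) * d + (d - x) - (e - z) by rewrite E; ring.
  by rewrite (le_trans (ler_normB _ _))// lerD2r -normrM ler_normD.
have -> : (c - 1) * d + (d - x) - (e - z) = z - x by rewrite E; ring.
nra.
Qed.

Definition near_id_on (u r k : R) (phi : R -> R) := forall a b : R,
  `|a - u| <= r -> `|b - u| <= r -> `|phi a - phi b - (a - b)| <= k * `|a - b|.

Lemma koenigs_coords_near_id (phi psi : R -> R) (u v r s k c x z : R) :
  0 <= k <= 8^-1 -> near_id_on u r k phi -> near_id_on v s k psi ->
  phi u = 0 -> psi v = 0 -> `|0 - u| <= r -> `|x - u| <= r -> `|0 - v| <= s ->
  `|z - v| <= s -> psi z = c * phi x -> psi 0 = c * phi 0 -> (u = 0 -> c = 1) ->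
  `|u - v| <= k * `|u| -> `|c - 1| <= 4 * k /\ `|z - x| <= 8 * k * `|x|.
Proof.
move=> k08 nf ng phiu psiv r0 rx s0 sz E E0 c1 uv.
have ru : `|u - u| <= r by rewrite subrr normr0 (le_trans _ r0).
have sv : `|v - v| <= s by rewrite subrr normr0 (le_trans _ s0).
have f0 := nf 0 u r0 ru; have g0 := ng 0 v s0 sv.
rewrite phiu subr0 sub0r opprK normrN in f0; rewrite psiv subr0 sub0r opprK normrN in g0.
have c4 := lin_scale_near1 k08 f0 g0 uv E0 c1; split=> //.
have f1 := nf x 0 rx r0; have g1 := ng z 0 sz s0.
rewrite subr0 in f1; rewrite subr0 in g1.
have E1 : psi z - psi 0 = c * (phi x - phi 0) by rewrite E E0; ring.
exact: lin_conj_near_id k08 f1 g1 E1 c4.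
Qed.

(* The monotonicity of psi confines z to the ball on which psi is nearly the
   identity. *)
Lemma koenigs_coords_near_id_mono (phi psi : R -> R) (u v p k c x z : R) :
  0 < p -> 0 <= k <= 8^-1 -> near_id_on u (4 * p) k phi -> near_id_on v (4 * p) k psi ->
  {homo psi : a b / a < b} -> phi u = 0 -> psi v = 0 -> - p <= u <= 0 -> - p <= v <= 0 ->
  - p <= x <= 0 -> z <= 0 -> psi z = c * phi x -> psi 0 = c * phi 0 -> 0 < c ->
  (u = 0 -> c = 1) -> `|u - v| <= k * `|u| -> `|z - x| <= 8 * k * `|x|.
Proof.
move=> p0 k08 nf ng psii phiu psiv up vp xp z0 E E0 c0 c1 uv.
have b0u : `|0 - u| <= 4 * p by rewrite ler_norml; lra.
have bxu : `|x - u| <= 4 * p by rewrite ler_norml; lra.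
have buu : `|u - u| <= 4 * p by rewrite ler_norml; lra.
have b0v : `|0 - v| <= 4 * p by rewrite ler_norml; lra.
have bvv : `|v - v| <= 4 * p by rewrite ler_norml; lra.
have [c4 _] := koenigs_coords_near_id k08 nf ng phiu psiv b0u b0u b0v b0v E0 E0 c1 uv.
suff zv : v - 3 * p < z.
  have bzv : `|z - v| <= 4 * p by rewrite ler_norml; lra.
  by have [] := koenigs_coords_near_id k08 nf ng phiu psiv b0u bxu b0v bzv E E0 c1 uv.
rewrite ltNge; apply/negP => hh.
have bw : `|v - 3 * p - v| <= 4 * p by rewrite ler_norml; lra.
have w1 := ng _ _ bw bvv; have x1 := nf _ _ bxu buu.
have wE : v - 3 * p - v = - (3 * p) by ring.
rewrite psiv subr0 wE normrN (ger0_norm (_ : 0 <= 3 * p)) in w1; last lra.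
rewrite phiu subr0 in x1.
have hw : psi z <= psi (v - 3 * p).
  by move: hh; rewrite le_eqVlt => /orP[/eqP -> //|/psii/ltW].
rewrite E in hw.
have xun : `|x - u| <= p by rewrite ler_norml; lra.
clear -w1 x1 hw xun k08 c4 c0 p0 xp up.
have /andP[k0 k8] := k08.
have h1 : k * `|x - u| <= 8^-1 * p by apply: ler_pM.
have h2 : k * (3 * p) <= 8^-1 * (3 * p) by rewrite ler_wpM2r//; lra.
have phix : - (9 / 8 * p) <= phi x by move: x1; rewrite ler_norml; lra.
have c2 : c <= 3 / 2 by move: c4; rewrite ler_norml; lra.
have cphi : c * - (9 / 8 * p) <= c * phi x by rewrite ler_wpM2l// ltW.
have cp : c * (9 / 8 * p) <= 3 / 2 * (9 / 8 * p) by rewrite ler_wpM2r//; lra.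
move: w1; rewrite ler_norml; lra.
Qed.

(** Both branches have value [nu] at 0, so they differ by the slope defect and two Taylor
    remainders. *)
Lemma C11_dist K e (A A' C C' : R -> R) nu z : C11 K A A' -> C11 K C C' -> A 0 = nu ->
  C 0 = nu -> `|C' 0 - A' 0| <= e -> `|C z - A z| <= e * `|z| + 2 * K * z ^+ 2.
Proof.
move=> HA HC A0 C0 H; have := HA.1 0 z; have := HC.1 0 z; rewrite A0 C0 subr0.
move=> h1 h2.
have -> : C z - A z = (C z - nu - C' 0 * z) - (A z - nu - A' 0 * z) + (C' 0 - A' 0) * z.
  by ring.
rewrite (le_trans (ler_normD _ _))// addrC normrM lerD ?ler_wpM2r//.
rewrite (le_trans (ler_normB _ _))//; lra.
Qed.

Variables (al al' ga ga' K : R).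
Hypotheses (bnd : slope_bounds al al' ga ga') (K0 : 0 <= K) (al'0 : 0 < al') (ga'0 : 0 < ga').
Local Notation th := (al' * ga').

(** The slopes at the kink agree up to O(nu); hence at distance O(nu) from 0 the two maps differ by
    O(nu^2), one order below the scale of the dynamics. *)
Definition compatible nu (A A' B B' C C' D D' : R -> R) :=
  [/\ bcmap al al' ga ga' K nu A A' B B', bcmap al al' ga ga' K nu C C' D D',
      `|C' 0 - A' 0| <= K * `|nu| & `|D' 0 - B' 0| <= K * `|nu|].

(** As [D] expands, [h p - p] is at most the distance from [D (h p) = h (B p)] to [D p]: an estimate
    on the left half line is carried to the right. *)
Lemma est_right nu A A' B B' C C' D D' h p Q :
  compatible nu A A' B B' C C' D D' -> incr_bij h -> h 0 = 0 -> 0 < p ->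
  h (pw A B p) = pw C D (h p) -> `|h (B p) - B p| <= Q ->
  `|h p - p| <= Q + K * `|nu| * p + 2 * K * p ^+ 2.
Proof.
move=> [bcf bcg hC hD] hb h0 p0 E hQ; have hm := incr_bij_mono hb.
have [[? ? ?] [ga1 ? ? ?]] := bc_consts bcf.
have hp0 : 0 < h p by rewrite -h0 hm.
rewrite (pw_ge0 bcf (ltW p0)) (pw_ge0 bcg (ltW hp0)) in E; rewrite E in hQ.
have := C11_dist p (bcB bcf) (bcB bcg) (bcB0 bcf) (bcB0 bcg) hD.
rewrite (gtr0_norm p0) => h1.
have h2 : `|D (h p) - D p| <= Q + K * `|nu| * p + 2 * K * p ^+ 2.
  have -> : D (h p) - D p = (D (h p) - B p) - (D p - B p) by ring.
  by rewrite (le_trans (ler_normB _ _))// -addrA lerD.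
apply: le_trans h2; have [hh|/ltW hh] := leP (h p) p.
  have := B_slope bcg hh => ?.
  rewrite ler0_norm ?subr_le0// ger0_norm; nra.
have := B_slope bcg hh => ?.
rewrite ger0_norm ?subr_ge0// ler0_norm; nra.
Qed.

Lemma koenigs_const_le K1 K2 lam lam' : 0 < lam' -> lam' <= lam -> 0 <= K1 -> K1 <= K2 -> th < 1 ->
  koenigs_const K1 th lam <= koenigs_const K2 th lam'.
Proof.
move=> l0 ll K10 KK t1; rewrite /koenigs_const; have t0 : 0 < 1 - th by lra.
have l1 : 0 < lam by lra.
apply: ler_pM; rewrite ?invr_ge0 ?mulr_ge0//; try lra.
by rewrite lef_pV2 ?posrE ?mulr_gt0// ler_pM2r.
Qed.

(** For [nu > 0], u is comparable to [nu]. The lower bound later converts an error O(nu^2) into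
    O(nu) times [|u|]. *)
Lemma BA_fix_bounds nu (A A' B B' : R -> R) u : bcmap al al' ga ga' K nu A A' B B' ->
  0 <= nu -> B (A u) = u ->
  [/\ u <= 0, `|u| * (1 - th) <= (1 + ga') * nu & (ga - 1) * nu <= `|u|].
Proof.
move=> bc n0 E; have [[? ? ?] [? ? ? ?]] := bc_consts bc.
have h1 : `|u| * (1 - th) <= (1 + ga') * nu.
  have := BA_lip bc u 0; rewrite E (bcA0 bc) subr0.
  have := B_lip bc nu 0; rewrite (bcB0 bc) subr0 (ger0_norm n0) => hB hBA.
  have a1 : `|u| <= `|u - B nu| + `|B nu| by rewrite -{1}[u](subrK (B nu)) ler_normD.
  have a2 : `|B nu| <= `|B nu - nu| + nu.
    by rewrite -{1}[B nu](subrK nu) (le_trans (ler_normD _ _))// (ger0_norm n0).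
  by lra.
have u0 : u <= 0.
  have [nE|nE] := eqVneq nu 0; last by rewrite ltW// (BA_fix_lt0 bc _ E).1// lt_neqAle eq_sym nE.
  by move: h1; rewrite nE mulr0 pmulr_lle0 ?subr_gt0// normr_le0 => /eqP ->.
split=> //.
have hA := A_slope bc u0; rewrite (bcA0 bc) in hA.
have nA : nu <= A u by nra.
have h2 := B_slope bc n0; rewrite (bcB0 bc) in h2.
have h3 := B_slope bc nA; rewrite E in h3.
rewrite ler0_norm//; nra.
Qed.

Lemma sqr_dist_bound (e Q w n : R) : 0 <= n -> 0 <= K -> e = K * n -> 0 <= Q ->
  `|w| <= Q * n -> e * `|w| + 2 * K * w ^+ 2 <= (K * Q + 2 * K * Q ^+ 2) * n ^+ 2.
Proof.
move=> n0 k0 -> Q0 H; rewrite -(real_normK (num_real w)).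
have a1 : K * n * `|w| <= K * n * (Q * n) by rewrite ler_wpM2l// mulr_ge0.
have a2 : `|w| ^+ 2 <= (Q * n) ^+ 2 by rewrite ler_sqr ?nnegrE// mulr_ge0.
have a3 : 2 * K * `|w| ^+ 2 <= 2 * K * (Q * n) ^+ 2 by rewrite ler_wpM2l// mulr_ge0.
by rewrite exprMn in a3; lra.
Qed.

(** Two contractions that differ by O(nu^2) at a fixed point have fixed points at distance O(nu^2) /
    (1 - th); one factor [nu] is then traded for [|u| / (ga - 1)]. *)
Lemma BA_fix_dist : exists Q : R, 0 <= Q /\ forall (nu : R) (A A' B B' C C' D D' : R -> R) u v,
  compatible nu A A' B B' C C' D D' -> 0 <= nu -> B (A u) = u -> D (C v) = v ->
  [/\ `|u| <= Q * nu, `|v| <= Q * nu & `|u - v| <= Q * nu * `|u|].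
Proof.
have K_ge0 := K0; have al'_gt0 := al'0; have ga'_gt0 := ga'0.
have [al0 ga1 th1 _] := bnd.
have t1 : 0 < 1 - th by rewrite subr_gt0.
pose Cu := (1 + ga') / (1 - th).
have Cu0 : 0 <= Cu by rewrite divr_ge0 ?(ltW t1)// addr_ge0// ltW.
(* [P * nu ^+ 2] bounds the difference of [D \o C] and [B \o A] at v: the defect of the left branch
   at v, amplified by [ga'], plus the defect of the right branch at [C v]. *)
pose P := ga' * (K * Cu + 2 * K * Cu ^+ 2) + (K * (1 + Cu) + 2 * K * (1 + Cu) ^+ 2).
have P0 : 0 <= P.
  have q w : 0 <= w -> 0 <= K * w + 2 * K * w ^+ 2.
    by move=> w0; rewrite addr_ge0// !mulr_ge0// exprn_ge0.
  by rewrite addr_ge0 ?mulr_ge0 ?(ltW ga'_gt0) ?q// addr_ge0.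
pose Cd := P / ((1 - th) * (ga - 1)).
have Cd0 : 0 <= Cd by rewrite divr_ge0// mulr_ge0 ?(ltW t1)// subr_ge0 ltW.
have CdE : Cd * (1 - th) * (ga - 1) = P.
  by rewrite -mulrA divfK// mulf_neq0// gt_eqF// subr_gt0.
exists (Cu + Cd); split; first exact: addr_ge0.
move=> nu A A' B B' C C' D D' u v [bcf bcg hC hD] n0 Eu Ev.
rewrite (ger0_norm n0) in hC hD.
have [u0 uC un] := BA_fix_bounds bcf n0 Eu; have [v0 vC vn] := BA_fix_bounds bcg n0 Ev.
have {}uC : `|u| <= Cu * nu by rewrite /Cu mulrAC ler_pdivlMr.
have {}vC : `|v| <= Cu * nu by rewrite /Cu mulrAC ler_pdivlMr.
have Cdn : 0 <= Cd * nu by rewrite mulr_ge0.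
split; [by rewrite mulrDl (le_trans uC)// lerDl|by rewrite mulrDl (le_trans vC)// lerDl|].
have hCv : `|C v| <= (1 + Cu) * nu.
  have hh := A_lip bcg v 0; rewrite (bcA0 bcg) subr0 in hh.
  have [[_ _ a1] _] := bc_consts bcf.
  have h2 : al' * `|v| <= 1 * (Cu * nu) by apply: ler_pM => //; exact: ltW.
  have h3 : `|C v| <= `|C v - nu| + nu.
    by rewrite -{1}[C v](subrK nu) (le_trans (ler_normD _ _))// (ger0_norm n0).
  clear -hh h2 h3; lra.
have d1 : `|C v - A v| <= (K * Cu + 2 * K * Cu ^+ 2) * nu ^+ 2.
  apply: le_trans (C11_dist v (bcA bcf) (bcA bcg) (bcA0 bcf) (bcA0 bcg) hC) _.
  exact: sqr_dist_bound.
have d2 : `|D (C v) - B (C v)| <= (K * (1 + Cu) + 2 * K * (1 + Cu) ^+ 2) * nu ^+ 2.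
  apply: le_trans (C11_dist (C v) (bcB bcf) (bcB bcg) (bcB0 bcf) (bcB0 bcg) hD) _.
  by apply: sqr_dist_bound => //; rewrite addr_ge0.
have d3 : `|B (C v) - B (A v)| <= ga' * `|C v - A v| := B_lip bcf _ _.
have d4 := BA_lip bcf u v.
have d5 : `|u - v| <= th * `|u - v| + ga' * `|C v - A v| + `|D (C v) - B (C v)|.
  have {1}-> : u - v = (B (A u) - B (A v)) - (B (C v) - B (A v)) - (D (C v) - B (C v)).
    by rewrite Eu Ev; ring.
  by rewrite (le_trans (ler_normB _ _))// lerD// (le_trans (ler_normB _ _))// lerD.
have d6 : (1 - th) * `|u - v| <= P * nu ^+ 2.
  have := ler_wpM2l (ltW ga'_gt0) d1; rewrite /P; clear -d2 d5; lra.
have d7 : P * nu ^+ 2 <= (1 - th) * (Cd * nu * `|u|).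
  have -> : P * nu ^+ 2 = (1 - th) * Cd * nu * ((ga - 1) * nu) by rewrite -CdE; ring.
  have -> : (1 - th) * (Cd * nu * `|u|) = (1 - th) * Cd * nu * `|u| by ring.
  have q0 : 0 <= (1 - th) * Cd * nu by rewrite mulr_ge0// mulr_ge0// ltW.
  by rewrite ler_wpM2l.
have d8 : `|u - v| <= Cd * nu * `|u|.
  by rewrite -(ler_pM2l t1) (le_trans d6).
rewrite (le_trans d8)// ler_wpM2r// ler_wpM2r// lerDr//.
Qed.

Lemma near_idW (u r k k' : R) phi : k <= k' -> near_id_on u r k phi -> near_id_on u r k' phi.
Proof. by move=> kk H a b ha hb; rewrite (le_trans (H a b ha hb))// ler_wpM2r. Qed.

(** On x <= 0 both coordinates belong to smooth maps and deviate from the identity by O(p) on balls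
    of radius 4 p. The condition [M * nu <= p] puts u and v within p of 0, so that p is the only
    scale left. *)
Lemma est_pos : exists M : R, 0 < M /\ forall (nu : R) (A A' B B' C C' D D' : R -> R) (uL vL : R) h (c : R),
  compatible nu A A' B B' C C' D D' -> 0 <= nu ->
  B (A uL) = uL -> D (C vL) = vL -> incr_bij h -> h 0 = 0 -> 0 < c ->
  (nu = 0 -> c = 1) -> B' (A uL) * A' uL = D' (C vL) * C' vL ->
  (forall x, x <= 0 -> koenigs (D \o C) vL (B' (A uL) * A' uL) (h x) =
      c * koenigs (B \o A) uL (B' (A uL) * A' uL) x) ->
  forall p x : R, 0 < p -> M * p <= 1 -> M * nu <= p -> - p <= x <= 0 ->
  `|h x - x| <= M * p * `|x|.
Proof.
have [Q [Q0 HQ]] := BA_fix_dist.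
have K_ge0 := K0; have al'_gt0 := al'0; have ga'_gt0 := ga'0.
have [al0 ga1 th1 _] := bnd.
have ga0 : 0 < ga := lt_trans ltr01 ga1.
pose Kba := K * al' ^+ 2 + ga' * K.
have Kba0 : 0 <= Kba by rewrite /Kba addr_ge0// mulr_ge0 ?sqr_ge0// ltW.
pose Cp := koenigs_const Kba th (al * ga).
have Cp0 : 0 <= Cp by rewrite divr_ge0 ?mulr_ge0 ?subr_ge0// ltW.
pose M1 := 4 * Cp + Q.
have M1E : M1 = 4 * Cp + Q by [].
have M10 : 0 <= M1 by rewrite addr_ge0// mulr_ge0.
clearbody M1.
have M_gt0 : 0 < 8 * M1 + 1 + Q by lra.
exists (8 * M1 + 1 + Q); split=> //.
move=> nu A A' B B' C C' D D' uL vL h c cmp n0 Eu Ev hb h0 c0 c1 E hE p x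
  p0 Mp Mn xp.
have [uC vC uv] := HQ _ _ _ _ _ _ _ _ _ _ _ cmp n0 Eu Ev.
have [bcf bcg _ _] := cmp.
have hm := incr_bij_mono hb.
have [u0 _ un] := BA_fix_bounds bcf n0 Eu; have [v0 _ _] := BA_fix_bounds bcg n0 Ev.
have Qp : 0 <= Q * p by rewrite mulr_ge0// ltW.
have Qn : 0 <= Q * nu by rewrite mulr_ge0.
have M1n : 0 <= M1 * nu by rewrite mulr_ge0.
have M1p : 0 <= M1 * p by rewrite mulr_ge0// ltW.
have nup : nu <= p by clear -bnd K0 al'0 ga'0 Mn Qn M1n; lra.
have Qnp : Q * nu <= p by clear -bnd K0 al'0 ga'0 Mn n0 M1n; lra.
pose k := M1 * p.
have k08 : 0 <= k <= 8^-1 by apply/andP; split; rewrite /k//; clear -bnd K0 al'0 ga'0 Mp Qp p0; lra.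
have up : - p <= uL <= 0 by move: uC; rewrite ler0_norm//; clear -bnd K0 al'0 ga'0 u0 Qnp; lra.
have vp : - p <= vL <= 0 by move: vC; rewrite ler0_norm//; clear -bnd K0 al'0 ga'0 v0 Qnp; lra.
have uvk : `|uL - vL| <= k * `|uL|.
  rewrite (le_trans uv)// ler_wpM2r// /k; apply: ler_pM => //.
  by rewrite M1E lerDr mulr_ge0.
set lam := B' (A uL) * A' uL in E hE.
have lam_ge : al * ga <= lam by have /andP[] := BA_deriv bcf uL.
have lam0 : 0 < lam by rewrite (lt_le_trans _ lam_ge)// mulr_gt0.
have r1 : koenigs_const Kba th lam * (4 * p) <= k.
  have hk : koenigs_const Kba th lam <= Cp by apply: koenigs_const_le => //; rewrite mulr_gt0.
  have := ler_wpM2r (ltW p0) hk; rewrite /k M1E mulrDl; clear -bnd K0 al'0 ga'0 Qp; lra.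
have r2 : koenigs_const Kba th lam * (4 * p) <= 1 / 2.
  by apply: (le_trans r1); have /andP[_ k8] := k08; apply: (le_trans k8); lra.
have nf := near_idW r1 (fun a b => koenigs_near_id (BA_C11 bcf) (normBA bcf) th1 Eu (erefl _) lam0 r2).
have ng := near_idW r1 (fun a b => koenigs_near_id (BA_C11 bcg) (normBA bcg) th1 Ev (esym E) lam0 r2).
have Lg := linearises_BA bcg Ev; rewrite -E in Lg.
have /andP[xl x0] := xp.
apply: (@le_trans _ _ (8 * k * `|x|)); last first.
  by rewrite ler_wpM2r// /k; clear -bnd K0 al'0 ga'0 Qp p0 M1p; lra.
apply: (koenigs_coords_near_id_mono p0 k08 nf ng) xp _ _ _ c0 _ uvk => //.
- by move=> a b; exact: (lin_incr Lg Logic.I Logic.I).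
- by exact: koenigs_fix.
- by exact: koenigs_fix.
- by rewrite leNgt -h0 hm -leNgt.
- exact: hE.
- by rewrite -hE// h0.
- move=> u00; apply: c1; move: un; rewrite u00 normr0 => un.
  by apply/eqP; rewrite eq_le n0 andbT -(@pmulr_rle0 _ (ga - 1))// subr_gt0.
Qed.

Lemma A_expand nu (A A' B B' : R -> R) x y : bcmap al al' ga ga' K nu A A' B B' ->
  al * `|x - y| <= `|A x - A y|.
Proof.
move=> bc; have [[? _ _] _] := bc_consts bc.
have [xy|/ltW xy] := leP x y.
  have /andP[h _] := A_slope bc xy; rewrite distrC (ger0_norm (_ : 0 <= y - x)) ?subr_ge0//.
  by rewrite (le_trans h)// ler_norm.
have /andP[h _] := A_slope bc xy; rewrite (ger0_norm (_ : 0 <= x - y)) ?subr_ge0//.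
by rewrite (le_trans h)// distrC ler_norm.
Qed.

Lemma B_expand nu (A A' B B' : R -> R) x y : bcmap al al' ga ga' K nu A A' B B' ->
  ga * `|x - y| <= `|B x - B y|.
Proof.
move=> bc; have [xy|/ltW xy] := leP x y.
  have /andP[h _] := B_slope bc xy; rewrite distrC (ger0_norm (_ : 0 <= y - x)) ?subr_ge0//.
  by rewrite (le_trans h)// ler_norm.
have /andP[h _] := B_slope bc xy; rewrite (ger0_norm (_ : 0 <= x - y)) ?subr_ge0//.
by rewrite (le_trans h)// distrC ler_norm.
Qed.

Lemma A_fix_dist nu (A A' B B' C : R -> R) x y : bcmap al al' ga ga' K nu A A' B B' ->
  A x = x -> C y = y -> `|x - y| <= `|C y - A y|.
Proof.
move=> bc Ex Ey; have [[? _ _] _] := bc_consts bc; rewrite Ey.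
have [xy|/ltW xy] := leP x y.
  have /andP[h _] := A_slope bc xy; rewrite Ex in h.
  have q : 0 <= al * (y - x) by rewrite mulr_ge0 ?subr_ge0// ltW.
  rewrite distrC (ger0_norm (_ : 0 <= y - x)) ?subr_ge0// (le_trans _ (ler_norm _))//; lra.
have /andP[h _] := A_slope bc xy; rewrite Ex in h.
have q : 0 <= al * (x - y) by rewrite mulr_ge0 ?subr_ge0// ltW.
rewrite (ger0_norm (_ : 0 <= x - y)) ?subr_ge0// distrC (le_trans _ (ler_norm _))//; lra.
Qed.

(* One step of the backward propagation of |h x - x| <= M x^2 along the orbits
   of f^2: the slope of f^2 lies between al ga and th, and th^2 < al ga. *)
Lemma est_neg_step nu (A A' B B' C C' D D' : R -> R) M x y b :
  compatible nu A A' B B' C C' D D' -> nu < 0 -> 0 <= M ->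
  M * th ^+ 2 + 3 * K + 3 * K * ga <= M * (al * ga) ->
  x <= nu -> 0 < A x -> b = C y ->
  `|D b - B (A x)| <= M * B (A x) ^+ 2 -> `|y - x| <= M * x ^+ 2.
Proof.
move=> [bcf bcg hC hD] n0 M0 HM xn Ax E H.
have [[al0 _ al1] [ga1 _ _ _]] := bc_consts bcf; have ga0 : 0 < ga := lt_trans ltr01 ga1.
have nx : 0 <= - x by rewrite oppr_ge0 ltW// (le_lt_trans xn).
have x0 : x <= 0 by rewrite -oppr_ge0.
have nE : `|nu| = - nu by rewrite ltr0_norm.
have sA := A_slope bcf x0; rewrite (bcA0 bcf) sub0r in sA.
have sB := B_slope bcf (ltW Ax); rewrite (bcB0 bcf) subr0 in sB.
set a := A x in Ax H sA sB *.
have aal : a <= al' * - x by lra.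
have ax : a <= - x by rewrite (le_trans aal)// ler_piMl// ltW.
have gan : 0 <= (ga' - 1) * - nu.
  by rewrite mulr_ge0//; have [_ [? ? _ _]] := bc_consts bcf; lra.
have gaa : ga' * a <= ga' * (nu + al' * - x) by rewrite ler_wpM2l ?(ltW ga'0)//; lra.
have x1 : `|B a| <= th * - x.
  have q : 0 <= ga * a by rewrite mulr_ge0 ?(ltW ga0) ?(ltW Ax).
  by rewrite ler0_norm; lra.
have x1s : B a ^+ 2 <= th ^+ 2 * x ^+ 2.
  rewrite -(real_normK (num_real (B a))) -(sqrrN x) -exprMn ler_sqr ?nnegrE//.
  exact: le_trans x1.
have cB := C11_dist a (bcB bcf) (bcB bcg) (bcB0 bcf) (bcB0 bcg) hD.
have cA := C11_dist x (bcA bcf) (bcA bcg) (bcA0 bcf) (bcA0 bcg) hC.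
rewrite nE (gtr0_norm Ax) in cB; rewrite nE (ler0_norm x0) in cA.
have Kn : 0 <= K * - nu by rewrite mulr_ge0// oppr_ge0 ltW.
have nx2 : K * - nu * - x <= K * x ^+ 2.
  by rewrite -mulrA ler_wpM2l// expr2 -(mulrNN x x) ler_wpM2r// lerN2.
have na : K * - nu * a + 2 * K * a ^+ 2 <= 3 * K * x ^+ 2.
  have q1 : K * - nu * a <= K * - nu * - x by rewrite ler_wpM2l.
  have q : a ^+ 2 <= (- x) ^+ 2 by rewrite ler_sqr ?nnegrE// ltW.
  rewrite sqrrN in q; have := ler_wpM2l (mulr_ge0 (ler0n R 2) K0) q; lra.
have MM : M * B a ^+ 2 <= M * th ^+ 2 * x ^+ 2 by rewrite -mulrA ler_wpM2l.
have e1 : ga * `|b - a| <= M * th ^+ 2 * x ^+ 2 + 3 * K * x ^+ 2.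
  apply: le_trans (B_expand _ _ bcg) _.
  have -> : D b - D a = (D b - B a) - (D a - B a) by ring.
  by rewrite (le_trans (ler_normB _ _))// lerD// ?(le_trans H)// (le_trans cB).
have e2 : al * `|y - x| <= `|b - a| + 3 * K * x ^+ 2.
  apply: le_trans (A_expand _ _ bcg) _.
  have -> : C y - C x = (b - a) - (C x - A x) by rewrite E /a; ring.
  rewrite (le_trans (ler_normB _ _))// lerD2l (le_trans cA)//; lra.
have alga : 0 < al * ga by rewrite mulr_gt0.
rewrite -(ler_pM2l alga).
have e3 := ler_wpM2l (ltW ga0) e2.
have e4 := ler_wpM2r (sqr_ge0 x) HM.
lra.
Qed.

(** The branches differ by at most 3 K nu^2 at [yL], and |nu| <= 2 |xL|; this is where 6 comes
    from. *)
Lemma A_fix_rel_dist nu (A A' B B' C C' D D' : R -> R) xL yL k :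
  compatible nu A A' B B' C C' D D' -> A xL = xL -> C yL = yL ->
  6 * K * `|nu| <= k -> `|xL - yL| <= k * `|xL|.
Proof.
move=> [bcf bcg hC _] Ex Ey kE; have K_ge0 := K0.
have /andP[a1 _] := A_fix_norm bcg Ey; have /andP[_ a2] := A_fix_norm bcf Ex.
have a3 := C11_dist yL (bcA bcf) (bcA bcg) (bcA0 bcf) (bcA0 bcg) hC.
have a4 := A_fix_dist bcf Ex Ey.
rewrite -(real_normK (num_real yL)) in a3.
have a5 : K * `|nu| * `|yL| <= K * `|nu| * `|nu| by rewrite ler_wpM2l// mulr_ge0.
have a6 : `|yL| ^+ 2 <= `|nu| ^+ 2 by rewrite ler_sqr ?nnegrE.
have a7 : 2 * K * `|yL| ^+ 2 <= 2 * K * `|nu| ^+ 2 by rewrite ler_wpM2l// mulr_ge0.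
have a8 : 3 * K * `|nu| * `|nu| <= 3 * K * `|nu| * (2 * `|xL|).
  by rewrite ler_wpM2l// !mulr_ge0.
have a9 : 6 * K * `|nu| * `|xL| <= k * `|xL| by rewrite ler_wpM2r.
lra.
Qed.

Lemma A_nonpos_bound nu (A A' B B' : R -> R) w : bcmap al al' ga ga' K nu A A' B B' ->
  w <= 0 -> A w <= 0 -> nu <= w * al.
Proof.
move=> bc w0 Aw; have /andP[h _] := A_slope bc w0; rewrite (bcA0 bc) in h; lra.
Qed.

Lemma dist_le_neg (r x u : R) : - r <= x -> x <= 0 -> - r <= u -> u <= 0 -> `|x - u| <= r.
Proof. by move=> *; rewrite ler_norml; lra. Qed.

(** For [nu < 0] the smooth model [A \o A] is valid only within O(nu) of 0, so the coordinates give
    the bound there alone. Points farther out are reached backwards along f^2, with the same [M] at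
    every step. *)
Lemma est_neg : exists M : R, 0 < M /\ forall (nu : R) (A A' B B' C C' D D' : R -> R) (xL yL : R) h (c : R),
  compatible nu A A' B B' C C' D D' -> nu < 0 -> M * `|nu| <= 1 ->
  A xL = xL -> C yL = yL -> A' xL = C' yL ->
  diff_conj (pw A B) (pw C D) setT h -> 0 < c ->
  (forall x, koenigs (pw C D \o pw C D) yL (A' xL * A' xL) (h x) =
    c * koenigs (pw A B \o pw A B) xL (A' xL * A' xL) x) ->
  forall x, x <= nu -> `|h x - x| <= M * x ^+ 2.
Proof.
move: K0 al'0 ga'0 => K_ge0 al'_gt0 ga'_gt0.
pose Kaa := K * al' ^+ 2 + al' * K.
have Kaa0 : 0 <= Kaa by rewrite /Kaa addr_ge0// mulr_ge0 ?sqr_ge0// ltW.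
have [al0 ga1 th1' th2'] := bnd; have th1 : th < 1 := th1'; have th2 : th ^+ 2 < al * ga := th2'.
have ga0 : 0 < ga by lra.
have th0 : 0 < th by rewrite mulr_gt0.
pose Cn := koenigs_const Kaa th (al * al).
have Cn0 : 0 <= Cn by rewrite divr_ge0 ?mulr_ge0 ?subr_ge0// ltW.
(* The region x <= 0, A x <= 0 lies within |nu| / al of 0: this gives [Cn / al] from the
   coordinates, and [6 * K] comes from the distance of the fixed points. *)
pose M1 := Cn / al + 6 * K.
have M10 : 0 <= M1 by apply: addr_ge0; [exact: divr_ge0 Cn0 (ltW al0)|rewrite mulr_ge0].
have M1E : M1 = Cn / al + 6 * K by [].
clearbody M1.
have alga : 0 < al * ga by rewrite mulr_gt0.
have d0 : 0 < 1 - th ^+ 2 / (al * ga) by rewrite subr_gt0 ltr_pdivrMr// mul1r.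
(* The least constant preserved by one backward step: it makes [M2 * th ^+ 2 + 3 * K + 3 * K * ga]
   equal to [M2 * (al * ga)]. Positivity of the denominator is the condition th^2 < al ga. *)
pose M2 := (3 * K / (al * ga) + 3 * K / al) / (1 - th ^+ 2 / (al * ga)).
have M20 : 0 <= M2.
  have k3 : 0 <= 3 * K by rewrite mulr_ge0.
  apply: divr_ge0 (ltW d0); apply: addr_ge0; first exact: divr_ge0 k3 (ltW alga).
  exact: divr_ge0 k3 (ltW al0).
have EM : M2 * (al * ga - th ^+ 2) = 3 * K + 3 * K * ga.
  rewrite /M2; field; rewrite !gt_eqF//; rewrite subr_gt0//.
clearbody M2.
pose M := 8 * M1 + M2 + 1.
have ME : M = 8 * M1 + M2 + 1 by [].
clearbody M.
have M0 : 0 <= M by lra.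
have e8 : 8^-1 <= 1 / 2 :> R by lra.
have M18 : 8 * M1 <= M by lra.
have HM : M * th ^+ 2 + 3 * K + 3 * K * ga <= M * (al * ga).
  have : M2 * (al * ga - th ^+ 2) <= M * (al * ga - th ^+ 2).
    by rewrite ler_wpM2r ?subr_ge0 ?(ltW th2)//; lra.
  by lra.
exists M; split; first by lra.
move=> nu A A' B B' C C' D D' xL yL h c cmp n0 Mnu Ex Ey E dc c0 hE.
have [bcf bcg hC hD] := cmp.
have hb := dc_bij dc; have h0 := dc0 dc; have hm := incr_bij_mono hb.
have hf x : h (pw A B x) = pw C D (h x) by exact: (dc_eq dc).
have [[_ al2 al1] _] := bc_consts bcf; have al_le1 : al <= 1 := le_trans al2 (ltW al1).
have nE : `|nu| = - nu by rewrite ltr0_norm.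
have A0 := bcA0 bcf; have C0 := bcA0 bcg.
have hle0 x : (h x <= 0) = (x <= 0) by rewrite !leNgt -{1}h0 hm.
(* Points whose whole f-orbit stays in x <= 0, where f^2 is [A \o A]. *)
have base x : x <= 0 -> A x <= 0 -> `|h x - x| <= 8 * (M1 * `|nu|) * `|x|.
  move=> x0 Ax0; set k := M1 * `|nu|.
  have k0 : 0 <= k by rewrite mulr_ge0.
  have k8 : k <= 8^-1.
    have : M1 * `|nu| * 8 <= 1.
      by apply: le_trans Mnu; rewrite mulrAC ler_wpM2r// mulrC.
    by rewrite -[8^-1]mul1r ler_pdivlMr.
  have k08 : 0 <= k <= 8^-1 by rewrite k0.
  have kE : k = M1 * `|nu| by [].
  clearbody k.
  have AA (A1 A1' B1 B1' : R -> R) (w : R) n : bcmap al al' ga ga' K nu A1 A1' B1 B1' -> w <= 0 -> A1 w <= 0 ->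
      iter n (pw A1 B1 \o pw A1 B1) w = iter n (A1 \o A1) w.
    move=> bc1 w0 Aw.
    suff [-> //] : iter n (pw A1 B1 \o pw A1 B1) w = iter n (A1 \o A1) w /\
      (iter n (A1 \o A1) w <= 0 /\ A1 (iter n (A1 \o A1) w) <= 0).
    have nx z : z <= 0 -> A1 z <= 0 -> A1 (A1 z) <= 0.
      move=> z0 Az0; have := A_slope bc1 z0; have := A_slope bc1 Az0.
      by rewrite (bcA0 bc1); nra.
    elim: n => [//|n [IH [h1 h2]]]; rewrite !iterS IH /= (pw_le0 _ _ h1) (pw_le0 _ _ h2).
    by split=> //; split; [exact: nx _ h1 h2|exact: nx _ h2 (nx _ h1 h2)].
  have fx : pw A B x = A x by rewrite pw_le0.
  have hx0 : h x <= 0 by rewrite hle0.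
  have Chx : C (h x) <= 0.
    by rewrite -(pw_le0 C D hx0) -hf fx hle0.
  have xL0 := A_fix_lt0 bcf n0 Ex; have yL0 := A_fix_lt0 bcg n0 Ey.
  have lamg : al * al <= A' xL * A' xL.
    have /andP[l1 _] := bcA' bcf xL; rewrite -[X in _ <= X]mulrNN.
    by apply: ler_pM => //; exact: ltW.
  have lam0 : 0 < A' xL * A' xL by rewrite (lt_le_trans _ lamg)// mulr_gt0.
  set lam := A' xL * A' xL in hE lamg lam0.
  pose r := `|nu| / al.
  have rnu : `|nu| <= r by rewrite ler_pdivlMr// ler_piMr.
  have r1 : koenigs_const Kaa th lam * r <= k.
    have : koenigs_const Kaa th lam <= Cn by apply: koenigs_const_le => //; rewrite mulr_gt0.
    have r0 : 0 <= r by rewrite divr_ge0// ltW.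
    move=> /(ler_wpM2r r0) /le_trans; apply.
    rewrite kE M1E mulrDl /r; have -> : Cn * (`|nu| / al) = Cn / al * `|nu| by ring.
    by rewrite lerDl !mulr_ge0.
  have r2 : koenigs_const Kaa th lam * r <= 1 / 2 := le_trans r1 (le_trans k8 e8).
  have inr (A1 A1' B1 B1' : R -> R) (w : R) : bcmap al al' ga ga' K nu A1 A1' B1 B1' -> w <= 0 -> A1 w <= 0 ->
      - r <= w.
    move=> bc1 w0 Aw; rewrite /r nE -mulNr opprK ler_pdivrMr//.
    exact: A_nonpos_bound bc1 w0 Aw.
  have E1 : (fun x => A' (A x) * A' x) xL = lam by rewrite /= Ex.
  have E2 : (fun x => C' (C x) * C' x) yL = lam by rewrite /= Ey -E.
  have Exx : (A \o A) xL = xL by rewrite /= !Ex.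
  have Eyy : (C \o C) yL = yL by rewrite /= !Ey.
  have nf := koenigs_near_id (AA_C11 bcf) (normAA bcf) th1 Exx E1 lam0 r2.
  have ng := koenigs_near_id (AA_C11 bcg) (normAA bcg) th1 Eyy E2 lam0 r2.
  have hEw w : w <= 0 -> A w <= 0 -> h w <= 0 -> C (h w) <= 0 ->
      koenigs (C \o C) yL lam (h w) = c * koenigs (A \o A) xL lam w.
    move=> w0 Aw hw Chw; have := hE w.
    rewrite (koenigs_ext _ _ (fun n => AA _ _ _ _ _ n bcf w0 Aw)).
    by rewrite (koenigs_ext _ _ (fun n => AA _ _ _ _ _ n bcg hw Chw)).
  set phi := koenigs (A \o A) xL lam in hEw nf; set psi := koenigs (C \o C) yL lam in hEw ng.
  have phiu : phi xL = 0 by exact: koenigs_fix.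
  have psiv : psi yL = 0 by exact: koenigs_fix.
  have {}nf := near_idW r1 nf.
  have {}ng := near_idW r1 ng.
  have xLr : - r <= xL by apply: (inr _ _ _ _ _ bcf); rewrite ?Ex ltW.
  have yLr : - r <= yL by apply: (inr _ _ _ _ _ bcg); rewrite ?Ey ltW.
  have xr := inr _ _ _ _ _ bcf x0 Ax0; have hxr := inr _ _ _ _ _ bcg hx0 Chx.
  have r00 : - r <= 0 := le_trans xLr (ltW xL0).
  have b0u := dist_le_neg r00 (lexx 0) xLr (ltW xL0).
  have bxu := dist_le_neg xr x0 xLr (ltW xL0).
  have b0v := dist_le_neg r00 (lexx 0) yLr (ltW yL0).
  have bxv := dist_le_neg hxr hx0 yLr (ltW yL0).
  have hE0 : psi 0 = c * phi 0 by rewrite -[in LHS]h0 hEw ?h0 ?A0 ?C0// ltW.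
  have uv : `|xL - yL| <= k * `|xL|.
    apply: A_fix_rel_dist cmp Ex Ey _.
    by rewrite kE ler_wpM2r// M1E lerDr divr_ge0// ltW.
  have u1 : xL = 0 -> c = 1 by move=> e; rewrite e ltxx in xL0.
  have [] := koenigs_coords_near_id k08 nf ng phiu psiv b0u bxu b0v bxv _ hE0 u1 uv => //.
  exact: hEw.
have step x : x <= nu -> 0 < A x ->
    `|h (B (A x)) - B (A x)| <= M * B (A x) ^+ 2 -> `|h x - x| <= M * x ^+ 2.
  move=> xn Ax; have x0 : x <= 0 := le_trans xn (ltW n0).
  have hx0 : h x <= 0 by rewrite hle0.
  have ha : h (A x) = C (h x) by rewrite -(pw_le0 A B x0) hf (pw_le0 _ _ hx0).
  have ha0 : 0 < h (A x) by rewrite -h0 hm.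
  rewrite -(pw_ge0 bcf (ltW Ax)) hf (pw_ge0 bcg (ltW ha0)) (pw_ge0 bcf (ltW Ax)).
  exact: est_neg_step cmp n0 M0 HM xn Ax ha.
(* Here x <= nu matters: it gives |nu| <= |x|, which turns the bound |nu| |x| into x^2. *)
have bnu x : x <= nu -> A x <= 0 -> `|h x - x| <= M * x ^+ 2.
  move=> xn Ax; have x0 : x <= 0 := le_trans xn (ltW n0).
  rewrite (le_trans (base x x0 Ax))// nE (ler0_norm x0).
  have q1 : 8 * (M1 * - nu) * - x <= 8 * M1 * x ^+ 2.
    by rewrite mulrA -mulrA ler_wpM2l ?mulr_ge0// expr2 -(mulrNN x x) ler_wpM2r ?oppr_ge0 ?lerN2.
  by rewrite (le_trans q1)// ler_wpM2r ?sqr_ge0.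
move=> x xn.
have xL0 := A_fix_lt0 bcf n0 Ex.
have nx : 0 < - xL by rewrite oppr_gt0.
have /cvgrPdist_lt/(_ _ nx)[N _ HN] := iter_pw2_nonpos bcf x (ltW n0) Ex.
have {}HN : A (iter N (pw A B \o pw A B) x) <= 0.
  have := HN N (leqnn N); rewrite /= distrC => hh.
  have := A_lip bcf (iter N (pw A B \o pw A B) x) xL; rewrite Ex => h1.
  have : `|A (iter N (pw A B \o pw A B) x) - xL| <= - xL.
    by rewrite (le_trans h1)// (le_trans _ (ltW hh))// ler_piMl// ltW.
  by rewrite ler_norml => /andP[_]; rewrite lerBlDr addNr.
elim: N x xn HN => [|N IH] x xn HN; first exact: bnu.
have [Ax|Ax] := leP (A x) 0; first exact: bnu.
have x0 : x <= 0 := le_trans xn (ltW n0).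
apply: step => //; apply: IH.
  by have := B_slope bcf (ltW Ax); rewrite (bcB0 bcf); nra.
by move: HN; rewrite iterSr /= (pw_le0 _ _ x0) (pw_ge0 bcf (ltW Ax)).
Qed.

End SizeEstimates.

(** * Fixed point, two-cycle and their basins in a neighbourhood of 0 *)

Section InvariantSets.
Variable R : realType.
Variables (al al' ga ga' K nu : R) (A A' B B' : R -> R).
Hypothesis bc : bcmap al al' ga ga' K nu A A' B B'.
Implicit Types x y : R.
Local Notation f := (pw A B).
Local Notation th := (al' * ga').

(** f alone may expand by [ga'], but two steps contract by [th] up to O(nu): at least one uses the
    left branch, unless x and f x are both positive, and then f x <= nu is already small. *)
Lemma pw2_bound (P : R) x : (1 + ga') * `|nu| <= (1 - th) * P -> `|x| <= P -> 0 < nu ->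
  `|f (f x)| <= P.
Proof.
move=> HP xP n0; have [[? ? ?] [? ? ? ?]] := bc_consts bc.
have nn : `|nu| = nu by rewrite gtr0_norm.
have lip y : `|f y| <= ga' * `|y| + nu.
  have := pw_lip bc y 0; rewrite (pw0 bc) subr0 => h.
  by rewrite -{1}[f y](subrK nu) (le_trans (ler_normD _ _))// nn lerD2r.
have lipA y : `|A y| <= al' * `|y| + nu.
  have := A_lip bc y 0; rewrite (bcA0 bc) subr0 => h.
  by rewrite -{1}[A y](subrK nu) (le_trans (ler_normD _ _))// nn lerD2r.
rewrite nn in HP.
have thP : th * `|x| <= th * P by rewrite ler_wpM2l// ltW.
have ga'0 : 0 <= ga' by lra.
have al'0 : 0 <= al' by lra.
have aln : al' * nu <= ga' * nu by rewrite ler_wpM2r ?(ltW n0)//; lra.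
have [x0|x0] := leP x 0.
  rewrite (pw_le0 A B x0).
  have h1 := lip (A x); have h2 := ler_wpM2l ga'0 (lipA x); lra.
have [fx0|fx0] := leP (f x) 0.
  rewrite (pw_le0 A B fx0).
  have h1 := lipA (f x); have h2 := ler_wpM2l al'0 (lip x); lra.
have fn : f x <= nu.
  rewrite (pw_ge0 bc (ltW x0)); have := B_slope bc (ltW x0); rewrite (bcB0 bc) subr0.
  have : 0 <= ga * x by rewrite mulr_ge0 ?(ltW x0)//; lra.
  by move=> ? /andP[? _]; lra.
have h1 := lip (f x); rewrite (gtr0_norm fx0) in h1.
have h2 := ler_wpM2l ga'0 fn.
have : 0 <= th * P by rewrite (le_trans _ thP)// mulr_ge0// ltW.
lra.
Qed.

Lemma iter_pw_bound (P : R) x n : (1 + ga') * `|nu| <= (1 - th) * P -> `|x| <= P ->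
  0 < nu -> `|iter n f x| <= `|nu| + ga' * P.
Proof.
move=> HP xP n0; have [[? ? ?] [? ? ? ?]] := bc_consts bc.
have even m : `|iter m (f \o f) x| <= P by elim: m => //= m IH; exact: pw2_bound.
have P0 : 0 <= P := le_trans (normr_ge0 _) xP.
have P1 : P <= ga' * P by rewrite ler_peMl//; lra.
rewrite -(odd_double_half n); case: (odd n); rewrite ?add1n ?add0n -?iterS; last first.
  by rewrite -iter_comp2 (le_trans (even _))// (le_trans P1)// lerDr.
rewrite iterS -iter_comp2 -{1}[f _](subrK nu) (le_trans (ler_normD _ _))// addrC lerD2l.
have := pw_lip bc (iter n./2 (f \o f) x) 0; rewrite (pw0 bc) subr0 => /le_trans; apply.
by rewrite ler_wpM2l//; lra.
Qed.

Variables (uL xR P : R) (N D : set R) (F : R -> R).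
Hypotheses (n0 : 0 < nu) (Eu : B (A uL) = uL) (Ex : B xR = xR).
Hypotheses (HP : (1 + ga') * `|nu| <= (1 - th) * P)
  (NP : forall x, N x -> `|x| <= P)
  (FE : forall x, `|x| <= `|nu| + ga' * P -> F x = f x)
  (DE : forall x, `|x| <= `|nu| + ga' * P -> D x)
  (NE : forall x, uL <= x <= A uL -> N x).

Let P1 x : N x -> `|x| <= `|nu| + ga' * P.
Proof.
move=> /NP xP; have [[? ? ?] [? ? ? ?]] := bc_consts bc.
have P0 : 0 <= P := le_trans (normr_ge0 _) xP.
have P1 : P <= ga' * P by rewrite ler_peMl//; lra.
by rewrite (le_trans xP)// (le_trans P1)// lerDr.
Qed.

Let FN x : N x -> F x = f x. Proof. by move=> /P1/FE. Qed.

Let iterF x n : N x -> iter n F x = iter n f x.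
Proof.
move=> Nx; elim: n => //= n ->; apply: FE; apply: iter_pw_bound => //; exact: NP.
Qed.

Let order : [/\ uL < 0, 0 < xR, xR < nu & nu < A uL].
Proof.
by have [? ?] := BA_fix_lt0 bc n0 Eu; have /andP[? ?] := B_fix_gt0 bc n0 Ex.
Qed.

Let fxR : f xR = xR.
Proof. by have [_ h _ _] := order; rewrite (pw_ge0 bc) ?ltW. Qed.
Let fuL : f uL = A uL.
Proof. by have [h _ _ _] := order; rewrite (pw_le0 _ _ (ltW h)). Qed.
Let fuR : f (A uL) = uL.
Proof. by have [_ h1 h2 h3] := order; rewrite (pw_ge0 bc)//; lra. Qed.

Let NxR : N xR. Proof. by have [? ? ? ?] := order; apply: NE; lra. Qed.
Let NuL : N uL. Proof. by have [? ? ? ?] := order; apply: NE; lra. Qed.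
Let NuR : N (A uL). Proof. by have [? ? ? ?] := order; apply: NE; lra. Qed.

Lemma fixed_pointsE : fixed_points F N = [set xR].
Proof.
apply/seteqP; split=> x /=; last by move=> ->; split=> //; rewrite FN.
by move=> [Nx]; rewrite FN// => fx; exact: pw_fix_uniq bc _ _ fx fxR.
Qed.

Lemma period_two_pointsE : period_two_points F N = [set uL; A uL].
Proof.
have [h1 h2 h3 h4] := order; apply/seteqP; split=> x /=.
  move=> [Nx NFx Fx FFx]; rewrite (FN Nx) in NFx Fx FFx; rewrite (FN NFx) in FFx.
  exact: period_two_uniq bc _ _ n0 Eu FFx Fx.
by move=> [|] ->; split; rewrite ?FN ?fuL ?fuR ?FN ?fuL ?fuR//; apply/eqP;
  [rewrite gt_eqF//; lra|rewrite lt_eqF//; lra].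
Qed.

(** The endpoints form an invariant cycle and f is monotone, so the open interval between them is
    invariant forwards and backwards, and all its backward orbits tend to [xR]. *)
Lemma basin_repE :
  N `&` basin_of_repulsion F N xR = [set x | uL < x < A uL].
Proof.
have [h1 h2 h3 h4] := order; have [k [fk kf kd kc]] := pw_inv bc.
have fd := pw_decr bc.
have inv y : uL < f y < A uL -> uL < y < A uL.
  move=> /andP[a b]; apply/andP; split; rewrite ltNge; apply/negP.
    rewrite le_eqVlt => /orP[/eqP e|/fd]; first by move: b; rewrite e fuL ltxx.
    by rewrite fuL => h; move: b; rewrite ltNge ltW.
  rewrite le_eqVlt => /orP[/eqP e|/fd]; first by move: a; rewrite -e fuR ltxx.
  by rewrite fuR => h; move: a; rewrite ltNge ltW.
have inv' y : uL < y < A uL -> uL < f y < A uL.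
  by move=> /andP[a b]; rewrite -{1}fuR -{2}fuL !fd.
apply/seteqP; split=> x /=.
  move=> [Nx [w [w0 wN wF wc]]].
  pose e := Num.min (xR - uL) (A uL - xR).
  have e0 : 0 < e by rewrite lt_min; lra.
  have /cvgrPdist_lt/(_ e e0)[n _ /(_ n (leqnn n)) /=] := wc.
  rewrite lt_min !ltr_norml => /andP[/andP[a1 a2] /andP[a3 a4]].
  have wn : uL < w n < A uL by lra.
  (* From [w n], close to [xR], the orbit returns to [w 0] under forward iteration, which preserves
     the interval. *)
  rewrite -w0; elim: n wn {a1 a2 a3 a4} => // n IH wn; apply: IH.
  by rewrite -(wF n) FN//; exact: inv'.
move=> xu; have Nx : N x by apply: NE; case/andP: xu => ? ?; rewrite !ltW.
have Wn n : uL < iter n k x < A uL.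
  by elim: n => //= n IH; apply: inv; rewrite kf.
split=> //; exists (fun n => iter n k x); split=> //.
- by move=> n; apply: NE; case/andP: (Wn n) => ? ?; rewrite !ltW.
- move=> n; rewrite FN ?iterS ?kf//.
  by apply: NE; case/andP: (Wn n.+1) => ? ?; rewrite -iterS !ltW.
- have C := iter_inv_rep bc fk kf kd n0 Eu Ex xu.
  have kxR : k xR = xR by rewrite -{1}fxR fk.
  apply/cvgrPdist_lt => e e0.
  have /continuous_epsP/(_ e e0)[r r0 Hr] := kc xR.
  have re0 : 0 < Num.min r e by rewrite lt_min r0.
  have /cvgrPdist_lt/(_ _ re0)[M _ HM] := C.
  (* Convergence is known along even times; continuity of [k] at its fixed point [xR] supplies the
     odd ones. *)
  exists M.*2 => // n /= Mn; rewrite distrC.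
  have := HM n./2; rewrite /= distrC iter_comp2 lt_min.
  have Mn2 : (M <= n./2)%N by rewrite -(doubleK M) half_leq.
  move=> /(_ Mn2) /andP[q1 q2].
  rewrite -(odd_double_half n); case: (odd n); rewrite ?add1n ?add0n//.
  have q3 : `|iter n./2.*2 k x - xR| < r by rewrite distrC.
  by rewrite iterS; have := Hr _ q3; rewrite kxR; first [by []|by rewrite distrC].
Qed.

(** Every point other than [xR] tends to the cycle: those on the left by the dynamics of f^2, those
    on the right after one step. *)
Lemma basin_attrE :
  N `&` basin_of_attraction F D [set uL; A uL] = N `&` [set x | x != xR].
Proof.
have [h1 h2 h3 h4] := order; have [[? ? ?] [? ? ? ?]] := bc_consts bc.
have fd := pw_decr bc.
apply/seteqP; split=> x /= [Nx].
  move=> [_ Hx]; split=> //; apply/eqP => xE.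
  pose e := Num.min (xR - uL) (A uL - xR).
  have e0 : 0 < e by rewrite lt_min; lra.
  have [M _ /(_ M (leqnn M))] := Hx e e0.
  have it n : iter n f xR = xR by elim: n => //= n ->.
  rewrite /= xE iterF// it => -[a [|] ->]; rewrite lt_min !ltr_norml => /andP[] ? ?; lra.
move=> xx; split=> //; split.
  by move=> n; rewrite iterF//; apply/DE/iter_pw_bound => //; exact: NP.
move=> e e0.
have ga'1 : 1 <= ga' by lra.
(* Odd iterates are images of even ones under a [ga']-Lipschitz map, hence the smaller tolerance. *)
have eg : 0 < e / ga' by rewrite divr_gt0//; lra.
have ege : e / ga' <= e by rewrite ler_pdivrMr ?ler_peMr ?(ltW e0)//; lra.
have left y : y < xR -> exists M, forall n, (M <= n)%N ->
    exists2 a, [set uL; A uL] a & `|iter n f y - a| < e.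
  move=> yx; have /cvgrPdist_lt/(_ _ eg)[M _ HM] := iter_pw2_attr bc n0 Eu Ex yx.
  exists M.*2 => n Mn.
  have Mn2 : (M <= n./2)%N by rewrite -(doubleK M) half_leq.
  have := HM _ Mn2; rewrite /= distrC iter_comp2 => q.
  rewrite -(odd_double_half n); case: (odd n); rewrite ?add1n ?add0n//; last first.
    by exists uL; [left|exact: lt_le_trans ege].
  exists (A uL); first by right.
  rewrite iterS -fuL (le_lt_trans (pw_lip bc _ _))// mulrC -ltr_pdivlMr//; lra.
move: xx; rewrite neq_lt => /orP[/left[M HM]|xx].
  by exists M => // n /= /HM; rewrite iterF.
have [M HM] : exists M, forall n, (M <= n)%N ->
    exists2 a, [set uL; A uL] a & `|iter n f (f x) - a| < e.
  by apply: left; rewrite -fxR; exact: fd.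
exists M.+1 => // -[//|n] /= Mn; have [a ua Ha] := HM n Mn.
have E : iter n.+1 F x = iter n f (f x) by rewrite iterF// iterSr.
by rewrite -E in Ha; exists a.
Qed.

End InvariantSets.

(** * From conjugacies of the line to conjugacies of neighbourhoods *)

Section Localisation.
Variable R : realType.
Implicit Types (x y p : R) (h k : R -> R).

Lemma incr_bij_inv h : incr_bij h -> exists k, [/\ cancel h k, cancel k h,
  {homo k : x y / x < y} & continuous k].
Proof.
move=> hb; have hm := incr_bij_mono hb; have [_ hs] := hb.
have [k kE] := choice hs; exists k.
have hk : cancel h k.
  by move=> x; have := kE (h x); case: (ltgtP (k (h x)) x) => //; rewrite -hm => + e; rewrite e ltxx.
have ki : {homo k : x y / x < y} by move=> x y xy; rewrite -hm !kE.
split=> //; apply: incr_bij_continuous; split=> // y.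
by exists (h y); rewrite hk.
Qed.

Lemma diffeomorphism_of (U V : set R) h k : incr_bij h -> cancel h k -> cancel k h ->
  continuous k -> open U -> open V -> (forall x, U x -> V (h x)) ->
  (forall y, V y -> U (k y)) -> (forall x, U x -> incr_diff_at h x) ->
  diffeomorphism_on U V h k.
Proof.
move=> hb hk kh kc oU oV UV VU hd; have hc := incr_bij_continuous hb.
split.
- split; [split|by move=> x Ux; split; [exact: UV|]|by move=> y Vy; split; [exact: VU|]].
    exact: continuous_subspaceT.
  exact: continuous_subspaceT.
- by apply: sdiff_C1 => // x /hd[d _ Hd]; exists d.
- apply: sdiff_C1 => // y /VU/hd[d d0 Hd]; exists (1 / d).
  apply: (sdiff_in_div (g := h) (T := setT)) => //.
  - exact: kc.
  - by rewrite gt_eqF.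
  - by apply: sdiff_ext (sdiff_id y) => z; rewrite /= kh.
Qed.

Lemma open_itv_oo (a b : R) : open [set` `]a, b[].
Proof. exact: interval_open. Qed.

Section Sizes.
Variables (al al' ga ga' K : R).
Hypotheses (bnd : slope_bounds al al' ga ga') (K0 : 0 <= K) (al'0 : 0 < al') (ga'0 : 0 < ga').
Local Notation th := (al' * ga').

(** Only the endpoints -p and p count, because their images bound M(mu). The statement covers all
    admissible p, since p is chosen after [M]. *)
Definition near_id_at (M nu : R) h := forall p, 0 < p -> M * p <= 1 ->
  M * `|nu| <= p -> `|h (- p) + p| <= M * p ^+ 2 /\ `|h p - p| <= M * p ^+ 2.

(** The value at p comes from the value at [B p], which can be as low as -(1 + ga') p; hence the
    left estimate is required on that longer interval. *)
Lemma near_id_at_right (M1 nu : R) (A A' B B' C C' D D' : R -> R) h p :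
  compatible al al' ga ga' K nu A A' B B' C C' D D' -> incr_bij h -> h 0 = 0 ->
  0 < p -> `|nu| <= p -> h (pw A B p) = pw C D (h p) -> 0 <= M1 ->
  (forall x, - ((1 + ga') * p) <= x -> x <= nu -> x <= 0 ->
    `|h x - x| <= M1 * (1 + ga') ^+ 2 * p ^+ 2) ->
  let M := M1 * (1 + ga') ^+ 2 + M1 + 3 * K + 1 in
  `|h (- p) + p| <= M * p ^+ 2 /\ `|h p - p| <= M * p ^+ 2.
Proof.
move=> cmp hb h0 p0 np E M10 H M; have [bcf bcg _ _] := cmp.
have ga'_gt0 := ga'0; have K_ge0 := K0.
have [_ [ga1 _ _ _]] := bc_consts bcf.
have p2 : 0 <= p ^+ 2 := sqr_ge0 p.
have gp : 0 < ga' * p by rewrite mulr_gt0.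
have /andP[n1 n2] : - p <= nu <= p by rewrite -ler_norml.
have le1 : M1 * (1 + ga') ^+ 2 * p ^+ 2 <= M * p ^+ 2.
  by rewrite ler_wpM2r// /M; lra.
split.
  apply: le_trans le1; rewrite -[p in _ + p]opprK; apply: H; lra.
have sB := B_slope bcf (ltW p0); rewrite (bcB0 bcf) subr0 in sB.
have gap : p <= ga * p by apply: ler_peMl; exact: ltW.
have Q : `|h (B p) - B p| <= M1 * (1 + ga') ^+ 2 * p ^+ 2 by apply: H; lra.
rewrite (le_trans (est_right cmp hb h0 p0 E Q))//.
have h1 : K * `|nu| * p <= K * p * p by rewrite ler_wpM2r ?(ltW p0)// ler_wpM2l.
have h2 : 0 <= M1 * p ^+ 2 by rewrite mulr_ge0.
rewrite /M; lra.
Qed.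

Lemma sqr_le_scaled (M1 x q : R) : 0 <= M1 -> - q <= x -> x <= 0 ->
  M1 * x ^+ 2 <= M1 * q ^+ 2.
Proof.
move=> M10 xq x0; rewrite ler_wpM2l// -(sqrrN x) ler_sqr ?nnegrE; lra.
Qed.

(** [M] precedes [nu] and the maps, so it is common to all small mu. *)
Lemma conj_with_size : exists M : R, 0 < M /\ forall (nu : R) (A A' B B' C C' D D' : R -> R),
  compatible al al' ga ga' K nu A A' B B' C C' D D' -> A' 0 * D' 0 = B' 0 * C' 0 ->
  (forall xL yL : R, nu <= 0 -> A xL = xL -> C yL = yL -> A' xL = C' yL ->
    exists h, diff_conj (pw A B) (pw C D) setT h /\ near_id_at M nu h) /\
  (forall uL vL xR yR : R, 0 < nu -> B (A uL) = uL -> D (C vL) = vL ->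
    B xR = xR -> D yR = yR -> B' (A uL) * A' uL = D' (C vL) * C' vL ->
    exists h, [/\ diff_conj (pw A B) (pw C D) [set x | x != xR] h,
      h xR = yR, h uL = vL & near_id_at M nu h]).
Proof.
have [Mn [Mn0 Hn]] := est_neg bnd K0 al'0 ga'0.
have [Mp [Mp0 Hp]] := est_pos bnd K0 al'0 ga'0.
have ga'_gt0 := ga'0; have K_ge0 := K0.
pose M1 := Mn + Mp; have M10 : 0 <= M1 by rewrite addr_ge0// ltW.
have MnM1 : Mn <= M1 by rewrite lerDl ltW.
have MpM1 : Mp <= M1 by rewrite lerDr ltW.
have g11 : 1 <= 1 + ga' by lra.
have g12 : 1 <= (1 + ga') ^+ 2 by rewrite exprn_ege1.
have g13 : 1 + ga' <= (1 + ga') ^+ 2 by rewrite expr2 ler_peMl//; lra.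
clearbody M1.
pose M := M1 * (1 + ga') ^+ 2 + M1 + 3 * K + 1.
have M1g : M1 * (1 + ga') <= M1 * (1 + ga') ^+ 2 by rewrite ler_wpM2l.
have M1M : M1 * (1 + ga') <= M by rewrite /M; lra.
have M1gg : 0 <= M1 * ga' by rewrite mulr_ge0// ltW.
have M11 : 1 <= M by rewrite /M; lra.
have M1leM : M1 <= M by lra.
exists M; split; first lra.
move=> nu A A' B B' C C' D D' cmp ratio; have [bcf bcg _ _] := cmp.
have pnu p : 0 < p -> M * `|nu| <= p -> `|nu| <= p.
  by move=> _; apply: le_trans; rewrite ler_peMl.
(* Common to [nu = 0] and [nu > 0]. In the latter case the conjugacy equation is missing at [xR];
   the alternative [|nu| > p] excludes it, as xR < nu. *)
have pos uL vL h c : 0 <= nu -> B (A uL) = uL -> D (C vL) = vL -> incr_bij h ->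
    h 0 = 0 -> 0 < c -> (nu = 0 -> c = 1) -> B' (A uL) * A' uL = D' (C vL) * C' vL ->
    (forall x, x <= 0 -> koenigs (D \o C) vL (B' (A uL) * A' uL) (h x) =
      c * koenigs (B \o A) uL (B' (A uL) * A' uL) x) ->
    (forall p, 0 < p -> h (pw A B p) = pw C D (h p) \/ `|nu| > p) -> near_id_at M nu h.
  move=> n0 Eu Ev hb h0 c0 c1 E hE hp p p0 Mpp Mnu; have np := pnu p p0 Mnu.
  have Ep : h (pw A B p) = pw C D (h p).
    by case: (hp p p0) => //; rewrite ltNge np.
  apply: (near_id_at_right cmp hb h0 p0 np Ep M10) => x x1 _ x0.
  have q0 : 0 < (1 + ga') * p by rewrite mulr_gt0//; lra.
  have := Hp _ _ _ _ _ _ _ _ _ _ _ _ _ cmp n0 Eu Ev hb h0 c0 c1 E hE ((1 + ga') * p) x q0.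
  have i1 : Mp * ((1 + ga') * p) <= 1.
    rewrite mulrA (le_trans _ Mpp)// ler_wpM2r ?(ltW p0)// (le_trans _ M1M)//.
    by rewrite ler_wpM2r//; lra.
  have i2 : Mp * nu <= (1 + ga') * p.
    have : Mp * nu <= M * `|nu|.
      by rewrite (ger0_norm n0) ler_wpM2r// (le_trans MpM1).
    have : 0 <= ga' * p by rewrite mulr_ge0 ?ltW.
    by move=> ? ?; lra.
  have i3 : - ((1 + ga') * p) <= x <= 0 by rewrite x1.
  move=> /(_ i1 i2 i3) /le_trans; apply.
  have -> : M1 * (1 + ga') ^+ 2 * p ^+ 2 = M1 * ((1 + ga') * p) * ((1 + ga') * p) by ring.
  apply: ler_pM => //; first by rewrite mulr_ge0 ?ltW.
    by rewrite ler_wpM2r// ltW.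
  by rewrite ler0_norm//; lra.
split=> [xL yL n0 Ex Ey E|uL vL xR yR n0 Eu Ev Ex Ey E].
  have [nE|nn] := eqVneq nu 0.
    have A0 := bcA0 bcf; have B0 := bcB0 bcf; have C0 := bcA0 bcg; have D0 := bcB0 bcg.
    have x0 : xL = 0.
      by have /andP[] := A_fix_norm bcf Ex; rewrite nE normr0 normr_le0 => /eqP.
    have y0 : yL = 0.
      by have /andP[] := A_fix_norm bcg Ey; rewrite nE normr0 normr_le0 => /eqP.
    rewrite x0 y0 in E; rewrite nE in A0 B0 C0 D0.
    have [h [dc hE]] := conj_zero bcf bcg ratio nE E.
    have [[? ? ?] [? ? ? ?]] := bc_consts bcf.
    have E2 : B' 0 = D' 0.
      move: ratio; rewrite E mulrC => /(mulIf _) ->//.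
      by have := bcA' bcg 0; move=> ?; rewrite lt_eqF//; lra.
    exists h; split=> //; apply: (pos 0 0 h 1) => //.
    - by rewrite nE.
    - by rewrite A0.
    - by rewrite C0.
    - exact: dc_bij dc.
    - exact: dc0 dc.
    - by rewrite A0 C0 E E2.
    - by move=> x xx; rewrite A0 mul1r; exact: hE.
    - by move=> p _; left; exact: (dc_eq dc).
  have {}n0 : nu < 0 by rewrite lt_neqAle nn.
  have [h [c [c0 dc hE]]] := conj_neg bcf bcg ratio n0 Ex Ey E.
  exists h; split=> // p p0 Mpp Mnu; have np := pnu p p0 Mnu.
  have Ep : h (pw A B p) = pw C D (h p) by exact: (dc_eq dc).
  apply: (near_id_at_right cmp (dc_bij dc) (dc0 dc) p0 np Ep M10) => x x1 xn x0.
  have Mnn : Mn * `|nu| <= 1.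
    have : Mn * `|nu| <= M * `|nu| by rewrite ler_wpM2r// (le_trans MnM1).
    have : p <= M * p by rewrite ler_peMl// ltW.
    by move=> ? ?; lra.
  have := Hn _ _ _ _ _ _ _ _ _ _ _ _ _ cmp n0 Mnn Ex Ey E dc c0 hE x xn.
  move=> /le_trans; apply; rewrite -mulrA -exprMn.
  apply: (le_trans (sqr_le_scaled (ltW Mn0) x1 x0)).
  by rewrite ler_wpM2r// sqr_ge0.
have [h [c [c0 dc hx hu hE]]] := conj_attr bcf bcg ratio n0 Eu Ev Ex Ey E.
exists h; split=> //; apply: (pos uL vL h c) => //.
- exact: ltW.
- exact: dc_bij dc.
- exact: dc0 dc.
- by move=> e; rewrite e ltxx in n0.
- move=> p p0; have [nn|np] := ltP p `|nu|; [by right|left].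
  apply: (dc_eq dc); rewrite /=.
  have /andP[_ xn] := B_fix_gt0 bcf n0 Ex.
  by rewrite gt_eqF// (lt_le_trans xn)// (le_trans _ np)// ler_norm.
Qed.

End Sizes.

Section FixedParameter.
Variables (al al' ga ga' K nu : R) (A A' B B' C C' D D' : R -> R).
Hypotheses (bcf : bcmap al al' ga ga' K nu A A' B B')
  (bcg : bcmap al al' ga ga' K nu C C' D D').
Variables (F G : R -> R) (r : R).
Hypotheses (FE : forall x, `|x| <= r -> F x = pw A B x)
  (GE : forall x, `|x| <= r -> G x = pw C D x).
Local Notation f := (pw A B).
Local Notation g := (pw C D).
Local Notation th := (al' * ga').

Lemma differentiably_conjugate_of (U V S : set R) h k :
  diff_conj f g S h -> cancel h k -> cancel k h -> continuous k -> U `<=` S ->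
  open U -> open V -> (forall x, U x -> V (h x)) -> (forall y, V y -> U (k y)) ->
  (forall x, U x -> `|x| <= r) -> (forall x, V x -> `|x| <= r) ->
  differentiably_conjugate F U G V.
Proof.
move=> dc hk kh kc US oU oV UV VU Ur Vr; exists h, k; split.
  by apply: diffeomorphism_of (dc_bij dc) hk kh kc oU oV UV VU _ => x /US; exact: (dc_diff dc).
move=> x Ux _; rewrite FE ?Ur// GE; last by apply: Vr; exact: UV.
by apply: (dc_eq dc); exact: US.
Qed.

Lemma local_conj_nonpos h p : diff_conj f g setT h -> 0 < p ->
  p <= r -> - r <= h (- p) -> h p <= r ->
  differentiably_conjugate F `]- p, p[ G `]h (- p), h p[.
Proof.
move=> dc p0 pr h1 h2; have hm := incr_bij_mono (dc_bij dc).
have [k [hk kh ki kc]] := incr_bij_inv (dc_bij dc).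
apply: (differentiably_conjugate_of dc hk kh kc) => //.
- by move=> x /=; rewrite !in_itv/= !hm.
- by move=> y /=; rewrite !in_itv/= -(hm (- p) (k y)) -(hm (k y) p) kh.
- by move=> x /=; rewrite in_itv/= ler_norml; lra.
- by move=> x /=; rewrite in_itv/= ler_norml; lra.
Qed.

Hypothesis ratio : A' 0 * D' 0 = B' 0 * C' 0.

(** The bound 2 p encloses both N and its image, and [r] leaves room for one more step of size
    [ga'], so that orbits starting there never meet the points where the extended maps differ from F
    and G. *)
Lemma local_conj_pos (Omega : set R) uL vL xR yR h p : 0 < nu -> B (A uL) = uL -> D (C vL) = vL ->
  B xR = xR -> D yR = yR -> B' xR = D' yR ->
  diff_conj f g [set x | x != xR] h -> h xR = yR -> h uL = vL ->
  0 < p -> - (2 * p) <= h (- p) -> h p <= 2 * p -> nu + ga' * (2 * p) <= r ->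
  (2 + ga') * nu < (1 - th) * p -> (forall x, `|x| <= r -> Omega x) ->
  let N := [set` `]- p, p[] in let M := [set` `]h (- p), h p[] in
  [/\ [/\ 0 < xR, fixed_points F N = [set xR],
          uL < 0 < A uL & period_two_points F N = [set uL; A uL]],
      [/\ 0 < yR, fixed_points G M = [set yR],
          vL < 0 < C vL & period_two_points G M = [set vL; C vL]],
      differentiably_conjugate F (N `&` basin_of_repulsion F N xR)
        G (M `&` basin_of_repulsion G M yR)
    & differentiably_conjugate F (N `&` basin_of_attraction F Omega [set uL; A uL])
        G (M `&` basin_of_attraction G setT [set vL; C vL])].
Proof.
move=> n0 Eu Ev Ex Ey E dc hx hu p0 hmp hpp nr np Or N M.
have [[? ? ?] [? ? ? th1]] := bc_consts bcf.
have [u0 nu_u] := BA_fix_lt0 bcf n0 Eu; have [v0 nu_v] := BA_fix_lt0 bcg n0 Ev.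
have /andP[x0 xn] := B_fix_gt0 bcf n0 Ex; have /andP[y0 yn] := B_fix_gt0 bcg n0 Ey.
have hm := incr_bij_mono (dc_bij dc).
have [k [hk kh ki kc]] := incr_bij_inv (dc_bij dc).
have nn : `|nu| = nu by rewrite gtr0_norm.
have ga'0 : 0 < ga' by lra.
have al'0 : 0 < al' by lra.
have gp : 0 < ga' * p by rewrite mulr_gt0.
have thp : 0 < th * p by rewrite mulr_gt0.
have gan : 0 < ga' * nu by rewrite mulr_gt0.
have HP : (1 + ga') * `|nu| <= (1 - th) * (2 * p) by rewrite nn; nra.
have [_ uC _] := BA_fix_bounds bcf (ltW n0) Eu.
have t1 : 0 < 1 - th by rewrite subr_gt0.
have up : `|uL| < p by rewrite -(ltr_pM2r t1) (le_lt_trans uC)//; lra.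
rewrite (ltr0_norm u0) in uC up.
(* (1 - th) A uL <= (1 - th) nu + al' (1 + ga') nu <= (2 + ga') nu, which explains the smallness
   condition on [nu]. *)
have uRp : A uL < p.
  have h1 := A_slope bcf (ltW u0); rewrite (bcA0 bcf) sub0r in h1.
  have h2 : al' * (- uL * (1 - th)) <= 1 * ((1 + ga') * nu).
    have q0 : 0 <= - uL * (1 - th) by apply: mulr_ge0 (ltW t1); rewrite oppr_ge0 ltW.
    by apply: ler_pM => //; exact: ltW.
  have /andP[_ h3] := h1.
  have h4 := ler_wpM2r (ltW t1) h3.
  have thn : 0 <= th * nu by rewrite mulr_ge0 ?ltW.
  rewrite -(ltr_pM2r t1); lra.
have hRv : h (A uL) = C vL.
  have := dc_eq dc (x := uL); rewrite hu (pw_le0 _ _ (ltW u0)) (pw_le0 _ _ (ltW v0)).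
  by apply; rewrite /= lt_eqF//; lra.
have NP x : N x -> `|x| <= 2 * p by rewrite /N/= in_itv/= ler_norml; lra.
have MP x : M x -> `|x| <= 2 * p by rewrite /M/= in_itv/= ler_norml; lra.
have pr : 2 * p <= r.
  have : p <= ga' * p by rewrite ler_peMl ?ltW//; lra.
  by lra.
have FE' x : `|x| <= `|nu| + ga' * (2 * p) -> F x = f x.
  by rewrite nn => xx; apply: FE; exact: le_trans nr.
have GE' x : `|x| <= `|nu| + ga' * (2 * p) -> G x = g x.
  by rewrite nn => xx; apply: GE; exact: le_trans nr.
have OE x : `|x| <= `|nu| + ga' * (2 * p) -> Omega x.
  by rewrite nn => xx; apply: Or; exact: le_trans nr.
have NE x : uL <= x <= A uL -> N x by rewrite /N/= in_itv/=; lra.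
have hle : {mono h : x y / x <= y} by move=> x y; rewrite !leNgt hm.
(* [h] maps the two-cycle of f to that of g, so the interval of the cycle of g is the image of an
   interval inside N. *)
have ME y : vL <= y <= C vL -> M y.
  move=> /andP[a b]; rewrite -hu -(kh y) hle in a; rewrite -hRv -(kh y) hle in b.
  have : N (k y) by apply: NE; rewrite a b.
  rewrite /N /M/= !in_itv/=.
  by rewrite -(hm (- p) (k y)) -(hm (k y) p) kh.
have oN : open N by exact: open_itv_oo.
have oM : open M by exact: open_itv_oo.
have NM x : N x -> M (h x) by rewrite /N /M /= !in_itv/= !hm.
have MN y : M y -> N (k y).
  by rewrite /N /M /= !in_itv/= -(hm (- p) (k y)) -(hm (k y) p) kh.
split.
- split=> //.
  + exact: (fixed_pointsE bcf n0 Eu Ex NP FE' NE).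
  + by rewrite u0/= (lt_trans n0).
  + exact: (period_two_pointsE bcf n0 Eu Ex NP FE' NE).
- split=> //.
  + exact: (fixed_pointsE bcg n0 Ev Ey MP GE' ME).
  + by rewrite v0/= (lt_trans n0).
  + exact: (period_two_pointsE bcg n0 Ev Ey MP GE' ME).
- have [h' [dc' hu' hR']] := conj_rep bcf bcg ratio n0 Eu Ev Ex Ey E.
  have hm' := incr_bij_mono (dc_bij dc').
  have [k' [hk' kh' ki' kc']] := incr_bij_inv (dc_bij dc').
  rewrite (basin_repE bcf n0 Eu Ex NP FE' NE) (basin_repE bcg n0 Ev Ey MP GE' ME).
  have oI (a b : R) : open [set x : R | a < x < b].
    have -> : [set x : R | a < x < b] = [set` `]a, b[].
      by apply/seteqP; split=> z /=; rewrite in_itv.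
    exact: open_itv_oo.
  apply: (differentiably_conjugate_of dc' hk' kh' kc') => //.
  + by move=> x /=; rewrite -hR' -hu' !hm'.
  + by move=> y /=; rewrite -hR' -hu' -(hm' uL (k' y)) -(hm' (k' y) (A uL)) kh'.
  + move=> x /= /andP[a b]; apply: le_trans pr; apply: NP; apply: NE.
    by rewrite (ltW a) (ltW b).
  + move=> x /= /andP[a b]; apply: le_trans pr; apply: MP; apply: ME.
    by rewrite (ltW a) (ltW b).
- rewrite (basin_attrE bcf n0 Eu Ex HP NP FE' OE NE).
  rewrite (basin_attrE bcg n0 Ev Ey HP MP GE' (fun _ _ => Logic.I) ME).
  have oS (a : R) : open [set x : R | x != a].
    have -> : [set x : R | x != a] = [set x | x < a] `|` [set x | a < x].
      by apply/seteqP; split=> z /=; rewrite neq_lt => /orP.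
    by apply: openU; [exact: open_lt|exact: open_gt].
  apply: (differentiably_conjugate_of dc hk kh kc).
  + by move=> x [].
  + exact: openI.
  + exact: openI.
  + move=> x [Nx /= xx]; split; first exact: NM.
    by rewrite /= -hx; apply: contra_neq xx => /(congr1 k); rewrite !hk.
  + move=> y [My /= yy]; split; first exact: MN.
    by rewrite /=; apply: contra_neq yy => e; rewrite -(kh y) e.
  + by move=> x [/NP xx _]; exact: le_trans pr.
  + by move=> x [/MP xx _]; exact: le_trans pr.
Qed.

End FixedParameter.
End Localisation.

(** * Extension of the two branches to the real line *)

Section Extension.
Variable R : realType.
Implicit Types (r x y mu : R).

Definition clamp r x := Num.max (- r) (Num.min r x).

Variant clamp_spec r x : R -> Type :=
| ClampLow of x < - r : clamp_spec r x (- r)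
| ClampIn of - r <= x <= r : clamp_spec r x x
| ClampHigh of r < x : clamp_spec r x r.

Lemma clampP r x : 0 <= r -> clamp_spec r x (clamp r x).
Proof.
move=> r0; rewrite /clamp; have [xr|xr] := ltP r x.
  by rewrite max_r; [constructor|lra].
by have [h|h] := ltP x (- r); constructor; rewrite ?h.
Qed.

Lemma clamp_bound r x : 0 <= r -> `|clamp r x| <= r.
Proof. by move=> r0; case: (clampP x r0) => h; rewrite ler_norml; lra. Qed.

Lemma clamp_id r x : `|x| <= r -> clamp r x = x.
Proof.
move=> xr; have r0 : 0 <= r := le_trans (normr_ge0 _) xr.
move: xr; rewrite ler_norml => /andP[h1 h2].
by case: (clampP x r0) => // h; exfalso; lra.
Qed.

Lemma clamp0 r : 0 <= r -> clamp r 0 = 0.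
Proof. by move=> r0; rewrite clamp_id ?normr0. Qed.

(** The second bound says that, unless the clamped values coincide, the overshoot of y is at most |y
    - x|; it controls the affine part of an extension. *)
Lemma clamp_dist r x y : 0 <= r -> `|clamp r y - clamp r x| <= `|y - x| /\
  `|clamp r y - clamp r x| * `|y - clamp r y| <= `|y - x| * `|clamp r y - clamp r x|.
Proof.
move=> r0; suff [h1 h2] : `|clamp r y - clamp r x| <= `|y - x| /\
    (clamp r y = clamp r x \/ `|y - clamp r y| <= `|y - x|).
  split=> //; case: h2 => [->|h2]; first by rewrite subrr normr0 mul0r mulr0.
  by rewrite mulrC ler_wpM2r.
have le (a b : R) : - b <= a <= b \/ b <= a <= - b -> `|a| <= `|b|.
  case=> h.
    have b0 : 0 <= b by lra.
    by rewrite (ger0_norm b0) ler_norml.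
  have b0 : b <= 0 by lra.
  by rewrite (ler0_norm b0) ler_norml opprK.
case: (clampP y r0) => hy; case: (clampP x r0) => hx; split.
all: try exact: lexx.
all: try by rewrite subrr normr0 normr_ge0.
all: try by left.
all: try by right; rewrite subrr normr0.
all: try (apply: le; first [left; lra|right; lra]).
all: right; apply: le; first [left; lra|right; lra].
Qed.

Lemma clamp_continuous r : 0 <= r -> continuous (clamp r).
Proof.
move=> r0 x; apply/continuous_epsP => e e0; exists e => // y.
by apply: le_lt_trans; exact: (clamp_dist x y r0).1.
Qed.

(** Continuation by the tangent lines at -r and r. Its derivative is A' at the clamped point, so
    slope bounds known on the ball hold on the whole line. *)
Definition ext r (A A' : R -> R) x := A (clamp r x) + A' (clamp r x) * (x - clamp r x).

Lemma ext_C11 K r (A A' : R -> R) : 0 <= r -> 0 <= K ->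
  (forall x y, `|x| <= r -> `|y| <= r -> `|A y - A x - A' x * (y - x)| <= K * (y - x) ^+ 2) ->
  (forall x y, `|x| <= r -> `|y| <= r -> `|A' x - A' y| <= K * `|x - y|) ->
  C11 (2 * K) (ext r A A') (A' \o clamp r).
Proof.
move=> r0 K0 H1 H2; split=> x y; have [d1 d2] := clamp_dist x y r0; last first.
  rewrite (le_trans (H2 _ _ (clamp_bound _ r0) (clamp_bound _ r0)))//.
  have [d3 _] := clamp_dist y x r0.
  have := ler_wpM2l K0 d3; have := mulr_ge0 K0 (normr_ge0 (x - y)); lra.
rewrite /ext /=.
have h1 := H1 _ _ (clamp_bound x r0) (clamp_bound y r0).
have h2 := H2 _ _ (clamp_bound y r0) (clamp_bound x r0).
move: d1 d2 h1 h2; set cx := clamp r x; set cy := clamp r y => d1 d2 h1 h2.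
have -> : A cy + A' cy * (y - cy) - (A cx + A' cx * (x - cx)) - A' cx * (y - x) =
  (A cy - A cx - A' cx * (cy - cx)) + (A' cy - A' cx) * (y - cy) by ring.
rewrite (le_trans (ler_normD _ _))// normrM.
have h3 := ler_wpM2r (normr_ge0 (y - cy)) h2.
rewrite -(real_normK (num_real (cy - cx))) in h1; rewrite -(real_normK (num_real (y - x))).
have q : `|cy - cx| ^+ 2 <= `|y - x| ^+ 2 by rewrite ler_sqr ?nnegrE.
have q2 : `|y - x| * `|cy - cx| <= `|y - x| ^+ 2 by rewrite expr2 ler_wpM2l.
have q3 := ler_wpM2l K0 q; have q4 := ler_wpM2l K0 (le_trans d2 q2).
lra.
Qed.

Lemma MVT_ball r (f df : R -> R) x y : (forall z : R, `|z| <= r -> is_derive z 1 f (df z)) ->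
  `|x| <= r -> `|y| <= r ->
  exists c, [/\ f y - f x = df c * (y - x), `|c| <= r & `|c - x| <= `|y - x|].
Proof.
move=> Hd xr yr.
have W a b : a <= b -> `|a| <= r -> `|b| <= r -> exists c,
    [/\ f b - f a = df c * (b - a), `|c| <= r, a <= c & c <= b].
  move=> ab; rewrite !ler_norml => /andP[a1 a2] /andP[b1 b2].
  have inr z : z \in `[a, b] -> `|z| <= r.
    by rewrite in_itv/= ler_norml => /andP[? ?]; lra.
  have [||c cab E] := @MVT_segment R f df a b ab.
  - by move=> z zab; apply: Hd; apply: inr; move: zab; exact: subset_itv_oo_cc.
  - apply: continuous_in_subspaceT => z; rewrite inE => /inr /Hd[+ _].
    by move=> /derivable1_diffP/differentiable_continuous.
  by exists c; move: (cab); rewrite in_itv/= => /andP[? ?]; split=> //; exact: inr.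
have [xy|/ltW yx] := leP x y.
  have [c [E cr c1 c2]] := W x y xy xr yr; exists c; split=> //.
  by rewrite !ger0_norm ?subr_ge0//; lra.
have [c [E cr c1 c2]] := W y x yx yr xr; exists c; split=> //.
  by rewrite -[LHS]opprB E; ring.
by rewrite !ler0_norm ?subr_le0//; lra.
Qed.

End Extension.

(** * Families of branches depending on mu *)

Section Families.
Variable R : realType.
Implicit Types (F : R * R -> R) (x mu r : R).

Lemma slice_x F x mu : derivable F (x, mu) ((1, 0) : R * R) ->
  is_derive x 1 (fun x => F (x, mu)) (pderiv_x F (x, mu)).
Proof.
rewrite /pderiv_x => dF.
have E : (fun h : R => h^-1 *: (((fun x => F (x, mu)) \o shift x) (h *: 1) - F (x, mu))) =
  (fun h : R => h^-1 *: ((F \o shift (x, mu)) (h *: ((1, 0) : R * R)) - F (x, mu))).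
  apply/funext => h; congr (_ *: (_ - _)); rewrite /= /shift /=; congr (F _).
  by congr pair; rewrite /= /GRing.scale/= ?mulr0 ?add0r.
by split; [rewrite /derivable E|rewrite /derive E].
Qed.

Lemma slice_mu F x mu : derivable F (x, mu) ((0, 1) : R * R) ->
  is_derive mu 1 (fun mu => F (x, mu)) (pderiv_mu F (x, mu)).
Proof.
rewrite /pderiv_mu => dF.
have E : (fun h : R => h^-1 *: (((fun mu => F (x, mu)) \o shift mu) (h *: 1) - F (x, mu))) =
  (fun h : R => h^-1 *: ((F \o shift (x, mu)) (h *: ((0, 1) : R * R)) - F (x, mu))).
  apply/funext => h; congr (_ *: (_ - _)); rewrite /= /shift /=; congr (F _).
  by congr pair; rewrite /= /GRing.scale/= ?mulr0 ?add0r.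
by split; [rewrite /derivable E|rewrite /derive E].
Qed.

Lemma nbhs_box (S : set (R * R)) : nbhs ((0, 0) : R * R) S -> exists2 r : R, 0 < r &
  forall x mu, `|x| <= r -> `|mu| <= r -> S (x, mu).
Proof.
move=> /nbhs_ballP[e /= e0 H]; exists (e / 2); first by rewrite divr_gt0.
have e2 : e / 2 < e by rewrite ltr_pdivrMr// ltr_pMr// ltr1n.
move=> x mu xr mr; apply: H; split; rewrite /ball/= sub0r normrN.
  exact: le_lt_trans e2.
exact: le_lt_trans e2.
Qed.

(** What is kept of the smoothness in (x, mu), with bounds holding for all mu. [fam_2] is a
    second-order expansion of the branch, uniform in mu near 0; the limit of the coefficient t rests
    on it. *)
Record family (eps K a a2 : R) (nu : R -> R) (A A' : R -> R -> R) : Prop := {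
  fam_C11 : forall mu, C11 K (A mu) (A' mu);
  fam_bd : forall mu x, `|A' mu x - a| <= eps;
  fam0 : forall mu, A mu 0 = nu mu;
  fam_cont : forall x, continuous (A^~ x);
  fam_cont' : forall x, continuous (A'^~ x);
  fam_a : forall mu, `|A' mu 0 - a| <= K * `|mu|;
  fam_2 : forall e, 0 < e -> exists2 d : R, 0 < d & forall mu x, `|mu| < d ->
    `|x| < d -> `|A' mu x - A' mu 0 - a2 * x| <= e * `|x| }.

Definition famA F r mu := ext r (fun x => F (x, clamp r mu)) (fun x => pderiv_x F (x, clamp r mu)).
Definition famA' F r mu x := pderiv_x F (clamp r x, clamp r mu).

Lemma continuous_slice F x (c : R -> R) mu : continuous c -> {for (x, c mu), continuous F} ->
  {for mu, continuous (fun mu => F (x, c mu))}.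
Proof.
move=> cc Fc; apply: (@cvg_comp _ _ _ (fun mu => (x, c mu)) F); last exact: Fc.
move=> S /= [[P Q] /= [Px Qc] PQ].
have : nbhs mu (c @^-1` Q) by exact: cc mu _ Qc.
rewrite nbhs_simpl /=; apply: filterS => y Qy.
by apply: PQ; split=> //=; exact: nbhs_singleton Px.
Qed.

Lemma norm_le_near1 (v w k : R) : `|v - w| <= 1 -> 0 <= k ->
  `|v| <= `|w| + k + 1 /\ `|v| <= k + `|w| + 1.
Proof. by move=> h k0; have := ler_normD (v - w) w; rewrite subrK; lra. Qed.

(** [K] and [a2] do not depend on r, so both branches can later be cut off at a common radius. The
    mean value theorem bounds the increments of the first derivative; the factor 2 comes from the
    affine extension. *)
Lemma family_exists F (U : set (R * R)) eps : open U -> U (0, 0) -> C_on 3 U F -> 0 < eps ->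
  exists r1 K a2 : R, [/\ 0 < r1, 0 <= K & forall r, 0 < r -> r <= r1 ->
    family eps K (pderiv_x F (0, 0)) a2 (fun mu => F (0, clamp r mu)) (famA F r) (famA' F r) /\
    (forall mu x, `|mu| <= r -> `|x| <= r -> famA F r mu x = F (x, mu))].
Proof.
move=> oU U0 CF eps0.
have [Fc [Fdx Fdm [Fxc [Fxdx Fxdm [Fxxc _] [Fxmc _]]] _]] := CF.
have inU z : U z -> z \in U by rewrite inE.
pose a := pderiv_x F (0, 0); pose a2 := pderiv_x (pderiv_x F) (0, 0).
pose am := pderiv_mu (pderiv_x F) (0, 0).
have near_of (H : R * R -> R) e : 0 < e -> {in U, continuous H} ->
    exists2 r : R, 0 < r & forall x mu, `|x| <= r -> `|mu| <= r -> `|H (x, mu) - H (0, 0)| <= e.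
  move=> e0 Hc; have := Hc _ (inU _ U0) => /cvgrPdist_le/(_ e e0) /nbhs_box[r r0 Hr].
  by exists r => // x mu xr mr; rewrite distrC; exact: Hr.
have [s0 s00 Hs0] : exists2 r : R, 0 < r & forall x mu, `|x| <= r -> `|mu| <= r -> U (x, mu).
  by apply: nbhs_box; exact: open_nbhs_nbhs.
have [s1 s10 Hs1] := near_of _ _ eps0 Fxc.
have [s2 s20 Hs2] := near_of _ _ ltr01 Fxxc.
have [s3 s30 Hs3] := near_of _ _ ltr01 Fxmc.
pose K := `|a2| + `|am| + 1.
have K0 : 0 <= K by rewrite !addr_ge0.
exists (Num.min (Num.min s0 s1) (Num.min s2 s3)), (2 * K), a2; split.
- by rewrite !lt_min s00 s10 s20.
- by rewrite mulr_ge0.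
move=> r r_gt0; rewrite !le_min => /andP[/andP[r0 r1] /andP[r2 r3]].
have rr := ltW r_gt0.
have Ub x mu : `|x| <= r -> `|mu| <= r -> U (x, mu).
  by move=> xr mr; apply: Hs0; apply: le_trans r0.
have bxx x mu : `|x| <= r -> `|mu| <= r -> `|pderiv_x (pderiv_x F) (x, mu)| <= K.
  move=> xr mr; have h := Hs2 x mu (le_trans xr r2) (le_trans mr r2).
  exact: (norm_le_near1 h (normr_ge0 am)).1.
have bxm x mu : `|x| <= r -> `|mu| <= r -> `|pderiv_mu (pderiv_x F) (x, mu)| <= K.
  move=> xr mr; have h := Hs3 x mu (le_trans xr r3) (le_trans mr r3).
  exact: (norm_le_near1 h (normr_ge0 a2)).2.
have cl mu : `|clamp r mu| <= r by exact: clamp_bound.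
have D1 mu (z : R) : `|mu| <= r -> `|z| <= r ->
    is_derive z 1 (fun x => F (x, mu)) (pderiv_x F (z, mu)).
  by move=> mr zr; apply: slice_x; apply: Fdx; exact/inU/Ub.
have D2 mu (z : R) : `|mu| <= r -> `|z| <= r ->
    is_derive z 1 (fun x => pderiv_x F (x, mu)) (pderiv_x (pderiv_x F) (z, mu)).
  by move=> mr zr; apply: slice_x; apply: Fxdx; exact/inU/Ub.
have D3 mu (z : R) : `|mu| <= r -> `|z| <= r ->
    is_derive mu 1 (fun mu => pderiv_x F (z, mu)) (pderiv_mu (pderiv_x F) (z, mu)).
  by move=> mr zr; apply: slice_mu; apply: Fxdm; exact/inU/Ub.
have L mu x y : `|mu| <= r -> `|x| <= r -> `|y| <= r ->
    `|pderiv_x F (x, mu) - pderiv_x F (y, mu)| <= K * `|x - y|.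
  move=> mr xr yr; have [c [-> cr _]] := MVT_ball (fun z => D2 mu z mr) yr xr.
  by rewrite normrM ler_wpM2r// bxx.
split; last first.
  move=> mu x mr xr; rewrite /famA /ext !(clamp_id mr) (clamp_id xr).
  by rewrite subrr mulr0 addr0.
split.
- move=> mu; apply: ext_C11 => //; last by move=> x y; exact: L.
  move=> x y xr yr; have [c [-> cr cx]] := MVT_ball (fun z => D1 _ z (cl mu)) xr yr.
  rewrite -mulrBl normrM -(real_normK (num_real (y - x))) expr2 mulrA ler_wpM2r//.
  by rewrite (le_trans (L _ _ _ (cl mu) cr xr))// ler_wpM2l.
- move=> mu x; apply: Hs1; exact: le_trans r1.
- by move=> mu; rewrite /famA /ext !(clamp0 rr) subrr mulr0 addr0.
- move=> x mu; rewrite /famA /ext.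
  apply: cvgD; last apply: cvgMl.
    by apply: continuous_slice; [exact: clamp_continuous|apply: Fc; exact/inU/Ub].
  by apply: continuous_slice; [exact: clamp_continuous|apply: Fxc; exact/inU/Ub].
- move=> x mu; rewrite /famA'.
  by apply: continuous_slice; [exact: clamp_continuous|apply: Fxc; exact/inU/Ub].
- move=> mu; rewrite /famA' (clamp0 rr).
  have z0 : `|0 : R| <= r by rewrite normr0.
  have [c [E cr _]] := MVT_ball (fun z zr => D3 z 0 zr z0) z0 (cl mu).
  rewrite E subr0 normrM.
  have := (clamp_dist 0 mu rr).1; rewrite (clamp0 rr) !subr0 => h.
  have h2 := ler_pM (normr_ge0 _) (normr_ge0 _) (bxm 0 c z0 cr) h.
  rewrite (le_trans h2)//; have := mulr_ge0 K0 (normr_ge0 mu); lra.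
- move=> e e0; have [s s_gt0 Hs] := near_of _ _ e0 Fxxc.
  exists (Num.min r s); first by rewrite lt_min r_gt0.
  move=> mu x; rewrite !lt_min => /andP[/ltW mr /ltW ms] /andP[/ltW xr /ltW xs].
  rewrite /famA' (clamp0 rr) (clamp_id mr) (clamp_id xr).
  have z0 : `|0 : R| <= Num.min r s by rewrite normr0 le_min rr ltW.
  have xm : `|x| <= Num.min r s by rewrite le_min xr.
  have D2' (z : R) : `|z| <= Num.min r s ->
      is_derive z 1 (fun x => pderiv_x F (x, mu)) (pderiv_x (pderiv_x F) (z, mu)).
    by rewrite le_min => /andP[zr _]; exact: D2.
  have [c [E + _]] := MVT_ball D2' z0 xm; rewrite le_min => /andP[cr cs].
  rewrite E subr0 -mulrBl normrM ler_wpM2r//; exact: Hs.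
Qed.

End Families.

Section ParameterFunctions.
Variable R : realType.
Implicit Types (mu x y : R).

Lemma slope_margin (aL aR : R) : aR < -1 -> aR^-1 < aL < 0 -> exists eps : R,
  0 < eps /\ slope_bounds (- aL - eps) (- aL + eps) (- aR - eps) (- aR + eps).
Proof.
move=> hR /andP[hL hL0]; pose a := - aL; pose b := - aR.
have a0 : 0 < a by rewrite oppr_gt0.
have b1 : 1 < b by rewrite /b; lra.
have s1 : a * b < 1.
  have : aR * aL < aR * aR^-1 by rewrite ltr_nM2l//; lra.
  by rewrite divff ?lt_eqF//; [rewrite /a /b; lra|lra].
have s0 : 0 < a * b by rewrite mulr_gt0//; lra.
set s := a * b in s0 s1; have sE : s = a * b by [].
(* With s = aL aR in (0, 1), an error t in the products must preserve (s + t)^2 < s - t. As s t <= t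
   and t^2 <= t, it suffices that 4 t < s - s^2, and here 8 t = s - s^2. *)
pose t := s * (1 - s) / 8.
have t0 : 0 < t by rewrite divr_gt0// mulr_gt0// subr_gt0.
have t8 : 8 * t = s * (1 - s) by rewrite /t; field.
clearbody s t.
have ab : 0 < a + b + 1 by lra.
pose e := Num.min (t / (a + b + 1)) (Num.min (a / 2) ((b - 1) / 2)).
have e0 : 0 < e by rewrite !lt_min !divr_gt0//; lra.
have e1 : e * (a + b + 1) <= t by rewrite -ler_pdivlMr// ge_min lexx.
have e2 : e <= a / 2 by rewrite !ge_min lexx orbT.
have e3 : e <= (b - 1) / 2 by rewrite !ge_min lexx !orbT.
have t1 : t <= 8^-1 * (1 - s) by have := sqr_ge0 (1 - s); rewrite expr2; lra.
have e4 : e <= 1.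
  have : e <= e * (a + b + 1) by rewrite ler_peMr// ?ltW//; lra.
  by lra.
have ee : 0 <= e * e <= e.
  by rewrite mulr_ge0 ?(ltW e0)//= ler_piMr// ltW.
have up : (a + e) * (b + e) <= s + t by rewrite sE; lra.
have lo : s - t <= (a - e) * (b - e) by rewrite sE; lra.
have up0 : 0 <= (a + e) * (b + e) by rewrite mulr_ge0//; lra.
exists e; split=> //; rewrite -/a -/b; split; [lra|lra|lra|].
apply: (@le_lt_trans _ _ ((s + t) ^+ 2)).
  by rewrite ler_sqr ?nnegrE//; lra.
apply: lt_le_trans lo.
have tt : t * t <= t by rewrite ler_piMr// ?(ltW t0)//; lra.
have st : s * t <= t by rewrite ler_piMl// ?ltW.
rewrite expr2; lra.
Qed.

(** Uniform expansion in x bounds the displacement of the zero by the value of E at the old zero; no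
    derivative in mu enters. *)
Lemma zero_continuous (E : R -> R -> R) (z : R -> R) (m : R) : 0 < m ->
  (forall mu x y, m * `|x - y| <= `|E mu x - E mu y|) -> (forall mu, E mu (z mu) = 0) ->
  (forall x, continuous (E^~ x)) -> continuous z.
Proof.
move=> m0 HE Hz Ec mu; apply/continuous_epsP => e e0.
have /continuous_epsP/(_ (m * e) (mulr_gt0 m0 e0))[r r0 Hr] := Ec (z mu) mu.
exists r => // y /Hr; rewrite Hz subr0 => H.
have := HE y (z mu) (z y); rewrite Hz subr0 => /le_lt_trans/(_ H).
by rewrite ltr_pM2l// distrC.
Qed.

Lemma param_comp_continuous (B : R -> R -> R) (a : R -> R) (L : R) :
  (forall mu x y, `|B mu x - B mu y| <= L * `|x - y|) ->
  (forall x, continuous (B^~ x)) -> continuous a -> continuous (fun mu => B mu (a mu)).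
Proof.
move=> HB Bc ac mu; apply/continuous_epsP => e e0.
have L1 : 0 < `|L| + 1 by rewrite ltr_wpDl.
have e2 : 0 < e / 2 by rewrite divr_gt0.
have /continuous_epsP/(_ _ e2)[r r0 Hr] := Bc (a mu) mu.
have /continuous_epsP/(_ _ (divr_gt0 e2 L1))[s s0 Hs] := ac mu.
exists (Num.min r s); first by rewrite lt_min r0.
move=> y; rewrite lt_min => /andP[/Hr h1 /Hs h2].
have -> : B y (a y) - B mu (a mu) = (B y (a y) - B y (a mu)) + (B y (a mu) - B mu (a mu)).
  by ring.
rewrite (le_lt_trans (ler_normD _ _))// (splitr e) ler_ltD//.
rewrite (le_trans (HB _ _ _))//.
move: h2; rewrite ltr_pdivlMr// => h2.
have : L * `|a y - a mu| <= `|a y - a mu| * (`|L| + 1).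
  rewrite mulrC ler_wpM2l//; have := ler_norm L; lra.
by move=> /le_trans; apply; exact: ltW.
Qed.

Lemma squeeze_cvg (z c w : R -> R) (l K : R) : (forall mu, `|z mu - c mu| <= K * `|w mu|) ->
  c mu @[mu --> 0] --> l -> w mu @[mu --> 0] --> (0 : R) -> z mu @[mu --> 0] --> l.
Proof.
move=> H cl w0.
have D : (fun mu => z mu - c mu) @ (0 : R) --> (0 : R).
  apply/cvgrPdist_le => e e0; have K1 : 0 < `|K| + 1 by rewrite ltr_wpDl.
  move/cvgrPdist_le : w0 => /(_ _ (divr_gt0 e0 K1)); apply: filterS => mu.
  rewrite sub0r normrN ler_pdivlMr// => h; rewrite sub0r normrN (le_trans (H mu))//.
  apply: le_trans h; rewrite mulrC ler_wpM2l//; have := ler_norm K; lra.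
rewrite -[l]add0r (_ : z = fun mu => (z mu - c mu) + c mu); first exact: cvgD.
by apply/funext => mu; rewrite subrK.
Qed.

(** At 0 only a punctured limit of f2 is asked for: the formula for t on mu > 0 divides by [nu],
    which vanishes there. *)
Lemma glue_continuous (f1 f2 : R -> R) mu : (mu <= 0 -> {for mu, continuous f1}) ->
  (0 < mu -> {for mu, continuous f2}) ->
  (mu = 0 -> f2 @ (0 : R)^' --> f1 0) ->
  {for mu, continuous (fun mu => if mu <= 0 then f1 mu else f2 mu)}.
Proof.
move=> c1 c2 c0; apply/continuous_epsP => e e0; have [mu0|mu0|mu0] := ltgtP mu 0.
- have /continuous_epsP/(_ e e0)[r r0 Hr] := c1 (ltW mu0).
  exists (Num.min r (- mu)); first by rewrite lt_min r0 oppr_gt0.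
  move=> y; rewrite lt_min => /andP[yr]; rewrite ltr_norml => ym.
  by rewrite ifT; [exact: Hr|lra].
- have /continuous_epsP/(_ e e0)[r r0 Hr] := c2 mu0.
  exists (Num.min r mu); first by rewrite lt_min r0.
  move=> y; rewrite lt_min => /andP[yr]; rewrite ltr_norml => ym.
  by rewrite leNgt ifF; [exact: Hr|apply/negbTE; rewrite negbK; lra].
- have /continuous_epsP/(_ e e0)[r r0 Hr] : {for 0, continuous f1} by rewrite -mu0; apply: c1; rewrite mu0.
  have /cvgrPdist_lt/(_ e e0) := c0 mu0; rewrite near_withinE => /nbhs_ballP[s /= s0 Hs].
  exists (Num.min r s); first by rewrite lt_min r0.
  move=> y; rewrite mu0 subr0 lt_min => /andP[yr ys].
  have [y0|y0] := leP y 0; first by apply: Hr; rewrite subr0.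
  rewrite distrC; apply: Hs; last by rewrite gt_eqF.
  by rewrite /ball/= sub0r normrN.
Qed.

Lemma familyW (eps K K' a a2 : R) nu A A' : K <= K' -> family eps K a a2 nu A A' ->
  family eps K' a a2 nu A A'.
Proof.
move=> KK [H1 H2 H3 H4 H5 H6 H7]; split=> //.
- by move=> mu; exact: C11W (H1 mu).
- by move=> mu; rewrite (le_trans (H6 mu))// ler_wpM2r.
Qed.

Record setting (eps K aL aR a2L a2R beta r : R) (nu : R -> R) (A A' B B' : R -> R -> R) : Prop := {
  set_bounds : slope_bounds (- aL - eps) (- aL + eps) (- aR - eps) (- aR + eps);
  set_eps : 0 < eps;
  set_A : family eps K aL a2L nu A A';
  set_B : family eps K aR a2R nu B B';
  set_r : 0 < r;
  set_beta : 0 < beta;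
  set_nu : forall mu, `|mu| <= r -> `|nu mu - beta * mu| <= beta / 2 * `|mu| }.

Section Setting.
Variables (eps K aL aR a2L a2R beta r : R) (nu : R -> R) (A A' B B' : R -> R -> R).
Hypothesis S : setting eps K aL aR a2L a2R beta r nu A A' B B'.

Lemma setting_bcmap mu : bcmap (- aL - eps) (- aL + eps) (- aR - eps) (- aR + eps) K (nu mu)
    (A mu) (A' mu) (B mu) (B' mu).
Proof.
have [H1 H2 HA HB _ _ _] := S; split=> //.
- exact: fam_C11 HA mu.
- exact: fam_C11 HB mu.
- by move=> x; have := fam_bd HA mu x; rewrite ler_norml; lra.
- by move=> x; have := fam_bd HB mu x; rewrite ler_norml; lra.
- exact: fam0 HA mu.
- exact: fam0 HB mu.
Qed.

Lemma nu0 : nu 0 = 0.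
Proof.
have := set_nu S (mu := 0); rewrite normr0 !mulr0 subr0 => /(_ (ltW (set_r S))).
by rewrite normr_le0 => /eqP.
Qed.

Lemma nu_bounds mu : `|mu| <= r -> beta / 2 * `|mu| <= `|nu mu| <= 2 * beta * `|mu|.
Proof.
move=> mr; have h := set_nu S mr; have b0 := set_beta S.
have bm : `|beta * mu| = beta * `|mu| by rewrite normrM gtr0_norm.
have h1 : `|nu mu| <= `|nu mu - beta * mu| + `|beta * mu|.
  by rewrite -{1}[nu mu](subrK (beta * mu)) ler_normD.
have h2 : `|beta * mu| <= `|nu mu| + `|nu mu - beta * mu|.
  by rewrite -{1}[beta * mu](subKr (nu mu)) ler_normB.
have h3 : 0 <= beta * `|mu| by rewrite mulr_ge0// ltW.
rewrite bm in h1 h2; lra.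
Qed.

Lemma nu_sign mu : `|mu| <= r -> (0 < nu mu) = (0 < mu) /\ (nu mu < 0) = (mu < 0).
Proof.
move=> mr; have := set_nu S mr; have b0 := set_beta S.
have [m0|m0|->] := ltgtP mu 0; last by rewrite nu0 ltxx.
- rewrite (ltr0_norm m0) ler_norml => /andP[_ h].
  have bm : beta * mu < 0 by rewrite nmulr_llt0.
  have h2 : nu mu < 0 by lra.
  by split=> //; apply/negbTE; rewrite -leNgt ltW.
- rewrite (gtr0_norm m0) ler_norml => /andP[h _].
  have bm : 0 < beta * mu by rewrite mulr_gt0.
  have h2 : 0 < nu mu by lra.
  by split=> //; apply/negbTE; rewrite -leNgt ltW.
Qed.

Lemma nu_continuous : continuous nu.
Proof.
have -> : nu = A^~ 0 by apply/funext => mu; rewrite (fam0 (set_A S)).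
exact: fam_cont (set_A S) 0.
Qed.

End Setting.
End ParameterFunctions.

(** * Parameters of the normal form *)

Section ParameterLimits.
Variable R : realType.
Implicit Types (mu x y : R).

(* Divided differences, extended by their limit where z vanishes. *)
Definition slope_at (F F' : R -> R -> R) (z : R -> R) mu :=
  if z mu == 0 then F' mu 0 else (F mu (z mu) - F mu 0) / z mu.

Definition curvature_at (F' : R -> R -> R) (a2 : R) (z : R -> R) mu :=
  if z mu == 0 then a2 else (F' mu (z mu) - F' mu 0) / z mu.

Lemma slope_atE F F' z mu : F mu (z mu) = F mu 0 + slope_at F F' z mu * z mu.
Proof.
rewrite /slope_at; have [->|z0] := eqVneq (z mu) 0; first by rewrite mulr0 addr0.
by rewrite divfK// addrC subrK.
Qed.

Lemma curvature_atE F' a2 z mu : F' mu (z mu) = F' mu 0 + curvature_at F' a2 z mu * z mu.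
Proof.
rewrite /curvature_at; have [->|z0] := eqVneq (z mu) 0; first by rewrite mulr0 addr0.
by rewrite divfK// addrC subrK.
Qed.

Lemma family_slope0 (eps K a a2 : R) nu F F' : family eps K a a2 nu F F' -> F' 0 0 = a.
Proof.
move=> H; have := fam_a H 0; rewrite normr0 mulr0 normr_le0 subr_eq0 => /eqP //.
Qed.

Lemma family_cvg0 (eps K a a2 : R) nu F F' : family eps K a a2 nu F F' ->
  F' mu 0 @[mu --> 0] --> a.
Proof. by move=> H; rewrite -(family_slope0 H); exact: fam_cont' H 0 0. Qed.

Lemma slope_at_cvg (eps K a a2 : R) nu F F' (z : R -> R) : family eps K a a2 nu F F' ->
  z mu @[mu --> 0] --> (0 : R) -> slope_at F F' z mu @[mu --> 0] --> a.
Proof.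
move=> H z0; apply: (squeeze_cvg (w := z) (K := K) _ (family_cvg0 H) z0) => mu.
rewrite /slope_at; have [E|zn] := eqVneq (z mu) 0.
  by rewrite subrr normr0 E normr0 mulr0.
have := (fam_C11 H mu).1 0 (z mu); rewrite subr0 => h.
have -> : (F mu (z mu) - F mu 0) / z mu - F' mu 0 =
  (F mu (z mu) - F mu 0 - F' mu 0 * z mu) / z mu by field.
rewrite normrM normfV ler_pdivrMr ?normr_gt0// -mulrA -expr2 real_normK//.
exact: num_real.
Qed.

Lemma curvature_at_cvg (eps K a a2 : R) nu F F' (z : R -> R) : family eps K a a2 nu F F' ->
  z mu @[mu --> 0] --> (0 : R) -> curvature_at F' a2 z mu @[mu --> 0] --> a2.
Proof.
move=> H z0; apply/cvgrPdist_le => e e0; have [d d0 Hd] := fam_2 H e0.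
move/cvgrPdist_lt : z0 => /(_ d d0).
have : \forall mu \near (0 : R), `|mu| < d.
  by apply/nbhs_ballP; exists d => // mu; rewrite /ball/= sub0r normrN.
apply: filterS2 => mu mud; rewrite sub0r normrN => zd.
rewrite /curvature_at; have [E|zn] := eqVneq (z mu) 0; first by rewrite subrr normr0 ltW.
rewrite distrC.
have -> : (F' mu (z mu) - F' mu 0) / z mu - a2 = (F' mu (z mu) - F' mu 0 - a2 * z mu) / z mu.
  by field.
by rewrite normrM normfV ler_pdivrMr ?normr_gt0// Hd.
Qed.

Lemma cvg_fun_neq0 (F : R -> R) (l : R) : F mu @[mu --> 0] --> l -> l != 0 ->
  \forall mu \near (0 : R), F mu != 0.
Proof.
move=> Fl l0; have ln : 0 < `|l| by rewrite normr_gt0.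
move/cvgrPdist_lt : Fl => /(_ _ ln); apply: filterS => mu.
by apply: contraTneq => ->; rewrite subr0 ltxx.
Qed.

Section ParameterFormulas.
Variables (eps K aL aR a2L a2R beta r : R) (nu : R -> R) (A A' B B' : R -> R -> R).
Hypothesis S : setting eps K aL aR a2L a2R beta r nu A A' B B'.
Local Notation al := (- aL - eps).
Local Notation al' := (- aL + eps).
Local Notation ga := (- aR - eps).
Local Notation ga' := (- aR + eps).

Lemma setting_consts : [/\ 0 < eps, aL < 0, aR < -1, 0 < 1 - aL * aR & 0 <= K].
Proof.
have bc := setting_bcmap S 0; have [[h1 h2 h3] [h4 h5 h6 h7]] := bc_consts bc.
have e0 := set_eps S; split; [exact e0|lra|lra| |exact: C11_K_ge0 (bcA bc)].
have : (- aL) * (- aR) <= al' * ga' by apply: ler_pM; lra.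
by lra.
Qed.

Lemma fixed_point_functions : exists xL uL xR : R -> R,
  [/\ forall mu, A mu (xL mu) = xL mu, forall mu, B mu (A mu (uL mu)) = uL mu
    & forall mu, B mu (xR mu) = xR mu] /\
  [/\ continuous xL, continuous uL & continuous xR].
Proof.
have bc := setting_bcmap S.
have [xL HxL] := choice (fun mu => A_fix (bc mu)).
have [uL HuL] := choice (fun mu => BA_fix (bc mu)).
have [xR HxR] := choice (fun mu => B_fix (bc mu)).
exists xL, uL, xR; split=> //; split.
- apply: (zero_continuous (E := fun mu x => A mu x - x) (m := 1)) => //.
  + move=> mu x y; rewrite mul1r.
    have W a b : a <= b -> `|a - b| <= `|A mu a - a - (A mu b - b)|.
      move=> ab; have := A_slope (bc mu) ab => /andP[h _].
      have q : 0 <= al * (b - a).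
        by have [[? _ _] _] := bc_consts (bc mu); apply: mulr_ge0; lra.
      rewrite distrC (ger0_norm (_ : 0 <= b - a)) ?subr_ge0//.
      by apply: le_trans (ler_norm _); lra.
    have [/W//|/ltW/W] := leP x y; by rewrite distrC [in X in _ <= X -> _]distrC.
  + by move=> mu; rewrite HxL subrr.
  + by move=> x mu; apply: cvgB; [exact: fam_cont (set_A S) x mu|exact: cvg_cst].
- have th1 : 0 < 1 - al' * ga'.
    by have [_ [_ _ _ h]] := bc_consts (bc 0); rewrite subr_gt0.
  apply: (zero_continuous (E := fun mu x => B mu (A mu x) - x) th1) => //.
  + move=> mu x y; have := BA_lip (bc mu) x y.
    have -> : B mu (A mu x) - x - (B mu (A mu y) - y) =
      - ((x - y) - (B mu (A mu x) - B mu (A mu y))) by ring.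
    rewrite normrN => h; apply: (@le_trans _ _ (`|x - y| - `|B mu (A mu x) - B mu (A mu y)|)).
      by lra.
    exact: lerB_dist.
  + by move=> mu; rewrite HuL subrr.
  + move=> x mu; apply: cvgB; last exact: cvg_cst.
    apply: (param_comp_continuous (L := ga')).
    * by move=> mu' a b; exact: B_lip (bc mu') a b.
    * exact: fam_cont (set_B S).
    * exact: fam_cont (set_A S) x.
- apply: (zero_continuous (E := fun mu x => B mu x - x) (m := 1)) => //.
  + move=> mu x y; rewrite mul1r.
    have W a b : a <= b -> `|a - b| <= `|B mu a - a - (B mu b - b)|.
      move=> ab; have := B_slope (bc mu) ab => /andP[h _].
      have q : 0 <= ga * (b - a).
        by have [_ [? _ _ _]] := bc_consts (bc mu); apply: mulr_ge0; lra.
      rewrite distrC (ger0_norm (_ : 0 <= b - a)) ?subr_ge0//.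
      by apply: le_trans (ler_norm _); lra.
    have [/W//|/ltW/W] := leP x y; by rewrite distrC [in X in _ <= X -> _]distrC.
  + by move=> mu; rewrite HxR subrr.
  + by move=> x mu; apply: cvgB; [exact: fam_cont (set_B S) x mu|exact: cvg_cst].
Qed.

Variables (xL uL xR : R -> R).
Hypotheses (xLE : forall mu, A mu (xL mu) = xL mu)
  (uLE : forall mu, B mu (A mu (uL mu)) = uL mu)
  (xRE : forall mu, B mu (xR mu) = xR mu).
Hypotheses (xLc : continuous xL) (uLc : continuous uL) (xRc : continuous xR).

(* For mu > 0 the parameters solve three equations: sR is the multiplier of the fixed
   point, sL / sR is the ratio of the slopes of f at the kink, and the multipliers of
   the two-cycles agree.  posX is the value of t v, where v < 0 belongs to the
   two-cycle of the normal form. *)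
Definition posR mu := B' mu (xR mu).
Definition posL mu := posR mu * (A' mu 0 / B' mu 0).
Definition posX mu := (A' mu (uL mu) * B' mu (A mu (uL mu)) / posR mu - posL mu) / 2.
(** With t v = [posX], the equation v = nu + sR (nu + sL v + t v^2) of the two-cycle is linear in v;
    this is [posX] divided by its solution. *)
Definition posT mu := posX mu * (1 - posR mu * (posL mu + posX mu)) / (nu mu * (1 + posR mu)).

Lemma fixed_points_at0 : [/\ xL 0 = 0, uL 0 = 0 & xR 0 = 0].
Proof.
have bc := setting_bcmap S 0; have A0 := bcA0 bc; have B0 := bcB0 bc.
rewrite (nu0 S) in A0 B0; have [_ [_ _ _ th1]] := bc_consts bc.
split.
- by have := A_fix_norm bc (xLE 0); rewrite (nu0 S) normr0 => /andP[]; rewrite normr_le0 => /eqP.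
- have := BA_lip bc (uL 0) 0; rewrite uLE A0 B0 subr0 => h.
  apply/eqP; rewrite -normr_le0 -(@pmulr_rle0 _ (1 - al' * ga')) ?subr_gt0//; lra.
- have := pw_fix_uniq bc (x := xR 0) (y := 0).
  have [x0|x0] := leP 0 (xR 0).
    by rewrite (pw_ge0 bc x0) xRE (pw0 bc) (nu0 S); apply.
  have := B_slope bc (ltW x0); rewrite xRE B0 => /andP[h _].
  have : 0 <= ga * (0 - xR 0).
    by rewrite mulr_ge0//; have [_ [? _ _ _]] := bc_consts bc; lra.
  by move=> ? _; lra.
Qed.

(** Both [posX] and [v] vanish at mu = 0, to first order in [nu]. Written with divided differences,
    [posX] is [nu] times a convergent factor, and [nu] cancels. *)
Lemma posT_cvg : exists t0 : R, posT @ (0 : R)^' --> t0.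
Proof.
have [x0 u0 xr0] := fixed_points_at0.
have [e0 aL0 aR1 d0 K0] := setting_consts.
have FA := set_A S; have FB := set_B S.
have nuc : nu mu @[mu --> 0] --> (0 : R) by rewrite -{2}(nu0 S); exact: (nu_continuous S).
have cu : uL mu @[mu --> 0] --> (0 : R) by rewrite -{2}u0; exact: uLc.
have cx : xR mu @[mu --> 0] --> (0 : R) by rewrite -{2}xr0; exact: xRc.
have A00 : A 0 0 = 0 by rewrite (fam0 FA) (nu0 S).
pose w mu := A mu (uL mu).
have bc := setting_bcmap S.
have cw : w mu @[mu --> 0] --> (0 : R).
  have E : A 0 (uL 0) = 0 by rewrite u0.
  rewrite -{2}E; apply: (param_comp_continuous (L := al')) => //; last exact: fam_cont FA.
  by move=> mu; exact: A_lip (bc mu).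
pose p := slope_at A A' uL; pose q := slope_at B B' w; pose q' := slope_at B B' xR.
have cp : p mu @[mu --> 0] --> aL by exact: slope_at_cvg FA cu.
have cq : q mu @[mu --> 0] --> aR by exact: slope_at_cvg FB cw.
have cq' : q' mu @[mu --> 0] --> aR by exact: slope_at_cvg FB cx.
pose c1 := curvature_at A' a2L uL; pose c2 := curvature_at B' a2R w.
pose c3 := curvature_at B' a2R xR.
have cc1 : c1 mu @[mu --> 0] --> a2L by exact: curvature_at_cvg FA cu.
have cc2 : c2 mu @[mu --> 0] --> a2R by exact: curvature_at_cvg FB cw.
have cc3 : c3 mu @[mu --> 0] --> a2R by exact: curvature_at_cvg FB cx.
have cA := family_cvg0 FA; have cB := family_cvg0 FB.
have d0' : 1 - aL * aR != 0 by rewrite gt_eqF.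
have d1 : 1 - aR != 0 by rewrite gt_eqF//; lra.
have cm (f h : R -> R) (a b : R) : f mu @[mu --> 0] --> a -> h mu @[mu --> 0] --> b ->
    f mu * h mu @[mu --> 0] --> a * b by exact: cvgM.
have cd (f h : R -> R) (a b : R) : f mu @[mu --> 0] --> a -> h mu @[mu --> 0] --> b ->
    f mu + h mu @[mu --> 0] --> a + b by exact: cvgD.
have cb (f h : R -> R) (a b : R) : f mu @[mu --> 0] --> a -> h mu @[mu --> 0] --> b ->
    f mu - h mu @[mu --> 0] --> a - b by exact: cvgB.
have ci (f : R -> R) (a : R) : a != 0 -> f mu @[mu --> 0] --> a -> (f mu)^-1 @[mu --> 0] --> a^-1.
  by move=> a0 fa; exact: cvgV.
have ck (a : R) : (fun _ : R => a) mu @[mu --> 0] --> a by exact: cvg_cst.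
pose dd mu := 1 - p mu * q mu; pose dx mu := 1 - q' mu.
have cdd : dd mu @[mu --> 0] --> 1 - aL * aR.
  exact: cb _ _ _ _ (ck 1) (cm _ _ _ _ cp cq).
have cdx : dx mu @[mu --> 0] --> 1 - aR := cb _ _ _ _ (ck 1) cq'.
(* In terms of divided differences the equations of the two-cycle and of the fixed point are linear;
   U, W and X are their solutions divided by [nu]. *)
pose U mu := (1 + q mu) / dd mu; pose W mu := 1 + p mu * U mu; pose X mu := (dx mu)^-1.
have cU : U mu @[mu --> 0] --> (1 + aR) / (1 - aL * aR).
  exact: cm _ _ _ _ (cd _ _ _ _ (ck 1) cq) (ci _ _ d0' cdd).
have cW : W mu @[mu --> 0] --> 1 + aL * ((1 + aR) / (1 - aL * aR)).
  exact: cd _ _ _ _ (ck 1) (cm _ _ _ _ cp cU).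
have cX : X mu @[mu --> 0] --> (1 - aR)^-1 := ci _ _ d1 cdx.
have csR : posR mu @[mu --> 0] --> aR.
  have E : B' 0 (xR 0) = aR by rewrite xr0 (family_slope0 FB).
  rewrite -E; apply: (param_comp_continuous (L := K)) => //; last exact: fam_cont' FB.
  by move=> mu; exact: (fam_C11 FB mu).2.
pose A0 mu := A' mu 0; pose B0 mu := B' mu 0.
(* The numerator of [posX] is A'(u) B'(w) B0 - posR^2 A0. Expanding each derivative about 0 cancels
   A0 B0^2, and every remaining term contains u, w or xR. *)
pose Q mu := (c1 mu * U mu * ((B0 mu + c2 mu * w mu) * B0 mu) + A0 mu * B0 mu * (c2 mu * W mu)
  - c3 mu * X mu * ((2 * B0 mu + c3 mu * xR mu) * A0 mu)) / (2 * (posR mu * B0 mu)).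
have aR0 : aR != 0 by rewrite lt_eqF//; lra.
have n2R : 2 * (aR * aR) != 0 by rewrite mulf_neq0// mulf_neq0.
have c2R := cm _ _ _ _ (ck 2) (cm _ _ _ _ csR cB).
have cQ1 := cm _ _ _ _ (cm _ _ _ _ cc1 cU) (cm _ _ _ _ (cd _ _ _ _ cB (cm _ _ _ _ cc2 cw)) cB).
have cQ2 := cm _ _ _ _ (cm _ _ _ _ cA cB) (cm _ _ _ _ cc2 cW).
have cQ3 := cm _ _ _ _ (cm _ _ _ _ cc3 cX)
  (cm _ _ _ _ (cd _ _ _ _ (cm _ _ _ _ (ck 2) cB) (cm _ _ _ _ cc3 cx)) cA).
have cQ := cm _ _ _ _ (cb _ _ _ _ (cd _ _ _ _ cQ1 cQ2) cQ3) (ci _ _ n2R c2R).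
move: cQ; set l := (X in _ --> X); clearbody l => cQ.
have {}cQ : Q mu @[mu --> 0] --> l by exact: cQ.
clear c2R cQ1 cQ2 cQ3.
have csL : posL mu @[mu --> 0] --> aR * (aL / aR).
  exact: cm _ _ _ _ csR (cm _ _ _ _ cA (ci _ _ aR0 cB)).
have key : \forall mu \near (0 : R), posX mu = nu mu * Q mu.
  have n1 := cvg_fun_neq0 cdd d0'; have n2 := cvg_fun_neq0 cdx d1.
  apply: filterS2 n1 n2 => mu n1 n2.
  have B0n : B' mu 0 != 0.
    by have := bcB' (bc mu) 0; have [_ [? _ _ _]] := bc_consts (bc mu); move=> ?; rewrite lt_eqF//; lra.
  have sRn : posR mu != 0.
    by have := bcB' (bc mu) (xR mu); have [_ [? _ _ _]] := bc_consts (bc mu); rewrite /posR => ?; rewrite lt_eqF//; lra.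
  have Ew : w mu = nu mu + p mu * uL mu by rewrite /w (slope_atE A A') (fam0 FA).
  have Eu : uL mu = nu mu + q mu * w mu by rewrite -{1}uLE (slope_atE B B' w) (fam0 FB).
  have Ex : xR mu = nu mu + q' mu * xR mu by rewrite -{1}xRE (slope_atE B B') (fam0 FB).
  have Eu2 : uL mu = nu mu * U mu.
    apply: (mulIf n1); rewrite /U -[RHS]mulrA divfK//.
    by rewrite /dd mulrBr mulr1 {1}Eu Ew; ring.
  have Ew2 : w mu = nu mu * W mu by rewrite Ew Eu2 /W; ring.
  have Ex2 : xR mu = nu mu * X mu.
    by apply: (mulIf n2); rewrite /X mulfVK// /dx mulrBr mulr1 {1}Ex; ring.
  have EA : A' mu (uL mu) = A0 mu + c1 mu * uL mu by exact: curvature_atE.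
  have EB : B' mu (w mu) = B0 mu + c2 mu * w mu by exact: curvature_atE.
  have ER : posR mu = B0 mu + c3 mu * xR mu by exact: curvature_atE.
  have -> : posX mu = (A' mu (uL mu) * B' mu (w mu) * B0 mu - posR mu * posR mu * A0 mu)
     / (2 * (posR mu * B0 mu)).
    by rewrite /posX /posL /w /A0 /B0; field; rewrite sRn B0n.
  rewrite /Q [RHS]mulrA; congr (_ / _); rewrite EA EB ER.
  move: (c1 mu) (c2 mu) (c3 mu) (A0 mu) (B0 mu) (U mu) (W mu) (X mu) Eu2 Ew2 Ex2.
  move: (uL mu) (w mu) (xR mu) (nu mu) => u w' x n k1 k2 k3 a b u' w'' x' -> -> ->.
  by ring.
have cX2 : posX mu @[mu --> 0] --> 0 * l.
  by have := cm _ _ _ _ nuc cQ; apply: cvg_trans; apply: near_eq_cvg; apply: filterS key.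
exists (l * (1 - aR * (aR * (aL / aR) + 0 * l)) / (1 + aR)).
pose T mu := Q mu * (1 - posR mu * (posL mu + posX mu)) / (1 + posR mu).
have aR1' : 1 + aR != 0 by rewrite lt_eqF//; lra.
have cT : T mu @[mu --> 0] --> l * (1 - aR * (aR * (aL / aR) + 0 * l)) / (1 + aR).
  have cD := cb _ _ _ _ (ck 1) (cm _ _ _ _ csR (cd _ _ _ _ csL cX2)).
  exact: cm _ _ _ _ (cm _ _ _ _ cQ cD) (ci _ _ aR1' (cd _ _ _ _ (ck 1) csR)).
have cT' : T @ (0 : R)^' --> l * (1 - aR * (aR * (aL / aR) + 0 * l)) / (1 + aR).
  by apply: cvg_trans cT; apply: cvg_app; exact: nbhs_dnbhs.
apply: cvg_trans cT'; apply: near_eq_cvg; rewrite near_withinE.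
have nr : \forall mu \near (0 : R), `|mu| <= r.
  by apply/nbhs_ballP; exists r; [exact: set_r S|move=> mu; rewrite /ball/= sub0r normrN; exact: ltW].
apply: filterS2 key nr => mu E mr m0.
have nn : nu mu != 0.
  have [s1 s2] := nu_sign S mr; apply: contra_neq m0 => n0; rewrite n0 !ltxx in s1 s2.
  by apply/eqP; rewrite eq_le !leNgt -s1 -s2.
have sR1 : 1 + posR mu != 0.
  by have := bcB' (bc mu) (xR mu); have [_ [? _ _ _]] := bc_consts (bc mu); rewrite /posR => ?; rewrite lt_eqF//; lra.
by rewrite /T /posT E; field; rewrite nn sR1.
Qed.

End ParameterFormulas.
End ParameterLimits.

(** * Continuity of the parameters and verification of the matching equations *)

Section NormalFormParameters.
Variable R : realType.
Implicit Types (mu x y : R).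

Section Continuity.
Implicit Types (f g : R -> R).

Lemma for_continuousM f g mu : continuous_at mu f -> continuous_at mu g ->
  continuous_at mu (fun mu => f mu * g mu).
Proof. by move=> fc gc; exact: continuousM. Qed.

Lemma for_continuousD f g mu : continuous_at mu f -> continuous_at mu g ->
  continuous_at mu (fun mu => f mu + g mu).
Proof. by move=> fc gc; exact: continuousD. Qed.

Lemma for_continuousB f g mu : continuous_at mu f -> continuous_at mu g ->
  continuous_at mu (fun mu => f mu - g mu).
Proof. by move=> fc gc; exact: continuousB. Qed.

Lemma for_continuousV f mu : f mu != 0 -> continuous_at mu f ->
  continuous_at mu (fun mu => (f mu)^-1).
Proof. by move=> f0 fc; exact: cvgV. Qed.

Lemma for_continuousC (a : R) mu : continuous_at mu (fun _ : R => a).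
Proof. exact: cvg_cst. Qed.

Lemma near0_le f (c e : R) : continuous_at 0 f -> f 0 = c -> 0 < e ->
  \forall mu \near (0 : R), `|f mu - c| <= e.
Proof.
move=> /cvgrPdist_le fc f0 e0; have := fc _ e0; apply: filterS => mu.
by rewrite f0 distrC.
Qed.

End Continuity.

Variables (eps K aL aR a2L a2R beta r : R) (nu : R -> R) (A A' B B' : R -> R -> R).
Hypothesis S : setting eps K aL aR a2L a2R beta r nu A A' B B'.
Local Notation al := (- aL - eps).
Local Notation al' := (- aL + eps).
Local Notation ga := (- aR - eps).
Local Notation ga' := (- aR + eps).

Lemma setting_A'_bound mu x : -1 <= A' mu x < 0 /\ A' mu x <= - al.
Proof.
have bc := setting_bcmap S mu; have [[h1 h2 h3] _] := bc_consts bc.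
by have := bcA' bc x; lra.
Qed.

Lemma setting_B'_bound mu x : B' mu x < -1 /\ - ga' <= B' mu x.
Proof.
have bc := setting_bcmap S mu; have [_ [h1 h2 _ _]] := bc_consts bc.
by have := bcB' bc x; lra.
Qed.

Lemma near_small : \forall mu \near (0 : R), `|mu| <= r.
Proof.
apply/nbhs_ballP; exists r; first exact: set_r S.
by move=> mu; rewrite /ball/= sub0r normrN; exact: ltW.
Qed.

Variables (xL uL xR : R -> R) (t0 : R).
Hypotheses (xLE : forall mu, A mu (xL mu) = xL mu)
  (uLE : forall mu, B mu (A mu (uL mu)) = uL mu)
  (xRE : forall mu, B mu (xR mu) = xR mu).
Hypotheses (xLc : continuous xL) (uLc : continuous uL) (xRc : continuous xR).
Local Notation pR := (posR B' xR).
Local Notation pL := (posL A' B' xR).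
Local Notation pX := (posX A A' B' uL xR).
Local Notation pT := (posT nu A A' B' uL xR).

(* For mu <= 0 there are only two equations, the ratio of the slopes at the kink and
   the multiplier of the fixed point y.  The free parameter is adjusted so that t tends
   to the limit t0 of posT; negX is the value of t y. *)
Definition negX mu := t0 * nu mu / (1 - A' mu (xL mu)).
Definition negL mu := A' mu (xL mu) - 2 * negX mu.
Definition negR mu := negL mu * (B' mu 0 / A' mu 0).
(** With t y = X and multiplier a = sL + 2 X, the fixed-point equation becomes y (1 - a + X) = nu.
    Then t = X (1 - a + X) / nu, and the choice of [negX] cancels [nu]. *)
Definition negT mu := t0 * (1 - A' mu (xL mu) + negX mu) / (1 - A' mu (xL mu)).
Definition negY mu := nu mu / (1 - A' mu (xL mu) + negX mu).
Definition posV mu := nu mu * (1 + pR mu) / (1 - pR mu * (pL mu + pX mu)).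

Lemma deriv_comp_continuous (a2 b : R) F F' (z : R -> R) : family eps K b a2 nu F F' ->
  continuous z -> continuous (fun mu => F' mu (z mu)).
Proof.
move=> H zc; apply: (param_comp_continuous (L := K)) => //; last exact: fam_cont' H.
by move=> mu; exact: (fam_C11 H mu).2.
Qed.

Lemma uR_continuous : continuous (fun mu => A mu (uL mu)).
Proof.
apply: (param_comp_continuous (L := al')) => //; last exact: fam_cont (set_A S).
by move=> mu; exact: A_lip (setting_bcmap S mu).
Qed.

Lemma A'0_continuous : continuous (fun mu => A' mu 0).
Proof. by apply: (deriv_comp_continuous (z := fun _ => 0) (set_A S)) => mu; exact: cvg_cst. Qed.

Lemma B'0_continuous : continuous (fun mu => B' mu 0).
Proof. by apply: (deriv_comp_continuous (z := fun _ => 0) (set_B S)) => mu; exact: cvg_cst. Qed.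

Lemma one_subA'_neq0 mu x : 1 - A' mu x != 0.
Proof. by have [h _] := setting_A'_bound mu x; rewrite gt_eqF//; lra. Qed.

Lemma A'_neq0 mu x : A' mu x != 0.
Proof. by have [h _] := setting_A'_bound mu x; rewrite lt_eqF//; lra. Qed.

Lemma B'_neq0 mu x : B' mu x != 0.
Proof. by have [h _] := setting_B'_bound mu x; rewrite lt_eqF//; lra. Qed.

Lemma one_addB'_neq0 mu x : 1 + B' mu x != 0.
Proof. by have [h _] := setting_B'_bound mu x; rewrite lt_eqF//; lra. Qed.

Lemma negX_continuous : continuous negX.
Proof.
rewrite /negX => mu; apply: for_continuousM.
  by apply: for_continuousM; [exact: for_continuousC|exact: (nu_continuous S)].
apply: for_continuousV; first exact: one_subA'_neq0.
apply: for_continuousB; first exact: for_continuousC.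
exact: (deriv_comp_continuous (set_A S) xLc).
Qed.

Lemma negD_continuous : continuous (fun mu => 1 - A' mu (xL mu) + negX mu).
Proof.
move=> mu; apply: for_continuousD; last exact: negX_continuous.
apply: for_continuousB; first exact: for_continuousC.
exact: (deriv_comp_continuous (set_A S) xLc).
Qed.

Lemma negL_continuous : continuous negL.
Proof.
rewrite /negL => mu; apply: for_continuousB; first exact: (deriv_comp_continuous (set_A S) xLc).
by apply: for_continuousM; [exact: for_continuousC|exact: negX_continuous].
Qed.

Lemma negR_continuous : continuous negR.
Proof.
rewrite /negR => mu; apply: for_continuousM; first exact: negL_continuous.
apply: for_continuousM; first exact: B'0_continuous.
by apply: for_continuousV; [exact: A'_neq0|exact: A'0_continuous].
Qed.

Lemma negT_continuous : continuous negT.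
Proof.
rewrite /negT => mu; apply: for_continuousM.
  by apply: for_continuousM; [exact: for_continuousC|exact: negD_continuous].
apply: for_continuousV; first exact: one_subA'_neq0.
apply: for_continuousB; first exact: for_continuousC.
exact: (deriv_comp_continuous (set_A S) xLc).
Qed.

Lemma posR_continuous : continuous pR.
Proof. exact: (deriv_comp_continuous (set_B S) xRc). Qed.

Lemma posL_continuous : continuous pL.
Proof.
rewrite /posL => mu; apply: for_continuousM; first exact: posR_continuous.
apply: for_continuousM; first exact: A'0_continuous.
by apply: for_continuousV; [exact: B'_neq0|exact: B'0_continuous].
Qed.

Lemma posX_continuous : continuous pX.
Proof.
rewrite /posX => mu; apply: for_continuousM; last exact: for_continuousC.
apply: for_continuousB; last exact: posL_continuous.
apply: for_continuousM; last first.
  by apply: for_continuousV; [exact: B'_neq0|exact: posR_continuous].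
apply: for_continuousM; first exact: (deriv_comp_continuous (set_A S) uLc).
exact: (deriv_comp_continuous (set_B S) uR_continuous).
Qed.

Lemma posD_continuous : continuous (fun mu => 1 - pR mu * (pL mu + pX mu)).
Proof.
move=> mu; apply: for_continuousB; first exact: for_continuousC.
apply: for_continuousM; first exact: posR_continuous.
by apply: for_continuousD; [exact: posL_continuous|exact: posX_continuous].
Qed.

Lemma posT_continuous mu : nu mu != 0 -> continuous_at mu pT.
Proof.
move=> nn; rewrite /posT; apply: for_continuousM.
  by apply: for_continuousM; [exact: posX_continuous|exact: posD_continuous].
apply: for_continuousV; first by rewrite mulf_neq0// one_addB'_neq0.
apply: for_continuousM; first exact: (nu_continuous S).
by apply: for_continuousD; [exact: for_continuousC|exact: posR_continuous].
Qed.

(** The formulas for the two signs of mu agree at 0, which makes the glued s_L and s_R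
    continuous. *)
Lemma values_at0 : [/\ negX 0 = 0, negL 0 = aL, negR 0 = aR, negT 0 = t0 &
  [/\ pR 0 = aR, pL 0 = aL & pX 0 = 0]].
Proof.
have [x0 u0 xr0] := fixed_points_at0 S xLE uLE xRE.
have a0 := family_slope0 (set_A S); have b0 := family_slope0 (set_B S).
have n0 := nu0 S.
have an : aL != 0 by rewrite -a0 A'_neq0.
have bn : aR != 0 by rewrite -b0 B'_neq0.
have a1 : 1 - aL != 0 by rewrite -a0 one_subA'_neq0.
have X0 : negX 0 = 0 by rewrite /negX n0 mulr0 mul0r.
have L0 : negL 0 = aL by rewrite /negL X0 x0 a0 mulr0 subr0.
have pR : pR 0 = aR by rewrite /posR xr0.
have pL : pL 0 = aL by rewrite /posL pR a0 b0; field.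
split=> //.
- by rewrite /negR L0 a0 b0; field.
- by rewrite /negT X0 x0 a0; field.
- split=> //; rewrite /posX pR pL u0 (fam0 (set_A S)) n0 a0 b0; by field.
Qed.

Lemma negD_neq0 : \forall mu \near (0 : R), 1 - A' mu (xL mu) + negX mu != 0.
Proof.
have [X0 _ _ _ _] := values_at0.
have := near0_le (negX_continuous (x := 0)) X0 (ltr0Sn _ 0 : (0 : R) < 1).
apply: filterS => mu; rewrite subr0 ler_norml => h.
by have [? _] := setting_A'_bound mu (xL mu); rewrite gt_eqF//; lra.
Qed.

Lemma posD_neq0 : \forall mu \near (0 : R), 1 - pR mu * (pL mu + pX mu) != 0.
Proof.
have [_ _ _ _ [R0 L0 X0]] := values_at0.
apply: (cvg_fun_neq0 (posD_continuous (x := 0))).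
by have [_ _ _ h _] := setting_consts S; rewrite R0 L0 X0 addr0 mulrC gt_eqF.
Qed.

Lemma negY_small rho : 0 < rho -> \forall mu \near (0 : R), `|negY mu| <= rho.
Proof.
move=> rho0; have c : continuous_at 0 negY.
  rewrite /negY; apply: for_continuousM; first exact: (nu_continuous S).
  by apply: for_continuousV; [exact: nbhs_singleton negD_neq0|exact: negD_continuous].
have Y0 : negY 0 = 0 by rewrite /negY (nu0 S) mul0r.
by have := near0_le c Y0 rho0; apply: filterS => mu; rewrite subr0.
Qed.

Lemma posV_small rho : 0 < rho -> \forall mu \near (0 : R), `|posV mu| <= rho.
Proof.
move=> rho0; have c : continuous_at 0 posV.
  rewrite /posV; apply: for_continuousM.
    apply: for_continuousM; first exact: (nu_continuous S).
    by apply: for_continuousD; [exact: for_continuousC|exact: posR_continuous].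
  by apply: for_continuousV; [exact: nbhs_singleton posD_neq0|exact: posD_continuous].
have Y0 : posV 0 = 0 by rewrite /posV (nu0 S) !mul0r.
by have := near0_le c Y0 rho0; apply: filterS => mu; rewrite subr0.
Qed.

Lemma neg_solution mu : 1 - A' mu (xL mu) + negX mu != 0 ->
  [/\ nu mu + negL mu * negY mu + negT mu * negY mu ^+ 2 = negY mu
    & A' mu (xL mu) = negL mu + 2 * negT mu * negY mu].
Proof.
move=> dn; have n1 := one_subA'_neq0 mu (xL mu).
have E : negT mu * negY mu = negX mu.
  move: dn; rewrite /negT /negY; set d := 1 - _ + _; clearbody d => dn.
  by rewrite /negX; field; rewrite dn n1.
split; last by rewrite -mulrA E /negL; ring.
rewrite expr2 mulrA E -addrA -mulrDl.
apply/eqP; rewrite -subr_eq0; apply/eqP.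
have -> : nu mu + (negL mu + negX mu) * negY mu - negY mu =
  nu mu - (1 - A' mu (xL mu) + negX mu) * negY mu by rewrite /negL; ring.
by rewrite /negY mulrC divfK// subrr.
Qed.

Lemma pos_solution mu : nu mu != 0 -> 1 - pR mu * (pL mu + pX mu) != 0 ->
  [/\ nu mu + pR mu * (nu mu + pL mu * posV mu + pT mu * posV mu ^+ 2) = posV mu
    & B' mu (A mu (uL mu)) * A' mu (uL mu) = pR mu * (pL mu + 2 * pT mu * posV mu)].
Proof.
move=> nn dn; have n1 := one_addB'_neq0 mu (xR mu); rewrite -/(posR B' xR mu) in n1.
have E : pT mu * posV mu = pX mu.
  move: dn; rewrite /posT /posV; set d := 1 - _ * _; clearbody d => dn.
  by field; rewrite n1 nn dn.
have rn : pR mu != 0 by exact: B'_neq0.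
split; last first.
  by rewrite -mulrA E /posX; field.
rewrite expr2 mulrA E -addrA -mulrDl.
apply/eqP; rewrite -subr_eq0; apply/eqP.
have -> : nu mu + pR mu * (nu mu + (pL mu + pX mu) * posV mu) - posV mu =
  nu mu * (1 + pR mu) - (1 - pR mu * (pL mu + pX mu)) * posV mu by ring.
by rewrite /posV mulrC [X in _ - X]mulrC divfK// subrr.
Qed.

End NormalFormParameters.

Section ParameterExistence.
Variable R : realType.
Implicit Types (mu x y : R).
Variables (eps K aL aR a2L a2R beta r : R) (nu : R -> R) (A A' B B' : R -> R -> R).
Hypothesis S : setting eps K aL aR a2L a2R beta r nu A A' B B'.
Local Notation al := (- aL - eps).
Local Notation ga' := (- aR + eps).

Lemma cvg_dnbhs (f : R -> R) x : continuous_at x f -> f @ x^' --> f x.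
Proof. by apply: cvg_trans; apply: cvg_app; exact: nbhs_dnbhs. Qed.

Section Bounds.
Variables (xL uL xR : R -> R) (t0 : R).
Hypotheses (xLE : forall mu, A mu (xL mu) = xL mu) (xRE : forall mu, B mu (xR mu) = xR mu).

Lemma derivative_bound (F F' : R -> R -> R) (a a2 z : R) mu : family eps K a a2 nu F F' ->
  `|mu| <= r -> `|z| <= `|nu mu| ->
  [/\ `|F' mu z - F' mu 0| <= 2 * beta * K * `|mu|, `|F' mu 0 - a| <= K * `|mu|
    & `|F' mu z - a| <= (2 * beta * K + K) * `|mu|].
Proof.
move=> H mr zn; have /andP[_ n2] := nu_bounds S mr; have [_ _ _ _ K0] := setting_consts S.
have h1 : `|F' mu z - F' mu 0| <= 2 * beta * K * `|mu|.
  have := (fam_C11 H mu).2 z 0; rewrite subr0 => /le_trans; apply.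
  have -> : 2 * beta * K * `|mu| = K * (2 * beta * `|mu|) by ring.
  by rewrite ler_wpM2l// (le_trans zn).
have h2 := fam_a H mu; split=> //.
have -> : F' mu z - a = (F' mu z - F' mu 0) + (F' mu 0 - a) by ring.
by rewrite (le_trans (ler_normD _ _))// mulrDl lerD.
Qed.

Lemma neg_bound : exists2 C, 0 <= C & forall mu, `|mu| <= r ->
  `|negL nu A' xL t0 mu - aL| <= C * `|mu| /\ `|negR nu A' B' xL t0 mu - aR| <= C * `|mu|.
Proof.
have [_ _ _ _ K0] := setting_consts S; have b0 := set_beta S.
pose C1 := 2 * beta * K + K + 4 * beta * `|t0|.
pose q := ga' / al.
have bc := setting_bcmap S; have [[al0 _ _] [ga1 ga2 _ _]] := bc_consts (bc 0).
have q0 : 0 <= q by rewrite divr_ge0//; lra.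
have C10 : 0 <= C1.
  by rewrite /C1 !addr_ge0// !mulr_ge0// ltW// mulr_gt0.
have qCK : 0 <= q * (C1 + K) by rewrite mulr_ge0// addr_ge0.
have qCK' := addr_ge0 qCK K0.
exists (q * (C1 + K) + K + C1); first exact: addr_ge0 qCK' C10.
move=> mu mr; have /andP[_ xn] := A_fix_norm (bc mu) (xLE mu).
have xn' : `|xL mu| <= `|nu mu| by have /andP[] := A_fix_norm (bc mu) (xLE mu).
have /andP[_ n2] := nu_bounds S mr.
have [h1 h2 h3] := derivative_bound (set_A S) mr xn'.
have [_ g2 _] := derivative_bound (z := 0) (set_B S) mr (ltac:(by rewrite normr0)).
have [/andP[_ a1] a2] := setting_A'_bound S mu (xL mu).
have X : `|negX nu A' xL t0 mu| <= 2 * beta * `|t0| * `|mu|.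
  rewrite /negX normrM normfV ler_pdivrMr; last by rewrite normr_gt0 (one_subA'_neq0 S).
  have m1 : 1 <= `|1 - A' mu (xL mu)| by rewrite ger0_norm; lra.
  have t1 : `|t0 * nu mu| <= 2 * beta * `|t0| * `|mu|.
    have -> : 2 * beta * `|t0| * `|mu| = `|t0| * (2 * beta * `|mu|) by ring.
    by rewrite normrM ler_wpM2l.
  by rewrite (le_trans t1)// ler_peMr// (le_trans _ t1).
have L : `|negL nu A' xL t0 mu - aL| <= C1 * `|mu|.
  have -> : negL nu A' xL t0 mu - aL = (A' mu (xL mu) - aL) - 2 * negX nu A' xL t0 mu.
    by rewrite /negL; ring.
  rewrite (le_trans (ler_normB _ _))// normrM (ger0_norm (_ : 0 <= 2))// /C1; lra.
have mu0 := normr_ge0 mu; have q1 : 0 <= (q * (C1 + K) + K) * `|mu|.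
  by rewrite mulr_ge0.
split; first by rewrite mulrDl; lra.
have -> : negR nu A' B' xL t0 mu - aR =
    (negL nu A' xL t0 mu - A' mu 0) * (B' mu 0 / A' mu 0) + (B' mu 0 - aR).
  by rewrite /negR; field; exact: (A'_neq0 S).
have q2 : `|B' mu 0 / A' mu 0| <= q.
  have := normB' (bc mu) 0; have /andP[c1 _] := bcA' (bc mu) 0 => c2.
  rewrite normrM normfV; apply: ler_pM => //.
  by rewrite lef_pV2 ?posrE// ?normr_gt0 ?(A'_neq0 S)// (le_trans c1)// -normrN ler_norm.
have L2 : `|negL nu A' xL t0 mu - A' mu 0| <= (C1 + K) * `|mu|.
  have -> : negL nu A' xL t0 mu - A' mu 0 = (negL nu A' xL t0 mu - aL) - (A' mu 0 - aL) by ring.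
  by rewrite (le_trans (ler_normB _ _))// mulrDl lerD.
rewrite (le_trans (ler_normD _ _))// normrM.
have := ler_pM (normr_ge0 _) (normr_ge0 _) L2 q2.
have : 0 <= C1 * `|mu| by rewrite mulr_ge0.
have -> : (q * (C1 + K) + K + C1) * `|mu| = (C1 + K) * `|mu| * q + K * `|mu| + C1 * `|mu| by ring.
by lra.
Qed.

Lemma pos_bound mu : `|mu| <= r -> 0 < mu ->
  `|posL A' B' xR mu - aL| <= (2 * beta * K + K) * `|mu| /\
  `|posR B' xR mu - aR| <= (2 * beta * K + K) * `|mu|.
Proof.
move=> mr mu0; have bc := setting_bcmap S mu.
have nn : 0 < nu mu by rewrite (nu_sign S mr).1.
have /andP[x0 xn] := B_fix_gt0 bc nn (xRE mu).
have xn' : `|xR mu| <= `|nu mu| by rewrite (gtr0_norm x0) (gtr0_norm nn) ltW.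
have [h1 h2 h3] := derivative_bound (set_B S) mr xn'.
have [_ g2 _] := derivative_bound (z := 0) (set_A S) mr (ltac:(by rewrite normr0)).
split=> //.
have -> : posL A' B' xR mu - aL =
    (B' mu (xR mu) - B' mu 0) * (A' mu 0 / B' mu 0) + (A' mu 0 - aL).
  by rewrite /posL /posR; field; exact: (B'_neq0 S).
rewrite (le_trans (ler_normD _ _))// [leRHS]mulrDl lerD// normrM (le_trans _ h1)//.
rewrite ler_piMr// normrM normfV ler_pdivrMr ?normr_gt0 ?(B'_neq0 S)// mul1r.
have [/andP[a1 a2] _] := setting_A'_bound S mu 0; have [b1 _] := setting_B'_bound S mu 0.
have b2 : B' mu 0 < 0 by lra.
by rewrite (ltr0_norm a2) (ltr0_norm b2); lra.
Qed.

End Bounds.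

(** [rho] bounds y and v because the quadratic branch is trusted only on that ball before it is
    extended affinely. [T] bounds t on both sides of mu = 0, since t tends to [t0] from either
    side. *)
Lemma parameters_exist : exists (sL sR t : R -> R) (C T : R),
  [/\ 0 <= C /\ 0 <= T,
    \forall mu \near (0 : R), [/\ {for mu, continuous sL}, {for mu, continuous sR}
      & {for mu, continuous t}],
    \forall mu \near (0 : R), [/\ `|sL mu - aL| <= C * `|mu|, `|sR mu - aR| <= C * `|mu|,
      `|t mu| <= T & A' mu 0 * sR mu = B' mu 0 * sL mu]
  & forall rho, 0 < rho -> \forall mu \near (0 : R),
    (mu <= 0 -> exists x y : R, [/\ A mu x = x, `|y| <= rho,
      nu mu + sL mu * y + t mu * y ^+ 2 = y & A' mu x = sL mu + 2 * t mu * y]) /\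
    (0 < mu -> exists u x v : R,
      [/\ B mu (A mu u) = u /\ B mu x = x, `|v| <= rho,
        nu mu + sR mu * (nu mu + sL mu * v + t mu * v ^+ 2) = v,
        B' mu (A mu u) * A' mu u = sR mu * (sL mu + 2 * t mu * v) & B' mu x = sR mu])].
Proof.
have [xL [uL [xR [[xLE uLE xRE] [xLc uLc xRc]]]]] := fixed_point_functions S.
have [t0 Ht0] := posT_cvg S xLE uLE xRE uLc xRc.
pose L1 := negL nu A' xL t0; pose R1 := negR nu A' B' xL t0; pose T1 := negT nu A' xL t0.
pose L2 := posL A' B' xR; pose R2 := posR B' xR; pose T2 := posT nu A A' B' uL xR.
have [X0 vL1 vR1 vT1 [vR2 vL2 _]] := values_at0 S t0 xLE uLE xRE.
have [C1 C10 HC1] := neg_bound t0 xLE.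
have [_ _ _ _ K0] := setting_consts S; have b0 := set_beta S.
have C2 : 0 <= 2 * beta * K + K by rewrite addr_ge0// mulr_ge0// mulr_ge0// ltW.
have nr := near_small S.
exists (fun mu => if mu <= 0 then L1 mu else L2 mu), (fun mu => if mu <= 0 then R1 mu else R2 mu),
  (fun mu => if mu <= 0 then T1 mu else T2 mu), (C1 + (2 * beta * K + K)), (`|t0| + 1).
split.
- by split; rewrite addr_ge0.
- apply: filterS nr => mu mr; split.
  + apply: glue_continuous => _; [exact: (negL_continuous S)|exact: (posL_continuous S)|].
    have -> : L1 0 = L2 0 by rewrite /L1 /L2 vL1.
    exact: cvg_dnbhs (posL_continuous S xRc (x := 0)).
  + apply: glue_continuous => _; [exact: (negR_continuous S)|exact: (posR_continuous S)|].
    have -> : R1 0 = R2 0 by rewrite /R1 /R2 vR1.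
    exact: cvg_dnbhs (posR_continuous S xRc (x := 0)).
  + apply: glue_continuous; [move=> _; exact: (negT_continuous S)|move=> m0|move=> _].
      by apply: (posT_continuous S) => //; rewrite gt_eqF// (nu_sign S mr).1.
    by have -> : T1 0 = t0 by [].
- have Tn := near0_le (negT_continuous S xLc (t0 := t0) (x := 0)) vT1 ltr01.
  have Tp : \forall mu \near (0 : R), mu != 0 -> `|T2 mu - t0| <= 1.
    have : \forall mu \near (0 : R)^', `|T2 mu - t0| <= 1.
      by move/cvgrPdist_le : Ht0 => /(_ 1 ltr01); apply: filterS => mu; rewrite distrC.
    by rewrite near_withinE.
  apply: filterS3 nr Tn Tp => mu mr tn tp.
  have tt (s : R) : `|s - t0| <= 1 -> `|s| <= `|t0| + 1.
    by move=> h; have := ler_normD (s - t0) t0; rewrite subrK; lra.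
  have mu0 := normr_ge0 mu.
  have z1 := mulr_ge0 C10 mu0; have z2 := mulr_ge0 C2 mu0.
  have [m0|m0] := leP mu 0.
    have [c1 c2] := HC1 mu mr; split; [rewrite mulrDl; lra|rewrite mulrDl; lra|exact: tt|].
    by rewrite /R1 /negR /L1; field; exact: (A'_neq0 S).
  have [c1 c2] := pos_bound xRE mr m0; split; [rewrite mulrDl; lra|rewrite mulrDl; lra| |].
    by apply: tt; apply: tp; rewrite gt_eqF.
  by rewrite /R2 /L2 /posL; field; exact: (B'_neq0 S).
move=> rho rho0.
have y1 := negY_small S t0 xLE uLE xRE xLc rho0.
have y2 := posV_small S t0 xLE uLE xRE uLc xRc rho0.
have d1 := negD_neq0 S t0 xLE uLE xRE xLc.
have d2 := posD_neq0 S t0 xLE uLE xRE uLc xRc.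
have nrs : \forall mu \near (0 : R), `|mu| <= r /\ `|negY nu A' xL t0 mu| <= rho.
  by apply: filterS2 nr y1 => mu; split.
apply: filterS3 nrs d1 (filterI y2 d2) => mu [mr ym] dm [vm em]; split=> m0.
  rewrite m0; have [e1 e2] := neg_solution S dm.
  by exists (xL mu), (negY nu A' xL t0 mu); split=> //; rewrite xLE.
rewrite leNgt m0 /=.
have nn : nu mu != 0 by rewrite gt_eqF// (nu_sign S mr).1.
have [e1 e2] := pos_solution S nn em.
by exists (uL mu), (xR mu), (posV nu A A' B' uL xR mu); split=> //; rewrite uLE xRE.
Qed.

End ParameterExistence.

(** * Conjugacy with the normal form *)

Section Assembly.
Variable R : realType.
Implicit Types (mu x y : R).

Section NormalForm.
Variables (sL sR t rho : R).

Lemma normal_form_pw nu y : `|y| <= rho -> normal_form nu sL sR t y =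
  pw (ext rho (fun z => nu + sL * z + t * z ^+ 2) (fun z => sL + 2 * t * z))
     (fun z => nu + sR * z) y.
Proof.
by move=> yr; rewrite /normal_form /pw /ext (clamp_id yr) subrr mulr0 addr0.
Qed.

Lemma quadratic_branch_C11 (nu T : R) : 0 <= rho -> 0 <= T -> `|t| <= T ->
  C11 (4 * T) (ext rho (fun z => nu + sL * z + t * z ^+ 2) (fun z => sL + 2 * t * z))
    ((fun z => sL + 2 * t * z) \o clamp rho).
Proof.
move=> r0 T0 tT; have -> : 4 * T = 2 * (2 * T) by ring.
apply: ext_C11 => //; first by rewrite mulr_ge0.
- move=> x y _ _.
  have -> : nu + sL * y + t * y ^+ 2 - (nu + sL * x + t * x ^+ 2) - (sL + 2 * t * x) * (y - x) =
    t * (y - x) ^+ 2 by ring.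
  by rewrite normrM (ger0_norm (sqr_ge0 _)) ler_wpM2r ?sqr_ge0//; lra.
- move=> x y _ _; have -> : sL + 2 * t * x - (sL + 2 * t * y) = 2 * t * (x - y) by ring.
  by rewrite !normrM ger0_norm// ler_wpM2r// ler_wpM2l.
Qed.

(** On the ball of radius [rho] the slope of the quadratic branch departs from sL by at most 2 T
    rho, and beyond it the slope is frozen, so the normal form lies in the same class as f. *)
Lemma normal_form_compatible (al al' ga ga' K L nu T : R) (A A' B B' : R -> R) :
  bcmap al al' ga ga' K nu A A' B B' -> 0 <= rho -> 0 <= T -> `|t| <= T -> K <= L -> 4 * T <= L ->
  al <= - sL - 2 * T * rho -> - sL + 2 * T * rho <= al' -> ga <= - sR <= ga' ->
  `|sL - A' 0| <= L * `|nu| -> `|sR - B' 0| <= L * `|nu| ->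
  compatible al al' ga ga' L nu A A' B B'
    (ext rho (fun z => nu + sL * z + t * z ^+ 2) (fun z => sL + 2 * t * z))
    ((fun z => sL + 2 * t * z) \o clamp rho) (fun z => nu + sR * z) (fun=> sR).
Proof.
move=> bc r0 T0 tT KL TL lo hi sRb e1 e2.
have L0 : 0 <= L by apply: le_trans TL; rewrite mulr_ge0.
have [b1 cA cB bA bB a0 b0] := bc.
split=> //=; last by rewrite (clamp0 r0) mulr0 addr0.
- by split=> //; [exact: C11W KL _|exact: C11W KL _].
- split=> //.
  + exact: C11W TL (quadratic_branch_C11 _ _ _ _).
  + split=> x y.
      have -> : nu + sR * y - (nu + sR * x) - sR * (y - x) = 0 by ring.
      by rewrite normr0 mulr_ge0// sqr_ge0.
    by rewrite subrr normr0 mulr_ge0.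
  + move=> x /=; have h : `|t * clamp rho x| <= T * rho.
      by rewrite normrM; apply: ler_pM => //; exact: clamp_bound.
    by move: h; rewrite ler_norml; lra.
  + by rewrite /ext (clamp0 r0) subr0 !mulr0 expr2 mulr0 mulr0 !addr0.
  + by rewrite mulr0 addr0.
Qed.

End NormalForm.

Section OneParameter.
Variables (al al' ga ga' L M nu rho sL sR t : R) (A A' B B' : R -> R) (F : R -> R).
Hypothesis cmp : compatible al al' ga ga' L nu A A' B B'
    (ext rho (fun z => nu + sL * z + t * z ^+ 2) (fun z => sL + 2 * t * z))
    ((fun z => sL + 2 * t * z) \o clamp rho) (fun z => nu + sR * z) (fun=> sR).
Hypothesis ratio : A' 0 * sR = B' 0 * sL.
Hypothesis FE : forall x, `|x| <= rho -> F x = pw A B x.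
Hypothesis rho0 : 0 <= rho.
Local Notation G := (normal_form nu sL sR t).
Local Notation C := (ext rho (fun z => nu + sL * z + t * z ^+ 2) (fun z => sL + 2 * t * z)).
Local Notation C' := ((fun z => sL + 2 * t * z) \o clamp rho).
Local Notation D := (fun z => nu + sR * z).
Variable p : R.
Hypotheses (p0 : 0 < p) (Mp : M * p <= 2^-1) (Mnu : M * `|nu| <= p)
  (prho : 3 * ga' * p <= rho) (pnu : `|nu| <= ga' * p)
  (pnu' : (2 + ga') * `|nu| < (1 - al' * ga') * p).

Lemma p_le_rho : 2 * p <= rho.
Proof.
have [bcf _ _ _] := cmp; have [_ [? ? _ _]] := bc_consts bcf.
have : p <= ga' * p by rewrite ler_peMl ?ltW//; lra.
have p_gt0 := p0; have h := prho; lra.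
Qed.

(** M p <= 1/2 keeps the images of the endpoints within p / 2 of them, which fixes their signs and
    the enclosure by 2 p. *)
Lemma near_id_bounds h : near_id_at M nu h ->
  [/\ `|h (- p) + p| <= M * p * p, `|h p - p| <= M * p * p,
    - (2 * p) <= h (- p), h (- p) < 0 < h p & h p <= 2 * p].
Proof.
have p_gt0 := p0; have M1 := Mp; have M2 : M * p * p <= 2^-1 * p by rewrite (ler_wpM2r (ltW p0)).
move=> /(_ p p0) [||h1 h2]; [lra|exact: Mnu|].
rewrite expr2 mulrA in h1 h2; split=> //.
- by move: h1; rewrite ler_norml; lra.
- by move: h1 h2; rewrite !ler_norml; lra.
- by move: h2; rewrite ler_norml; lra.
Qed.

Hypothesis HM : forall (A0 A0' B0 B0' C0 C0' D0 D0' : R -> R),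
  compatible al al' ga ga' L nu A0 A0' B0 B0' C0 C0' D0 D0' -> A0' 0 * D0' 0 = B0' 0 * C0' 0 ->
  (forall xL yL : R, nu <= 0 -> A0 xL = xL -> C0 yL = yL -> A0' xL = C0' yL ->
    exists h, diff_conj (pw A0 B0) (pw C0 D0) setT h /\ near_id_at M nu h) /\
  (forall uL vL xR yR : R, 0 < nu -> B0 (A0 uL) = uL -> D0 (C0 vL) = vL ->
    B0 xR = xR -> D0 yR = yR -> B0' (A0 uL) * A0' uL = D0' (C0 vL) * C0' vL ->
    exists h, [/\ diff_conj (pw A0 B0) (pw C0 D0) [set x | x != xR] h,
      h xR = yR, h uL = vL & near_id_at M nu h]).

Lemma ratio' : A' 0 * (fun=> sR) (0 : R) = B' 0 * C' 0.
Proof. by rewrite /= (clamp0 rho0) mulr0 addr0. Qed.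

Lemma conj_nonpos x y : nu <= 0 -> A x = x -> `|y| <= rho ->
  nu + sL * y + t * y ^+ 2 = y -> A' x = sL + 2 * t * y ->
  exists q1 q2, [/\ `|q1 + p| <= M * p * p, `|q2 - p| <= M * p * p, q1 < 0 < q2
    & differentiably_conjugate F `]- p, p[ G `]q1, q2[].
Proof.
move=> n0 Ax yr Ey Ed; have [H _] := HM cmp ratio'.
have [||h [dc hM]] := H x y n0 Ax.
- by rewrite /ext (clamp_id yr) subrr mulr0 addr0.
- by rewrite /= (clamp_id yr).
have [h1 h2 h3 h4 h5] := near_id_bounds hM; have pr := p_le_rho.
have p_gt0 := p0.
exists (h (- p)), (h p); split=> //.
by apply: (local_conj_nonpos FE _ dc) => //; [move=> z zr; exact: normal_form_pw|lra|lra|lra].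
Qed.

Lemma conj_pos (Omega : set R) u x v : 0 < nu -> B (A u) = u -> B x = x -> `|v| <= rho ->
  nu + sR * (nu + sL * v + t * v ^+ 2) = v ->
  B' (A u) * A' u = sR * (sL + 2 * t * v) -> B' x = sR ->
  (forall x, `|x| <= rho -> Omega x) ->
  exists q1 q2, [/\ `|q1 + p| <= M * p * p, `|q2 - p| <= M * p * p, q1 < 0 < q2
    & let N := [set` `]- p, p[] in let V := [set` `]q1, q2[] in
      exists xR uL uR yR vL vR : R,
      [/\ [/\ 0 < xR, fixed_points F N = [set xR],
             uL < 0 < uR & period_two_points F N = [set uL; uR]],
         [/\ 0 < yR, fixed_points G V = [set yR],
             vL < 0 < vR & period_two_points G V = [set vL; vR]],
         differentiably_conjugate F (N `&` basin_of_repulsion F N xR)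
           G (V `&` basin_of_repulsion G V yR)
       & differentiably_conjugate F (N `&` basin_of_attraction F Omega [set uL; uR])
           G (V `&` basin_of_attraction G setT [set vL; vR])]].
Proof.
move=> n0 Eu Ex vr Ev Em Er HO; have [_ H] := HM cmp ratio'; have [bcf bcg _ _] := cmp.
have [_ [? ? _ _]] := bc_consts bcf.
have sR1 : sR < -1 by have := bcB' bcg 0; move=> /=; lra.
have Cv : C v = nu + sL * v + t * v ^+ 2 by rewrite /ext (clamp_id vr) subrr mulr0 addr0.
have DCv : D (C v) = v by rewrite Cv.
have Dy : D (nu / (1 - sR)) = nu / (1 - sR).
  by field; rewrite gt_eqF//; lra.
have E : B' (A u) * A' u = (fun=> sR) (C v) * C' v by rewrite Em /= (clamp_id vr).
have [h [dc hx hu hM]] := H u v x _ n0 Eu DCv Ex Dy E.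
have [h1 h2 h3 h4 h5] := near_id_bounds hM; have pr := p_le_rho.
have p_gt0 := p0; have pr' := prho; have pn := pnu; have pn' := pnu'.
rewrite gtr0_norm// in pn pn'.
exists (h (- p)), (h p); split=> //.
have GE z : `|z| <= rho -> G z = pw C D z by exact: normal_form_pw.
have nr : nu + ga' * (2 * p) <= rho by lra.
have := local_conj_pos bcf bcg FE GE ratio' n0 Eu DCv Ex Dy Er dc hx hu p0 h3 h5 nr pn' HO.
by move=> X; exists x, u, (A u), (nu / (1 - sR)), v, (C v); exact: X.
Qed.

End OneParameter.
End Assembly.

(** * Choice of the constants and conclusion *)

Section FromHypotheses.
Variable R : realType.
Implicit Types (mu x y : R).

Lemma bigO_affine (s : R -> R) (a C : R) : 0 <= C ->
  (\forall mu \near (0 : R), `|s mu - a| <= C * `|mu|) -> s = cst a +O_ (0 : R) id.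
Proof.
move=> C0 H; apply/eqaddOP; exists C; split; first exact: num_real.
move=> k Ck; apply: filterS H => mu /le_trans; apply.
by rewrite ler_wpM2r// ltW.
Qed.

Lemma near0_ball (P : R -> Prop) : (\forall mu \near (0 : R), P mu) ->
  exists2 m : R, 0 < m & forall mu, `|mu| < m -> P mu.
Proof.
move=> /nbhs_ballP[m /= m0 H]; exists m => // mu mm; apply: H.
by rewrite /ball/= sub0r normrN.
Qed.

Lemma setting_exists (Omega I : set R) (openOmega : open Omega) (Omega0 : Omega 0)
    (openI : open I) (I0 : I 0) (fL fR : R * R -> R) (f : R -> R -> R)
    (f_pwC3 : piecewise_C 3 Omega I fL fR f)
    (f_match : forall mu : R, I mu -> fL (0, mu) = fR (0, mu)) (fL00 : fL (0, 0) = 0)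
    (aL aR beta : R) (aLE : aL = pderiv_x fL (0, 0)) (aRE : aR = pderiv_x fR (0, 0))
    (betaLE : beta = pderiv_mu fL (0, 0))
    (beta_gt0 : 0 < beta) (aR_lt : aR < -1) (aL_bnd : aR^-1 < aL < 0) :
  exists eps K a2L a2R r : R, exists (nu : R -> R) (A A' B B' : R -> R -> R),
    [/\ setting eps K aL aR a2L a2R beta r nu A A' B B',
      forall x, `|x| <= r -> Omega x, forall mu, `|mu| <= r -> I mu
    & forall mu x, `|mu| <= r -> `|x| <= r -> f x mu = pw (A mu) (B mu) x /\ f 0 mu = nu mu].
Proof.
have [eps [eps0 bnd]] := slope_margin aR_lt aL_bnd.
have [[UL [oUL sUL CL]] [UR [oUR sUR CR]] EL ER] := f_pwC3.
have UL0 : UL (0, 0) by apply: sUL; split.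
have UR0 : UR (0, 0) by apply: sUR; split.
have [rL [KL [a2L [rL0 KL0 HL]]]] := family_exists oUL UL0 CL eps0.
have [rR [KR [a2R [rR0 KR0 HR]]]] := family_exists oUR UR0 CR eps0.
have near_of (X : set R) : open X -> X 0 -> exists2 m : R, 0 < m & forall x, `|x| < m -> X x.
  by move=> oX X0; apply: near0_ball; exact: open_nbhs_nbhs.
have [rO rO0 HO] := near_of _ openOmega Omega0.
have [rI rI0 HI] := near_of _ openI I0.
have dmu : is_derive (0 : R) 1 (fun mu => fL (0, mu)) beta.
  rewrite betaLE; apply: slice_mu.
  by have [_ [_ h _ _]] := CL; apply: h; rewrite inE.
have b2 : 0 < beta / 2 by rewrite divr_gt0.
have [rb rb0 Hb] := (is_derive_epsP _ _ _).1 dmu _ b2.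
pose r := Num.min (Num.min rL rR) (Num.min (Num.min (rO / 2) (rI / 2)) (rb / 2)).
have r0 : 0 < r by rewrite !lt_min rL0 rR0 !divr_gt0.
have [r1 r2] : r <= rL /\ r <= rR by rewrite !ge_min !lexx ?orbT.
have [r3 r4] : r <= rO / 2 /\ r <= rI / 2 by rewrite !ge_min !lexx ?orbT.
have r5 : r <= rb / 2 by rewrite !ge_min !lexx ?orbT.
clearbody r.
have Or x : `|x| <= r -> Omega x by move=> xr; apply: HO; lra.
have Ir x : `|x| <= r -> I x by move=> xr; apply: HI; lra.
have [FL ELf] := HL r r0 r1; have [FR ERf] := HR r r0 r2.
rewrite -aLE in FL; rewrite -aRE in FR.
have Enu : (fun mu => fR (0, clamp r mu)) = (fun mu => fL (0, clamp r mu)).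
  by apply/funext => mu; rewrite f_match//; apply: Ir; exact: clamp_bound (ltW r0).
rewrite Enu in FR.
exists eps, (Num.max KL KR), a2L, a2R, r, (fun mu => fL (0, clamp r mu)).
exists (famA fL r), (famA' fL r), (famA fR r), (famA' fR r).
have z0 : `|0 : R| <= r by rewrite normr0 ltW.
split=> //; last first.
  move=> mu x mr xr; split; last first.
    by rewrite (clamp_id mr) EL//; exact: Ir.
  rewrite /pw; have [x0|/ltW x0] := leP x 0.
    by rewrite ELf// EL//; [exact: Or|exact: Ir].
  by rewrite ERf// ER//; [exact: Or|exact: Ir].
split=> //.
- by apply: familyW FL; rewrite le_max lexx.
- by apply: familyW FR; rewrite le_max lexx orbT.
- move=> mu mr; rewrite (clamp_id mr).
  have := Hb mu; rewrite fL00 !subr0; apply; lra.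
Qed.

Lemma relative_size (delta p M q1 q2 : R) : 0 < p -> 0 < delta -> M * p <= delta / 2 ->
  `|q1 + p| <= M * p * p -> `|q2 - p| <= M * p * p -> q1 < 0 -> 0 < q2 ->
  (1 - delta) * p < `|q1| < (1 + delta) * p /\ (1 - delta) * p < `|q2| < (1 + delta) * p.
Proof.
move=> p0 d0 Mp h1 h2 h3 h4.
have h5 : M * p * p <= delta / 2 * p by rewrite (ler_wpM2r (ltW p0)).
have dp : 0 < delta * p by rewrite mulr_gt0.
rewrite (ltr0_norm h3) (gtr0_norm h4).
move: h1 h2; rewrite !ler_norml => /andP[? ?] /andP[? ?].
by split; lra.
Qed.

Lemma normal_form_conjugacies (Omega I : set R) (f : R -> R -> R)
    (eps K aL aR a2L a2R beta r : R) (nu : R -> R) (A A' B B' : R -> R -> R)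
    (S : setting eps K aL aR a2L a2R beta r nu A A' B B')
    (Or : forall x, `|x| <= r -> Omega x) (Ir : forall mu, `|mu| <= r -> I mu)
    (fE : forall mu x, `|mu| <= r -> `|x| <= r ->
      f x mu = pw (A mu) (B mu) x /\ f 0 mu = nu mu) :
  exists sL sR t : R -> R,
    (sL = cst aL +O_ (0 : R) id /\ sR = cst aR +O_ (0 : R) id) /\
    forall delta : R, 0 < delta ->
      exists (mu0 p : R) (qm qp : R -> R),
        conjugate_to_normal_form Omega I f sL sR t mu0 `]- p, p[
          (fun mu => `]qm mu, qp mu[%classic)
        /\ forall mu : R, - mu0 < mu < mu0 ->
             (1 - delta) * p < `|qm mu| < (1 + delta) * p
             /\ (1 - delta) * p < `|qp mu| < (1 + delta) * p.
Proof.
have [sL [sR [t [C [T [[C0 T0] Hc Hb Hsol]]]]]] := parameters_exist S.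
exists sL, sR, t; split.
  by split; apply: bigO_affine C0 _; apply: filterS Hb => mu [].
move=> delta delta0.
have bc := setting_bcmap S; have bnd := bc_bounds (bc 0).
have [[al0 al1 _] [ga1 ga2 th0 th1]] := bc_consts (bc 0).
have K0 := C11_K_ge0 (bcA (bc 0)).
have eps0 := set_eps S; have r0 := set_r S; have b0 := set_beta S.
(* A common constant for f and the normal form: [4 * T] serves the quadratic branch, and the last
   term converts slope errors (C + K) |mu| into multiples of |nu|, through |mu| <= (2 / beta)
   |nu|. *)
pose L := K + 4 * T + (C + K) * (2 / beta).
have [L0 KL TL CL] : [/\ 0 <= L, K <= L, 4 * T <= L & (C + K) * (2 / beta) <= L].
  have h1 : 0 <= (C + K) * (2 / beta) by rewrite mulr_ge0 ?addr_ge0// divr_ge0// ltW.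
  have h2 : 0 <= 4 * T by rewrite mulr_ge0.
  have h3 := addr_ge0 K0 h2.
  split; [exact: addr_ge0|by rewrite /L -addrA lerDl addr_ge0| |by rewrite lerDr].
  by apply: (@le_trans _ _ (K + 4 * T)); [rewrite lerDr|rewrite lerDl].
clearbody L.
have al'0 : 0 < - aL + eps := lt_le_trans al0 al1.
have g1 : 0 < - aR + eps := lt_trans ltr01 (lt_le_trans ga1 ga2).
have [M [M0 HM]] := conj_with_size bnd L0 al'0 g1.
(* Half of the slope margin [eps] is spent on the variation 2 T rho of the quadratic slope; the
   other half absorbs C |mu|. *)
pose rho := Num.min r (eps / (4 * (T + 1))).
have T1 : 0 < 4 * (T + 1) by rewrite mulr_gt0// ltr_wpDl.
have rho0 : 0 < rho by rewrite lt_min r0 divr_gt0.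
have rho_r : rho <= r by rewrite ge_min lexx.
have rho_e : 2 * T * rho <= eps / 2.
  have : rho * (4 * (T + 1)) <= eps by rewrite -ler_pdivlMr// ge_min lexx orbT.
  by clear - eps0 rho0; lra.
clearbody rho.
have ga0 : 0 < 3 * (- aR + eps) by rewrite mulr_gt0.
(* The three terms give, in turn, control of the endpoints, the relative size delta, and room for
   orbits inside the ball of radius [rho]. *)
pose p := Num.min (Num.min (2^-1 / M) (delta / 2 / M)) (rho / (3 * (- aR + eps))).
have p0 : 0 < p by rewrite !lt_min !divr_gt0.
have Mp1 : M * p <= 2^-1 by rewrite mulrC -ler_pdivlMr// !ge_min lexx.
have Mp2 : M * p <= delta / 2 by rewrite mulrC -ler_pdivlMr// !ge_min lexx !orbT.
have prho : 3 * (- aR + eps) * p <= rho by rewrite mulrC -ler_pdivlMr// !ge_min lexx !orbT.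
clearbody p.
have nu_small (e : R) : 0 < e -> \forall mu \near (0 : R), `|nu mu| <= e.
  move=> e0; have := near0_le (nu_continuous S (x := 0)) (nu0 S) e0.
  by apply: filterS => mu; rewrite subr0.
(* The three smallness conditions on [nu] once p is fixed; the factor 2 in the last denominator
   makes the resulting inequality strict. *)
have n1 : 0 < Num.min (p / M) (Num.min ((- aR + eps) * p)
    ((1 - (- aL + eps) * (- aR + eps)) * p / (2 * (2 + (- aR + eps))))).
  have g2 : 0 < 2 * (2 + (- aR + eps)) by rewrite mulr_gt0// addr_gt0.
  have th1' : 0 < 1 - (- aL + eps) * (- aR + eps) by rewrite subr_gt0.
  rewrite !lt_min; apply/and3P; split; first exact: divr_gt0.
    exact: mulr_gt0.
  by apply: divr_gt0 => //; exact: mulr_gt0.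
have Cmu : \forall mu \near (0 : R), `|mu| <= eps / 2 / (C + 1).
  have e0 : 0 < eps / 2 / (C + 1) by rewrite !divr_gt0// ltr_wpDl.
  have := @near0_le R id 0 _ (@cvg_id _ _) erefl e0.
  by apply: filterS => mu; rewrite subr0.
have [mu0 mu00 Hmu] := near0_ball (filterI (filterI (filterI (near_small S) Cmu) (filterI Hc Hb))
  (filterI (nu_small _ n1) (Hsol rho rho0))).
(* The endpoints of M(mu) are chosen pointwise in mu; outside |mu| < mu0 the pair (0, 0) is a dummy
   value. *)
have Hq mu : exists q : R * R, `|mu| < mu0 ->
    [/\ `|q.1 + p| <= M * p * p, `|q.2 - p| <= M * p * p, q.1 < 0 < q.2
      & (mu <= 0 -> differentiably_conjugate (fun x => f x mu) `]- p, p[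
          (normal_form (f 0 mu) (sL mu) (sR mu) (t mu)) `]q.1, q.2[) /\
        (0 < mu -> let N := [set` `]- p, p[] in let V := [set` `]q.1, q.2[] in
          let F x := f x mu in let G := normal_form (f 0 mu) (sL mu) (sR mu) (t mu) in
      exists xR uL uR yR vL vR : R,
      [/\ [/\ 0 < xR, fixed_points F N = [set xR],
             uL < 0 < uR & period_two_points F N = [set uL; uR]],
         [/\ 0 < yR, fixed_points G V = [set yR],
             vL < 0 < vR & period_two_points G V = [set vL; vR]],
         differentiably_conjugate F (N `&` basin_of_repulsion F N xR)
           G (V `&` basin_of_repulsion G V yR)
       & differentiably_conjugate F (N `&` basin_of_attraction F Omega [set uL; uR])
           G (V `&` basin_of_attraction G setT [set vL; vR])])].
  have [mm|] := ltP `|mu| mu0; last by exists (0, 0).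
  have [[[mr mC] [_ [b1 b2 b3 ratio]]] [+ [s1 s2]]] := Hmu mu mm.
  rewrite !le_min => /andP[m1 /andP[m2 m3]].
  have z0 : `|0 : R| <= r by rewrite normr0 ltW.
  have [_ f0] := fE mu 0 mr z0; rewrite f0.
  have Mnu : M * `|nu mu| <= p by rewrite mulrC -ler_pdivlMr.
  have thp : 0 < (1 - (- aL + eps) * (- aR + eps)) * p by rewrite mulr_gt0// subr_gt0.
  have pnu : (2 + (- aR + eps)) * `|nu mu| < (1 - (- aL + eps) * (- aR + eps)) * p.
    have g2 : 0 < 2 * (2 + (- aR + eps)) by rewrite mulr_gt0// addr_gt0.
    by move: m3; rewrite ler_pdivlMr//; clear - thp; lra.
  have Ce : C * `|mu| <= eps / 2.
    have C1 : 0 < C + 1 by rewrite ltr_wpDl.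
    move: mC; rewrite ler_pdivlMr// => h.
    by apply: le_trans h; rewrite mulrC ler_wpM2l// lerDl.
  have /andP[nl _] := nu_bounds S mr.
  have mul : `|mu| <= 2 / beta * `|nu mu|.
    rewrite -(ler_pM2l (_ : 0 < beta / 2)) ?divr_gt0//.
    by have -> : beta / 2 * (2 / beta * `|nu mu|) = `|nu mu| by field; rewrite gt_eqF.
  have dl (s a a' : R) : `|s - a| <= C * `|mu| -> `|a' - a| <= K * `|mu| -> `|s - a'| <= L * `|nu mu|.
    move=> h1 h2; have -> : s - a' = (s - a) - (a' - a) by ring.
    rewrite (le_trans (ler_normB _ _))//.
    have h3 : (C + K) * `|mu| <= (C + K) * (2 / beta * `|nu mu|) by rewrite ler_wpM2l// addr_ge0.
    have h4 : (C + K) * (2 / beta) * `|nu mu| <= L * `|nu mu| by rewrite ler_wpM2r.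
    by apply: le_trans h4; rewrite -mulrA; apply: le_trans h3; rewrite mulrDl lerD.
  have cmp : compatible (- aL - eps) (- aL + eps) (- aR - eps) (- aR + eps) L (nu mu)
      (A mu) (A' mu) (B mu) (B' mu)
      (ext rho (fun z => nu mu + sL mu * z + t mu * z ^+ 2) (fun z => sL mu + 2 * t mu * z))
      ((fun z => sL mu + 2 * t mu * z) \o clamp rho) (fun z => nu mu + sR mu * z) (fun=> sR mu).
    move: (b1) (b2); rewrite !ler_norml => /andP[x1 x2] /andP[x3 x4].
    apply: (normal_form_compatible (bc mu) (ltW rho0) T0 b3 KL TL).
    - by clear - rho_e Ce x1 x2; lra.
    - by clear - rho_e Ce x1 x2; lra.
    - by clear - eps0 Ce x3 x4; lra.
    - exact: dl b1 (fam_a (set_A S) mu).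
    - exact: dl b2 (fam_a (set_B S) mu).
  have FE x : `|x| <= rho -> f x mu = pw (A mu) (B mu) x.
    by move=> xr; apply: (fE mu x mr _).1; exact: le_trans rho_r.
  have HM' := fun A0 A0' B0 B0' C1 C1' D0 D0' => HM (nu mu) A0 A0' B0 B0' C1 C1' D0 D0'.
  have [mu_le|mu_gt] := leP mu 0.
    have [x [y [Ax yr Ey Ed]]] := s1 mu_le.
    have n0 : nu mu <= 0 by rewrite leNgt (nu_sign S mr).1 -leNgt.
    have [q1 [q2 [h1 h2 h3 h4]]] := conj_nonpos cmp ratio FE (ltW rho0) p0 Mp1 Mnu prho HM' n0 Ax yr Ey Ed.
    by exists (q1, q2).
  have [u [x [v [[Eu Ex] vr Ev Em Er]]]] := s2 mu_gt.
  have n0 : 0 < nu mu by rewrite (nu_sign S mr).1.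
  have Orho x' : `|x'| <= rho -> Omega x' by move=> xr; apply: Or; exact: le_trans rho_r.
  have [q1 [q2 [h1 h2 h3 h4]]] := conj_pos cmp ratio FE (ltW rho0) p0 Mp1 Mnu prho m2 pnu HM'
    n0 Eu Ex vr Ev Em Er Orho.
  by exists (q1, q2).
have [q {}Hq] := choice Hq.
have inmu mu : - mu0 < mu < mu0 -> `|mu| < mu0 by rewrite ltr_norml.
have inmu' mu : mu \in `]- mu0, mu0[ -> `|mu| < mu0 by rewrite in_itv/=; exact: inmu.
exists mu0, p, (fun mu => (q mu).1), (fun mu => (q mu).2); split; last first.
  move=> mu /inmu mm; have [h1 h2 /andP[h3 h4] _] := Hq mu mm.
  exact: relative_size p0 delta0 Mp2 h1 h2 h3 h4.
split.
- split=> // mu /inmu' mm; have [[[mr _] _] _] := Hmu mu mm; exact: Ir.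
- by split=> mu /inmu' mm; have [[_ [[c1 c2 c3] _]] _] := Hmu mu mm.
- split; first by split; [exact: interval_open|rewrite /= in_itv/= oppr_lt0 p0].
  move=> x /=; rewrite in_itv/= => /andP[x1 x2]; apply: Or; apply: le_trans rho_r.
  have pp : p <= (- aR + eps) * p by rewrite ler_peMl ?(ltW p0)// (le_trans (ltW ga1)).
  by rewrite ler_norml; clear - pp prho p0 x1 x2; lra.
- move=> mu /inmu mm; have [_ _ h3 _] := Hq mu mm.
  by split; [exact: interval_open|rewrite /= in_itv].
- split=> mu /andP[mu1 mu2].
    have mm : `|mu| < mu0 by rewrite ltr_norml mu1 (le_lt_trans mu2).
    by have [_ _ _ [h _]] := Hq mu mm; exact: h.
  have mm : `|mu| < mu0 by rewrite gtr0_norm.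
  by have [_ _ _ [_ h]] := Hq mu mm; exact: h.
Qed.

End FromHypotheses.

Theorem theorem2p3 (R : realType) (Omega I : set R)
    (openOmega : open Omega) (itvOmega : is_interval Omega) (Omega0 : Omega 0)
    (openI : open I) (itvI : is_interval I) (I0 : I 0)
    (fL fR : R * R -> R) (f : R -> R -> R)
    (f_pwC3 : piecewise_C 3 Omega I fL fR f)
    (f_match : forall mu : R, I mu -> fL (0, mu) = fR (0, mu))
    (fL00 : fL (0, 0) = 0) (fR00 : fR (0, 0) = 0)
    (aL aR beta : R)
    (aLE : aL = pderiv_x fL (0, 0)) (aRE : aR = pderiv_x fR (0, 0))
    (betaLE : beta = pderiv_mu fL (0, 0)) (betaRE : beta = pderiv_mu fR (0, 0))
    (beta_gt0 : 0 < beta) (aR_lt : aR < -1) (aL_bnd : aR^-1 < aL < 0) :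
  exists sL sR t : R -> R,
    [/\ sL = cst aL +O_ (0 : R) id
          /\ sR = cst aR +O_ (0 : R) id,
        exists (mu0 : R) (N : set R) (M : R -> set R),
          conjugate_to_normal_form Omega I f sL sR t mu0 N M
      & forall delta : R, 0 < delta ->
          exists (mu0 p : R) (qm qp : R -> R),
            conjugate_to_normal_form Omega I f sL sR t mu0 `]- p, p[
              (fun mu => `]qm mu, qp mu[%classic)
            /\ forall mu : R, - mu0 < mu < mu0 ->
                 (1 - delta) * p < `|qm mu| < (1 + delta) * p
                 /\ (1 - delta) * p < `|qp mu| < (1 + delta) * p].
Proof.
have [eps [K [a2L [a2R [r [nu [A [A' [B [B' [S Or Ir fE]]]]]]]]]]] :=
  setting_exists openOmega Omega0 openI I0 f_pwC3 f_match fL00 aLE aRE betaLE beta_gt0 aR_lt aL_bnd.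
have [sL [sR [t [sO H]]]] := normal_form_conjugacies S Or Ir fE.
exists sL, sR, t; split=> //.
(* Any delta serves here; s_L, s_R and t were fixed before it. *)
have [mu0 [p [qm [qp [Hc _]]]]] := H 1 ltr01.
by exists mu0, `]- p, p[%classic, (fun mu => `]qm mu, qp mu[%classic).
Qed.
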